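(* Let $0\neq p(x)\in\mathbb C((x))$, $\phi(x,z)=e^{zp(x)\frac{d}{dx}}(x)$. Let $G$ be a group with linear characters $\chi,\chi_\phi:G\to\mathbb C^\times$ satisfying $\phi(x,\chi(g)z)=\chi_\phi(g)\phi(\chi_\phi(g)^{-1}x,z)$ for all $g\in G$, and assume that $\chi_\phi$ is injective. Let $W$ be a complex vector space and let $S$ be a $\chi_\phi(G)$-stable and $\chi_\phi(G)$-quasi local subset of $\mathcal E(W)=\mathrm{Hom}(W,W((z)))$. Then the vertex algebra $\langle S\rangle_\phi$ together with the group homomorphism $$R:G\to\mathrm{GL}(\langle S\rangle_\phi),\qquad R_g(a(z))=a(\chi_\phi(g)^{-1}z),$$ is a $(G,\chi)$-vertex algebra, and $W$ is a faithful $(G,\chi_\phi)$-equivariant $\phi$-coordinated quasi $\langle S\rangle_\phi$-module with $Y_W(a(z),z_0)=a(z_0)$ for $a(z)\in\langle S\rangle_\phi$.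
   Context: $\phi(x,z)=\sum_{n\ge0}\frac{z^n}{n!}\left(p(x)\frac{d}{dx}\right)^n(x)\in\mathbb C((x))[[z]]$. $W((z_1,z_2))=W[[z_1,z_2]][z_1^{-1},z_2^{-1}]$; for $A(z_1,z)\in\mathrm{Hom}(W,W((z_1,z)))$, $A(z_1,z)|_{z_1=\phi(z,z_0)}=\left(e^{z_0p(z_1)\partial/\partial z_1}A(z_1,z)\right)|_{z_1=z}$. For a subgroup $\Gamma\le\mathbb C^\times$, $\mathbb C_\Gamma[z]$ is the set of monic polynomials in $\mathbb C[z]$ all of whose roots lie in $\Gamma$. A subset $S\subset\mathcal E(W)$ is $\Gamma$-quasi local if for all $a(z),b(z)\in S$ there is $q(z)\in\mathbb C_\Gamma[z]$ with $q(z_1/z_2)[a(z_1),b(z_2)]=0$; it is $\Gamma$-stable if $a(\lambda z)\in S$ for all $a(z)\in S$, $\lambda\in\Gamma$. A pair $(a(z),b(z))$ in $\mathcal E(W)$ is quasi local if $q(z_1,z_2)[a(z_1),b(z_2)]=0$ for some nonzero $q\in\mathbb C[z_1,z_2]$; a subset is quasi local if all its pairs are. For a quasi local pair with such $q$, define $Y_{\mathcal E}^\phi(a(z),z_0)b(z)=\sum_{n\in\mathbb Z}a(z)_n^\phi b(z)z_0^{-n-1}=q(\phi(z,z_0),z)^{-1}\left(q(z_1,z)a(z_1)b(z)\right)|_{z_1=\phi(z,z_0)}\in\mathcal E(W)((z_0))$, the inverse taken in $\mathbb C((z))((z_0))$ (independent of $q$). A quasi local subspace $U$ is $Y_{\mathcal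 E}^\phi$-closed if $a(z)_n^\phi b(z)\in U$ for $a(z),b(z)\in U$, $n\in\mathbb Z$. $\langle S\rangle_\phi$ is the smallest $Y_{\mathcal E}^\phi$-closed quasi local subspace of $\mathcal E(W)$ containing $S$ and $1_W$; $(\langle S\rangle_\phi,Y_{\mathcal E}^\phi,1_W)$ is a vertex algebra. A $(G,\chi)$-vertex algebra is a pair $(V,R)$ of a vertex algebra $(V,Y,\mathbf 1)$ and a group homomorphism $R:G\to\mathrm{GL}(V)$ with $R_g(\mathbf 1)=\mathbf 1$ and $R_gY(v,z)R_g^{-1}=Y(R_g(v),\chi(g)z)$. A $\phi$-coordinated quasi $V$-module is a vector space $W$ with a linear map $Y_W(\cdot,z):V\to\mathrm{Hom}(W,W((z)))$ such that $Y_W(\mathbf 1,z)=1_W$ and for all $u,v\in V$ there is a nonzero $f(z_1,z_2)\in\mathbb C[z_1,z_2]$ with $f(z_1,z_2)Y_W(u,z_1)Y_W(v,z_2)\in\mathrm{Hom}(W,W((z_1,z_2)))$ and $f(\phi(z_2,z_0),z_2)Y_W(Y(u,z_0)v,z_2)=\left(f(z_1,z_2)Y_W(u,z_1)Y_W(v,z_2)\right)|_{z_1=\phi(z_2,z_0)}$. It is faithful if $v\mapsto Y_W(v,z)$ is injective. It is $(G,\chi_\phi)$-equivariant if $Y_W(R_gv,z)=Y_W(v,\chi_\phi(g)^{-1}z)$ for $g\in G,v\in V$, and for all $u,v\in V$ there is $q(z)\in\mathbb C_{\chi_\phi(G)}[z]$ with $q(z_1/z_2)Y_W(u,z_1)Y_W(v,z_2)\in\mathrm{Hom}(W,W((z_1,z_2)))$.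 *)

(* Defs.v *)
From HB Require Import structures.
From mathcomp Require Import all_boot all_order all_algebra.
From mathcomp Require Import mathcomp_extra boolp classical_sets functions.
From mathcomp Require Import cardinality fsbigop reals complex.
From mathcomp Require Import zify.

Set Implicit Arguments.
Unset Strict Implicit.
Unset Printing Implicit Defensive.

Import Order.TTheory GRing.Theory Num.Theory.
Local Open Scope classical_set_scope.
Local Open Scope ring_scope.

Section LaurentSeries.
Variable F : fieldType.

(* A series with coefficients in V is a function f : int -> V, where f n is the
   coefficient of x^n; it is in V((x)) when it is bounded below.            *)
Definition bounded_below (V : nmodType) (f : int -> V) : Prop :=
  exists N : int, forall n, n < N -> f n = 0.

Definition laurent_pred : {pred (int -> F)} := fun f => `[< bounded_below f >].

Fact laurent_zmod_closed : zmod_closed laurent_pred.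
Proof.
split=> [|f g /asboolP[N fN] /asboolP[M gM]]; apply/asboolP; first by exists 0.
exists (Num.min N M) => n; rewrite lt_min => /andP[nN nM].
by rewrite -[LHS]/(f n - g n) fN// gM// subr0.
Qed.
HB.instance Definition _ :=
  GRing.isZmodClosed.Build (int -> F) laurent_pred laurent_zmod_closed.

(* F((x)) *)
Record laurent := Laurent { lcoef :> int -> F ; _ : lcoef \in laurent_pred }.

HB.instance Definition _ := [isSub for lcoef].
HB.instance Definition _ := [Choice of laurent by <:].
HB.instance Definition _ := [SubChoice_isSubZmodule of laurent by <:].

Lemma laurentP (f : laurent) : bounded_below f.
Proof. by case: f => f /= /asboolP. Qed.

Lemma eq_laurent (f g : laurent) : f =1 g -> f = g.
Proof. by move=> fg; apply: val_inj; apply/funext. Qed.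

Definition mk_laurent (f : int -> F) (hf : bounded_below f) : laurent :=
  Laurent (introT (asboolP _) hf : f \in laurent_pred).

Definition zrange (N : int) (K : nat) : seq int :=
  [seq N + k%:Z | k <- iota 0 K].

Lemma mem_zrange N K i : (i \in zrange N K) = (N <= i < N + K%:Z).
Proof.
apply/mapP/idP => [[k]|/andP[Ni iK]].
  by rewrite mem_iota => /andP[_ kK] ->; lia.
exists (absz (i - N)%R); last by lia.
by rewrite mem_iota; lia.
Qed.

Lemma zrange_uniq N K : uniq (zrange N K).
Proof.
by rewrite map_inj_uniq ?iota_uniq// => i j /addrI; lia.
Qed.

Lemma fsum_seq (V : nmodType) (r : seq int) (f : int -> V) : uniq r ->
  (forall i, i \notin r -> f i = 0) ->
  \sum_(i \in [set: int]) f i = \sum_(i <- r) f i.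
Proof.
move=> ur f0; rewrite (fsbigE r)//; last by move=> i _; exact: f0.
by apply: eq_bigl => i; rewrite in_setT.
Qed.

Definition lmul_fun (f g : laurent) : int -> F :=
  fun n => \sum_(i \in [set: int]) f i * g (n - i).

Lemma lmul_seq (f g : laurent) N M n K :
  (forall i, i < N -> f i = 0) -> (forall i, i < M -> g i = 0) ->
  n < N + M + K%:Z ->
  lmul_fun f g n = \sum_(i <- zrange N K) f i * g (n - i).
Proof.
move=> fN gM nK; apply: fsum_seq; first exact: zrange_uniq.
move=> i; rewrite mem_zrange negb_and -ltNge -leNgt => /orP[iN|iK].
  by rewrite fN ?mul0r.
by rewrite gM ?mulr0//; lia.
Qed.

Fact lmul_bdd f g : bounded_below (lmul_fun f g).
Proof.
have [N fN] := laurentP f; have [M gM] := laurentP g.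
by exists (N + M) => n nNM; rewrite (lmul_seq (K := 0) fN gM) ?big_nil//; lia.
Qed.

Definition lmul f g := mk_laurent (lmul_bdd f g).

(* c x^k *)
Fact lmonom_bdd (c : F) (k : int) : bounded_below (fun n => c *+ (n == k)).
Proof. by exists k => n nk; rewrite (_ : n == k = false)//; lia. Qed.

Definition lmonom c k := mk_laurent (lmonom_bdd c k).

Fact lmulC : commutative lmul.
Proof.
move=> f g; apply: eq_laurent => n /=.
rewrite /lmul_fun (reindex_fsbigT (fun i : int => n - i)) /=; last first.
  by exists (fun i : int => n - i) => i; lia.
by apply: eq_fsbigr => i _; rewrite mulrC; congr (g _ * f _); lia.
Qed.

Fact lmulA : associative lmul.
Proof.
move=> f g h; apply: eq_laurent => n /=.
have [a fa] := laurentP f; have [b gb] := laurentP g; have [c hc] := laurentP h.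
pose K := absz (n - a - b - c + 1).
have gh0 i : i < b + c -> lmul g h i = 0.
  by move=> ilt /=; rewrite (lmul_seq (K := 0) gb hc) ?big_nil//; lia.
have fg0 i : i < a + b -> lmul f g i = 0.
  by move=> ilt /=; rewrite (lmul_seq (K := 0) fa gb) ?big_nil//; lia.
rewrite (lmul_seq (K := K) fa gh0); last lia.
rewrite (lmul_seq (K := K) fg0 hc); last lia.
transitivity (\sum_(i <- zrange a K) \sum_(j <- zrange (a + b) K)
    f i * g (j - i) * h (n - j)).
  rewrite [LHS]big_seq [RHS]big_seq; apply: eq_bigr => i.
  rewrite mem_zrange => /andP[ai iK] /=.
  rewrite /lmul_fun (reindex_fsbigT (fun j : int => j - i)) /=; last first.
    by exists (fun j : int => j + i) => j; lia.
  rewrite (fsum_seq (r := zrange (a + b) K)) ?zrange_uniq//; last first.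
    move=> j; rewrite mem_zrange negb_and -ltNge -leNgt => /orP[jN|jK].
      by rewrite gb ?mul0r//; lia.
    by rewrite hc ?mulr0//; lia.
  rewrite mulr_sumr; apply: eq_bigr => j _; rewrite mulrA.
  by congr (_ * h _); lia.
rewrite exchange_big /=; rewrite [LHS]big_seq [RHS]big_seq; apply: eq_bigr => j.
rewrite mem_zrange => /andP[aj jK]; rewrite -mulr_suml.
case: (ltP j (n - c + 1)) => jn; last by rewrite hc ?mulr0//; lia.
by rewrite (lmul_seq (K := K) fa gb)//; lia.
Qed.

Fact lmul1 : left_id (lmonom 1 0) lmul.
Proof.
move=> f; apply: eq_laurent => n /=.
rewrite /lmul_fun (fsum_seq (r := [:: 0])) ?big_seq1 /=.
- by rewrite mul1r; congr (f _); lia.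
- by [].
- by move=> i; rewrite inE => /negbTE ->; rewrite mul0r.
Qed.

Fact lmulDl : left_distributive lmul +%R.
Proof.
move=> f g h; apply: eq_laurent => n.
have [a fa] := laurentP f; have [b gb] := laurentP g; have [c hc] := laurentP h.
pose N := Num.min a b.
have fN i : i < N -> f i = 0 by rewrite lt_min => /andP[/fa].
have gN i : i < N -> g i = 0 by rewrite lt_min => /andP[_ /gb].
have fgN i : i < N -> (f + g) i = 0.
  by move=> iN; rewrite -[(f + g) i]/(f i + g i) fN// gN// addr0.
rewrite -[RHS]/(lmul_fun f h n + lmul_fun g h n) -[LHS]/(lmul_fun (f + g) h n).
pose K := (absz (n - N - c + 1)%R).
rewrite (lmul_seq (K := K) fN hc) ?(lmul_seq (K := K) gN hc);
  rewrite ?(lmul_seq (K := K) fgN hc); try lia.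
by rewrite -big_split; apply: eq_bigr => i _; exact: mulrDl.
Qed.

Fact lone_neq0 : lmonom 1 0 != 0.
Proof.
apply/eqP => /(congr1 (fun f : laurent => f 0)) /= /eqP.
by rewrite mulr1n oner_eq0.
Qed.

HB.instance Definition _ := GRing.Zmodule_isComNzRing.Build laurent
  lmulA lmulC lmul1 lmulDl lone_neq0.

Section Inverse.
Variable u : nat -> F.

Fixpoint inv_seq n : seq F :=
  if n is m.+1 then
    rcons (inv_seq m)
      (- (u 0)^-1 * \sum_(k < m.+1) u k.+1 * (inv_seq m)`_(m - k))
  else [:: (u 0)^-1].

Lemma size_inv_seq n : size (inv_seq n) = n.+1.
Proof. by elim: n => //= n IH; rewrite size_rcons IH. Qed.

Lemma nth_inv_seq n m : (m <= n)%N -> (inv_seq n)`_m = (inv_seq m)`_m.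
Proof.
elim: n => [|n IH]; first by rewrite leqn0 => /eqP ->.
rewrite leq_eqVlt => /orP[/eqP -> //|mn].
by rewrite /= nth_rcons size_inv_seq mn IH.
Qed.

Lemma inv_seqP n : u 0 != 0 ->
  \sum_(k < n.+1) u k * (inv_seq (n - k))`_(n - k) = (n == 0)%:R.
Proof.
move=> u0; case: n => [|n]; first by rewrite big_ord1 /= mulfV.
rewrite big_ord_recl subn0 /= nth_rcons size_inv_seq ltnn eqxx.
rewrite mulrA mulrN mulfV// mulN1r addrC; apply/eqP; rewrite subr_eq0; apply/eqP.
apply: eq_bigr => k _; rewrite /bump /= add1n subSS.
by rewrite (nth_inv_seq (n := n)) ?leq_subr.
Qed.
End Inverse.

Fact laurent_invertible (f : laurent) : f != 0 -> exists g, g * f = 1.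
Proof.
move=> f0; have [N fN] := laurentP f.
have /ex_minnP[k fk kmin] : exists k : nat, f (N + k%:Z) != 0.
  apply: contrapT => /forallNP fz; move/eqP: f0; apply; apply: eq_laurent => n.
  have [/fN//|nN] := ltP n N.
  have /negP := fz (absz (n - N)%R); rewrite negbK (_ : N + _ = n); last by lia.
  by move/eqP.
pose M := N + k%:Z.
have fM n : n < M -> f n = 0.
  move=> nM; have [/fN//|nN] := ltP n N; apply/eqP/negPn/negP => fn.
  have := kmin (absz (n - N)%R); rewrite (_ : N + _ = n); last by lia.
  by move=> /(_ fn); rewrite /M in nM; lia.
pose u (j : nat) := f (M + j%:Z).
have u0 : u 0 != 0 by rewrite /u addr0.
pose gf (n : int) :=
  if n < - M then 0 else (inv_seq u (absz (n + M)%R))`_(absz (n + M)%R).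
have gM n : n < - M -> gf n = 0 by rewrite /gf => ->.
have gb : bounded_below gf by exists (- M).
exists (mk_laurent gb); rewrite mulrC; apply: eq_laurent => n.
rewrite -[LHS]/(lmul_fun f (mk_laurent gb) n).
have [n0|n0] := ltP n 0.
  rewrite (@lmul_seq f (mk_laurent gb) M (- M) n 0 fM gM) ?big_nil /=;
    last by lia.
  by rewrite (_ : n == 0 = false)//; lia.
rewrite (@lmul_seq f (mk_laurent gb) M (- M) n (absz n).+1 fM gM) /=;
  last by lia.
rewrite big_map -{1}[(absz n).+1]subn0 -/(index_iota 0 _) big_mkord.
rewrite (_ : (n == 0) = ((absz n) == 0%N)); last by lia.
rewrite -(inv_seqP (absz n) u0); apply: eq_bigr => j _ /=.
rewrite /gf ltNge (_ : - M <= _) /=; last by have := ltn_ord j; lia.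
rewrite /u; congr (f _ * nth _ _ _); first congr (inv_seq _ _);
  have := ltn_ord j; lia.
Qed.

Definition linv (f : laurent) : laurent := xget 0 [set g | g * f = 1].

Fact lmulVf (f : laurent) : f != 0 -> linv f * f = 1.
Proof. by move=> /laurent_invertible /(@xgetPex _ 0). Qed.

Fact linv0 : linv 0 = 0.
Proof.
rewrite /linv; case: xgetP => // g _ /=; rewrite mulr0 => /esym /eqP.
by rewrite oner_eq0.
Qed.

HB.instance Definition _ := GRing.ComNzRing_isField.Build laurent lmulVf linv0.

Definition lconst (c : F) : laurent := lmonom c 0.

Definition lseries_fun (c : nat -> F) : int -> F :=
  fun n => if n is Posz k then c k else 0.

Fact lseries_bdd c : bounded_below (lseries_fun c).
Proof. by exists 0; case. Qed.

(* \sum_(k >= 0) c_k x^k *)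
Definition lseries (c : nat -> F) : laurent := mk_laurent (lseries_bdd c).

Definition lpoly (q : {poly F}) : laurent := lseries (fun k => q`_k).

Fact lderiv_bdd (f : laurent) :
  bounded_below (fun n : int => (n + 1)%:~R * f (n + 1)).
Proof.
by have [N fN] := laurentP f; exists (N - 1) => n nN; rewrite fN ?mulr0//; lia.
Qed.

Definition lderiv (f : laurent) : laurent := mk_laurent (lderiv_bdd f).

Fact ldil_bdd (c : F) (f : laurent) : bounded_below (fun n : int => c ^ n * f n).
Proof. by have [N fN] := laurentP f; exists N => n nN; rewrite fN ?mulr0. Qed.

(* f(c x) *)
Definition ldil (c : F) (f : laurent) : laurent := mk_laurent (ldil_bdd c f).

End LaurentSeries.

Arguments lmonom {F}.
Arguments lconst {F}.

Section Phi.
Variables (K : fieldType) (p : laurent K).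

(* phi(x, z) = e^(z p(x) d/dx) x: the coefficient of z^n is in K((x)), and phi
   itself is regarded in K((x))((z)).                                        *)
Definition phi_coef (n : nat) : laurent K :=
  lconst (n`!%:R^-1) * iter n (fun f => p * lderiv f) (lmonom 1 1).

Definition phi : laurent (laurent K) := lseries phi_coef.

(* phi(x, c z) = d phi(d^-1 x, z), coefficientwise in z *)
Definition phi_covariant (c d : K) : Prop :=
  forall n : int, lconst (c ^ n) * phi n = lconst d * ldil d^-1 (phi n).

(* A polynomial q(z1, z2) is an element of {poly {poly K}} whose outer variable
   is z1 and whose inner variable is z2; this is q(phi(z, z0), z) in
   K((z))((z0)).                                                             *)
Definition poly_phi (q : {poly {poly K}}) : laurent (laurent K) :=
  (map_poly (fun r : {poly K} => lconst (lpoly r)) q).[phi].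

End Phi.

(* (End W)[[z, z^-1]] and (End W)[[z1, z1^-1, z2, z2^-1]], linearity being
   imposed in in_EW and in_EW2: a n is the coefficient of z^n (so not the
   mode a_n, which is the coefficient of z^(-n-1)), and A m n is the
   coefficient of z1^m z2^n.                                                 *)
Notation distr W := (int -> W -> W).
Notation distr2 W := (int -> int -> W -> W).

Section Fields.
Variables (K : fieldType) (W : lmodType K).
Implicit Types (a b : distr W) (A : distr2 W) (U S : set (distr W)).

(* E(W) = Hom(W, W((z))) *)
Definition in_EW a : Prop :=
  (forall n, linear (a n)) /\ forall w, bounded_below (fun n => a n w).

(* Hom(W, W((z1, z2))) *)
Definition in_EW2 A : Prop :=
  (forall m n, linear (A m n)) /\
  forall w, exists N : int, forall m n, (m < N) || (n < N) -> A m n w = 0.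

(* 1_W *)
Definition id_distr : distr W := fun n w => if n == 0 then w else 0.

(* a(c z) *)
Definition dil (c : K) a : distr W := fun n w => c ^ n *: a n w.

(* a(z1) b(z2) *)
Definition distr_prod a b : distr2 W := fun m n w => a m (b n w).

(* [a(z1), b(z2)] *)
Definition distr_comm a b : distr2 W :=
  fun m n w => a m (b n w) - b n (a m w).

(* q(z1, z2) A(z1, z2) *)
Definition poly2_mul (q : {poly {poly K}}) A : distr2 W := fun m n w =>
  \sum_(i < size q) \sum_(j < size q`_i) q`_i`_j *: A (m - i%:Z) (n - j%:Z) w.

(* q(z1 / z2) A(z1, z2) *)
Definition ratio_mul (q : {poly K}) A : distr2 W := fun m n w =>
  \sum_(k < size q) q`_k *: A (m - k%:Z) (n + k%:Z) w.

(* p(z1) d/dz1 A(z1, z2) *)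
Definition pderiv1 (p : laurent K) A : distr2 W := fun m n w =>
  \sum_(i \in [set: int]) p i *: ((m - i + 1)%:~R *: A (m - i + 1) n w).

(* A(z1, z)|_(z1 = phi(z, z0)) = (e^(z0 p(z1) d/dz1) A(z1, z))|_(z1 = z), as a
   series in z0; the inner sum is finite when A is in Hom(W, W((z1, z))).    *)
Definition subst_phi (p : laurent K) A : int -> distr W := fun k m w =>
  if k is Posz j then
    j`!%:R^-1 *: \sum_(i \in [set: int]) iter j (pderiv1 p) A i (m - i) w
  else 0.

(* f(z) a(z), for f in K((z)) and a in E(W); the sum is finite for each w, but
   not uniformly in w.                                                       *)
Definition laurent_act (f : laurent K) a : distr W := fun n w =>
  \sum_(i \in [set: int]) f i *: a (n - i) w.

(* f(z, z0) X(z, z0), for f in K((z))((z0)) and X in E(W)((z0)) *)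
Definition laurent2_act (f : laurent (laurent K)) (X : int -> distr W) :
    int -> distr W := fun n =>
  \sum_(i \in [set: int]) laurent_act (f i) (X (n - i)).

Definition qlocal_with (q : {poly {poly K}}) a b : Prop :=
  q != 0 /\ poly2_mul q (distr_comm a b) = 0.

Definition quasi_local U : Prop :=
  forall a b, U a -> U b -> exists q, qlocal_with q a b.

(* Y_E^phi(a(z), z0) b(z) as a series in z0, for a quasi local pair (a, b). It
   does not depend on the choice of q.                                       *)
Definition Yphi (p : laurent K) a b : int -> distr W :=
  let q := xget 0 [set q | qlocal_with q a b] in
  laurent2_act (poly_phi p q)^-1 (subst_phi p (poly2_mul q (distr_prod a b))).

(* a(z)_n^phi b(z) *)
Definition nprod (p : laurent K) a (n : int) b : distr W :=
  Yphi p a b (- n - 1).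

Definition closed_quasi_local_subspace (p : laurent K) U : Prop :=
  [/\ U `<=` in_EW, submod_closed (fun a => a \in U), quasi_local U &
      forall a b n, U a -> U b -> U (nprod p a n b)].

(* <S>_phi, as an intersection; it is the smallest closed quasi local subspace
   containing S and 1_W as soon as it is itself closed and quasi local.      *)
Definition generated (p : laurent K) S : set (distr W) :=
  \bigcap_(U in [set U | [/\ closed_quasi_local_subspace p U, S `<=` U &
                             U id_distr]]) U.

Definition poly_roots_in (Gam : set K) (q : {poly K}) : Prop :=
  q \is monic /\ forall x, root q x -> Gam x.

Definition gamma_quasi_local (Gam : set K) S : Prop :=
  forall a b, S a -> S b -> exists2 q, poly_roots_in Gam q &
    ratio_mul q (distr_comm a b) = 0.

Definition gamma_stable (Gam : set K) S : Prop :=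
  forall a c, S a -> Gam c -> S (dil c a).

Definition generated_pred (p : laurent K) S : {pred distr W} :=
  fun a => a \in generated p S.

Fact generated_submod p S : submod_closed (generated_pred p S).
Proof.
split=> [|c a b]; rewrite -!topredE /= /generated_pred !in_setE.
  by move=> U [[_ [U0 _] _ _] _ _]; have := U0; rewrite -topredE /= in_setE.
move=> aS bS U HU; have Ua := aS U HU; have Ub := bS U HU.
case: HU => -[_ [_ Ulin] _ _] _ _; have := Ulin c a b.
by rewrite -!topredE /= !in_setE; exact.
Qed.
HB.instance Definition _ p S := GRing.isSubmodClosed.Build K (distr W)
  (generated_pred p S) (generated_submod p S).

Record generated_space p S := GeneratedSpace {
  gval :> distr W ; _ : gval \in generated_pred p S }.

HB.instance Definition _ p S := [isSub for @gval p S].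
HB.instance Definition _ p S := [Choice of generated_space p S by <:].
HB.instance Definition _ p S :=
  [SubChoice_isSubLmodule of generated_space p S by <:].

End Fields.

Arguments id_distr {K} W.

Section VertexAlgebra.
Variables (K : fieldType) (V : lmodType K).
Implicit Types (Y : V -> int -> V -> V) (vac u v w : V).

(* binom(m, i), for m in Z *)
Definition gbinom (m : int) (i : nat) : K :=
  (\prod_(j < i) (m - j%:Z)%:~R) / i`!%:R.

(* Y v n is the mode v_n, i.e. Y(v, z) = \sum_n v_n z^(-n-1). The Jacobi
   identity is stated in components: it is the coefficient of
   z0^(-l-1) z1^(-m-1) z2^(-n-1) in
     z0^-1 delta((z1 - z2) / z0) Y(u, z1) Y(v, z2)
       - z0^-1 delta((z2 - z1) / - z0) Y(v, z2) Y(u, z1)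
     = z2^-1 delta((z1 - z0) / z2) Y(Y(u, z0) v, z2).                        *)
Record vertex_algebra Y vac : Prop := VertexAlgebra {
  va_linear_l : forall n v, linear (fun u => Y u n v) ;
  va_linear_r : forall u n, linear (Y u n) ;
  va_truncation : forall u v, exists N : int, forall n, N <= n -> Y u n v = 0 ;
  va_vacuum : forall n v, Y vac n v = if n == -1 then v else 0 ;
  va_creation : forall v, Y v (-1) vac = v /\
    forall n : int, 0 <= n -> Y v n vac = 0 ;
  va_jacobi : forall u v w (l m n : int),
    \sum_(i \in [set: nat])
      (gbinom m i *: Y (Y u (l + i%:Z) v) (m + n - i%:Z) w) =
    \sum_(i \in [set: nat]) (((-1) ^+ i * gbinom l i) *:
      (Y u (m + l - i%:Z) (Y v (n + i%:Z) w)
       - (-1) ^ l *: Y v (n + l - i%:Z) (Y u (m + i%:Z) w))) }.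

Definition linear_character (G : groupType) (chi : G -> K) : Prop :=
  {morph chi : g h / (g * h)%g >-> g * h} /\ forall g, chi g != 0.

Record equivariant_vertex_algebra (G : groupType) (chi : G -> K)
    Y vac (R : G -> V -> V) : Prop := EquivariantVertexAlgebra {
  eva_va : vertex_algebra Y vac ;
  eva_linear : forall g, linear (R g) ;
  eva_bijective : forall g, bijective (R g) ;
  eva_morph : forall g h v, R (g * h)%g v = R g (R h v) ;
  eva_vacuum : forall g, R g vac = vac ;
  eva_covariance : forall g u v n,
    R g (Y u n (R (g^-1)%g v)) = chi g ^ (- n - 1) *: Y (R g u) n v }.

Variable W : lmodType K.
Implicit Types (YW : V -> distr W).

(* YW v is Y_W(v, z), by coefficients of z^n. *)
Record coordinated_quasi_module (p : laurent K) Y vac YW : Prop :=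
    CoordinatedQuasiModule {
  cqm_linear : linear YW ;
  cqm_field : forall v, in_EW (YW v) ;
  cqm_vacuum : YW vac = id_distr W ;
  cqm_assoc : forall u v, exists f : {poly {poly K}},
    [/\ f != 0, in_EW2 (poly2_mul f (distr_prod (YW u) (YW v))) &
        laurent2_act (poly_phi p f) (fun k => YW (Y u (- k - 1) v)) =
        subst_phi p (poly2_mul f (distr_prod (YW u) (YW v)))] }.

Definition equivariant_module (G : groupType) (chip : G -> K)
    (R : G -> V -> V) YW : Prop :=
  (forall g v, YW (R g v) = dil (chip g)^-1 (YW v)) /\
  forall u v, exists2 q, poly_roots_in (range chip) q &
    in_EW2 (ratio_mul q (distr_prod (YW u) (YW v))).

End VertexAlgebra.

(* Main.v *)
(** Applied to a fixed vector w, a field a(z) becomes an element of W((z)), a vector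
    space over C((z)), and the substitution z1 = phi(z, z0) becomes an operator T which
    turns multiplication by q(z1, z) into multiplication by q(phi(z, z0), z). Since
    phi(z, z0) - z = z0 p(z) + ..., a nonzero q remains nonzero after the substitution, and
    Y(a(z), z0) b(z) is determined by its product with q(phi(z, z0), z), for any q such
    that q(z1, z2) kills the commutator of a and b.

    Gamma-quasi locality passes to the products a_n b: for c Gamma-quasi local to a and b,
    a product of factors phi(z, z0) - g t and z - g t kills the commutator of
    Y(a(z), z0) b(z) with c(t), and modulo higher powers of z0 the former are the factors
    z - g t, so the coefficients in z0 are handled one after the other. Hence the union of
    the sets obtained from S and 1_W by iterating linear combinations and products is
    closed, and it is the generated space.

    For the products themselves, Y(a, z1) Y(b, z2) c becomes, after multiplication by a
    polynomial at (phi(z, z1), phi(z, z2), z), a double substitution that is symmetric in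
    the two variables; the multiplier is a unit times (z1 - z2)^k z1^i z2^j, and units can
    be cancelled, which leaves the usual locality. The defect J(l, m, n) of the Jacobi
    identity satisfies J(l+1, m, n) = J(l, m+1, n) - J(l, m, n+1) and vanishes for l large.
    If J(l+1, ., .) = 0, then J(l, m, n) depends only on m + n; it kills the vacuum, by the
    translation property, and satisfies a locality relation with every field, which forces
    J(l, ., .) = 0.

    Finally phi(x, chi z) = d phi(d^-1 x, z) says that the dilation z -> d^-1 z carries
    the substitution of phi to itself, up to z0 -> chi^-1 z0; this is the covariance of
    the products. *)

Require Import Defs.
From HB Require Import structures.
From mathcomp Require Import all_boot all_order all_algebra.
From mathcomp Require Import mathcomp_extra boolp classical_sets functions.
From mathcomp Require Import fsbigop reals complex polyXY.
From mathcomp Require Import zify ring.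

Set Implicit Arguments.
Unset Strict Implicit.
Unset Printing Implicit Defensive.

Import Order.TTheory GRing.Theory Num.Theory.
Local Open Scope classical_set_scope.
Local Open Scope ring_scope.

(** * Laurent series with vector coefficients *)

(** Lower bounds on the coefficients of a field depend on the vector, and so do the finite sums in
    the products. Hence products are computed on a fixed w, in [lser (lser W)], and whatever has to
    hold for all w at once ([Yv_lo], [killed]) is tracked separately. The main obstacle is that Y(a,
    z1) Y(b, z2) c and Y(b, z2) Y(a, z1) c lie in W((z))((z1))((z2)) and W((z))((z2))((z1)), modules
    over two different fields, so a common multiplier cannot be divided out inside one ring. The
    relation [sym] records that two such series have the same coefficients and no negative
    exponents, and it survives the removal of a unit coefficient by coefficient. Powers of z1 and z2
    then only shift indices, and the power of z1 - z2 that remains is the exponent of locality.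
    Gamma-quasi locality is carried by lists of linear factors z1 - g z2 rather than by polynomials
    in z1 / z2: such factors can be merged, commuted and turned around one at a time, and turning
    one around replaces g by its inverse. *)

Section IntSums.
Variable V : zmodType.
Implicit Types f g : int -> V.

(** The sum over Z is that of finitely supported families, with value 0 otherwise, so it is additive
    only under support conditions. These are given as explicit bounds [N] and [M], found in each use
    from the lower bounds of the series involved. *)
Lemma fsum_box (N M : int) f : (forall i, i < N -> f i = 0) ->
  (forall i, M <= i -> f i = 0) ->
  \sum_(i \in [set: int]) f i = \sum_(i <- zrange N (absz (M - N))) f i.
Proof.
move=> fN fM; apply: fsum_seq; first exact: zrange_uniq.
move=> i; rewrite mem_zrange negb_and -ltNge -leNgt => /orP[/fN//|h].
by apply: fM; lia.
Qed.

Lemma fsum1 (k : int) f : (forall i, i != k -> f i = 0) ->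
  \sum_(i \in [set: int]) f i = f k.
Proof.
move=> f0; rewrite (fsum_seq (r := [:: k]))// ?big_seq1// => i.
by rewrite inE => /f0.
Qed.

Lemma fsum0 f : (forall i, f i = 0) -> \sum_(i \in [set: int]) f i = 0.
Proof. by move=> f0; rewrite fsbig1. Qed.

Lemma fsumD N M f g :
  (forall i, i < N -> f i = 0) -> (forall i, M <= i -> f i = 0) ->
  (forall i, i < N -> g i = 0) -> (forall i, M <= i -> g i = 0) ->
  \sum_(i \in [set: int]) (f i + g i) =
  \sum_(i \in [set: int]) f i + \sum_(i \in [set: int]) g i.
Proof.
move=> fN fM gN gM; rewrite !(@fsum_box N M)// ?big_split// => i h.
  by rewrite fN// gN// addr0.
by rewrite fM// gM// addr0.
Qed.

Lemma fsum_reindex (h h' : int -> int) f : cancel h h' -> cancel h' h ->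
  \sum_(i \in [set: int]) f i = \sum_(i \in [set: int]) f (h i).
Proof. by move=> hK h'K; rewrite (reindex_fsbigT h) //; exists h'. Qed.

Lemma fsum_shift (k : int) f :
  \sum_(i \in [set: int]) f i = \sum_(i \in [set: int]) f (i - k).
Proof.
by rewrite (@fsum_reindex (fun i => i - k) (fun i => i + k))// => i; lia.
Qed.

Lemma fsum_rev (k : int) f :
  \sum_(i \in [set: int]) f i = \sum_(i \in [set: int]) f (k - i).
Proof.
by rewrite (@fsum_reindex (fun i => k - i) (fun i => k - i))// => i; lia.
Qed.

Lemma fsum_exchange (N M N' M' : int) (F : int -> int -> V) :
  (forall i j, i < N -> F i j = 0) -> (forall i j, M <= i -> F i j = 0) ->
  (forall i j, j < N' -> F i j = 0) -> (forall i j, M' <= j -> F i j = 0) ->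
  \sum_(i \in [set: int]) \sum_(j \in [set: int]) F i j =
  \sum_(j \in [set: int]) \sum_(i \in [set: int]) F i j.
Proof.
move=> FN FM FN' FM'.
rewrite (@fsum_box N M); first last.
- by move=> i h; apply: fsum0 => j; apply: FM.
- by move=> i h; apply: fsum0 => j; apply: FN.
transitivity (\sum_(i <- zrange N (absz (M - N)))
    \sum_(j <- zrange N' (absz (M' - N'))) F i j).
  by apply: eq_bigr => i _; apply: fsum_box => j; [exact: FN'|exact: FM'].
rewrite exchange_big (@fsum_box N' M') /=; first last.
- by move=> i h; apply: fsum0 => j; apply: FM'.
- by move=> i h; apply: fsum0 => j; apply: FN'.
by apply: eq_bigr => j _; apply/esym/fsum_box => i; [exact: FN|exact: FM].
Qed.

End IntSums.

Lemma fsum_additive (V V' : zmodType) (al : {additive V -> V'}) N M (f : int -> V) :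
  (forall i, i < N -> f i = 0) -> (forall i, M <= i -> f i = 0) ->
  al (\sum_(i \in [set: int]) f i) = \sum_(i \in [set: int]) al (f i).
Proof.
move=> fN fM; rewrite !(@fsum_box _ N M) ?raddf_sum// => i h.
  by rewrite fN ?raddf0.
by rewrite fM ?raddf0.
Qed.

Lemma fsum_scale (F : pzRingType) (V : lmodType F) (c : F) N M (f : int -> V) :
  (forall i, i < N -> f i = 0) -> (forall i, M <= i -> f i = 0) ->
  c *: (\sum_(i \in [set: int]) f i) = \sum_(i \in [set: int]) c *: f i.
Proof. exact: (@fsum_additive _ _ (GRing.scale c)). Qed.

Lemma fsum_scalel (F : pzRingType) (V : lmodType F) (v : V) N M (f : int -> F) :
  (forall i, i < N -> f i = 0) -> (forall i, M <= i -> f i = 0) ->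
  (\sum_(i \in [set: int]) f i) *: v = \sum_(i \in [set: int]) f i *: v.
Proof.
move=> fN fM; rewrite !(@fsum_box _ N M) ?scaler_suml// => i h.
  by rewrite fN ?scale0r.
by rewrite fM ?scale0r.
Qed.

Section LaurentModule.
Variables (F : fieldType) (V : lmodType F).

Definition lser_pred : {pred (int -> V)} := fun f => `[< bounded_below f >].

Fact lser_zmod_closed : zmod_closed lser_pred.
Proof.
split=> [|f g /asboolP[N fN] /asboolP[M gM]]; apply/asboolP; first by exists 0.
exists (Num.min N M) => n; rewrite lt_min => /andP[nN nM].
by rewrite -[LHS]/(f n - g n) fN// gM// subr0.
Qed.
HB.instance Definition _ :=
  GRing.isZmodClosed.Build (int -> V) lser_pred lser_zmod_closed.

(* V((x)), a vector space over F((x)) *)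
Record lser := Lser { scoef :> int -> V ; _ : scoef \in lser_pred }.

HB.instance Definition _ := [isSub for scoef].
HB.instance Definition _ := [Choice of lser by <:].
HB.instance Definition _ := [SubChoice_isSubZmodule of lser by <:].

Lemma lserP (f : lser) : bounded_below f.
Proof. by case: f => f /= /asboolP. Qed.

Lemma eq_lser (f g : lser) : f =1 g -> f = g.
Proof. by move=> fg; apply: val_inj; apply/funext. Qed.

Definition mk_lser (f : int -> V) (hf : bounded_below f) : lser :=
  Lser (introT (asboolP _) hf : f \in lser_pred).

Lemma lserD (f g : lser) n : (f + g) n = f n + g n.
Proof. by []. Qed.

Lemma lserN (f : lser) n : (- f) n = - f n.
Proof. by []. Qed.

Lemma lserB (f g : lser) n : (f - g) n = f n - g n.
Proof. by []. Qed.

Lemma lser0 n : (0 : lser) n = 0.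
Proof. by []. Qed.

Lemma lser_sum (I : Type) (r : seq I) (P : pred I) (f : I -> lser) n :
  (\sum_(i <- r | P i) f i) n = \sum_(i <- r | P i) f i n.
Proof. by elim/big_rec2: _ => // i x y _ <-. Qed.

Definition lscale_fun (c : laurent F) (f : lser) : int -> V :=
  fun n => \sum_(i \in [set: int]) c i *: f (n - i).

Lemma lscale_lo (c : laurent F) (f : lser) N M :
  (forall i, i < N -> c i = 0) -> (forall i, i < M -> f i = 0) ->
  forall n, n < N + M -> lscale_fun c f n = 0.
Proof.
move=> cN fM n nNM; apply: fsum0 => i.
have [/cN->|iN] := ltP i N; first by rewrite scale0r.
by rewrite fM ?scaler0//; lia.
Qed.

Fact lscale_bdd c f : bounded_below (lscale_fun c f).
Proof.
have [N cN] := laurentP c; have [M fM] := lserP f.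
by exists (N + M); apply: lscale_lo.
Qed.

Definition lscale c f := mk_lser (lscale_bdd c f).

Fact lscaleA a b f : lscale a (lscale b f) = lscale (a * b) f.
Proof.
apply: eq_lser => n /=.
have [N aN] := laurentP a; have [N' bN] := laurentP b; have [M fM] := lserP f.
transitivity (\sum_(i \in [set: int]) \sum_(j \in [set: int])
    (a i * b (j - i)) *: f (n - j)).
  apply: eq_fsbigr => i _; rewrite /= /lscale_fun.
  rewrite (@fsum_scale _ _ _ N' (n - i - M + 1)); first last.
  - by move=> j h; rewrite fM ?scaler0//; lia.
  - by move=> j h; rewrite bN ?scale0r//; lia.
  rewrite (fsum_shift i); apply: eq_fsbigr => j _.
  by rewrite scalerA; congr (_ *: f _); lia.
rewrite (@fsum_exchange _ N (n - M - N' + 1) (N + N') (n - M + 1)); first last.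
- by move=> i j h; rewrite fM ?scaler0//; lia.
- move=> i j h; have [/aN->|iN] := ltP i N; first by rewrite mul0r scale0r.
  by rewrite bN ?mulr0 ?scale0r//; lia.
- move=> i j h; have [jM|jM] := ltP (n - j) M; first by rewrite fM// scaler0.
  by rewrite bN ?mulr0 ?scale0r//; lia.
- by move=> i j /aN->; rewrite mul0r scale0r.
apply: eq_fsbigr => j _.
rewrite (@fsum_scalel _ _ _ N (j - N' + 1))// => i h.
  by rewrite aN ?mul0r//; lia.
by rewrite bN ?mulr0//; lia.
Qed.

Fact lscale1 : left_id 1 lscale.
Proof.
move=> f; apply: eq_lser => n /=; rewrite /lscale_fun (@fsum1 _ 0) /=.
  by rewrite subr0 -[RHS]scale1r; congr (_ *: _).
by move=> i /negbTE i0; rewrite -[X in X *: _]/(1 *+ (i == 0)) i0 scale0r.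
Qed.

Fact lscaleDr : right_distributive lscale +%R.
Proof.
move=> c f g; apply: eq_lser => n; rewrite lserD /= /lscale_fun.
have [N cN] := laurentP c; have [M fM] := lserP f; have [M' gM] := lserP g.
pose k := Num.min M M'.
have kM : k <= M by rewrite /k; lia.
have kM' : k <= M' by rewrite /k; lia.
rewrite -(@fsumD _ N (n - k + 1)).
- by apply: eq_fsbigr => i _; rewrite lserD scalerDr.
- by move=> i /cN->; rewrite scale0r.
- by move=> i h; rewrite fM ?scaler0//; lia.
- by move=> i /cN->; rewrite scale0r.
- by move=> i h; rewrite gM ?scaler0//; lia.
Qed.

Fact lscaleDl f : {morph lscale^~ f : a b / a + b}.
Proof.
move=> a b; apply: eq_lser => n; rewrite lserD /= /lscale_fun.
have [N aN] := laurentP a; have [N' bN] := laurentP b; have [M fM] := lserP f.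
pose k := Num.min N N'.
have kM : k <= N by rewrite /k; lia.
have kM' : k <= N' by rewrite /k; lia.
rewrite -(@fsumD _ k (n - M + 1)).
- by apply: eq_fsbigr => i _; rewrite -[(a + b) i]/(a i + b i) scalerDl.
- by move=> i h; rewrite aN ?scale0r//; lia.
- by move=> i h; rewrite fM ?scaler0//; lia.
- by move=> i h; rewrite bN ?scale0r//; lia.
- by move=> i h; rewrite fM ?scaler0//; lia.
Qed.

HB.instance Definition _ := GRing.Zmodule_isLmodule.Build (laurent F) lser
  lscaleA lscale1 lscaleDr lscaleDl.

Lemma lscaleE (c : laurent F) (f : lser) n :
  (c *: f) n = \sum_(i \in [set: int]) c i *: f (n - i).
Proof. by []. Qed.

Lemma lscale_const (c : F) (f : lser) n : (lconst c *: f) n = c *: f n.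
Proof.
rewrite lscaleE (@fsum1 _ 0) /= ?mulr1n ?subr0// => i /negbTE->.
by rewrite scale0r.
Qed.

Lemma lscale_monom (k : int) (f : lser) n : (lmonom 1 k *: f) n = f (n - k).
Proof.
rewrite lscaleE (@fsum1 _ k) /= ?eqxx ?mulr1n ?scale1r// => i /negbTE->.
by rewrite scale0r.
Qed.

(** Defaults to 0 on unbounded families, so that a series can be named before its boundedness is
    proved. *)
Definition to_lser (f : int -> V) : lser :=
  if pselect (bounded_below f) is left h then mk_lser h else 0.

Lemma to_lserE (f : int -> V) : bounded_below f -> to_lser f =1 f.
Proof. by move=> h n; rewrite /to_lser; case: pselect. Qed.

End LaurentModule.
Arguments to_lser {F V}.

Section LaurentExtra.
Variable F : fieldType.
Implicit Types (f g : laurent F) (c : F).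

Lemma laurD f g n : (f + g) n = f n + g n. Proof. by []. Qed.
Lemma laurN f n : (- f) n = - f n. Proof. by []. Qed.
Lemma laurB f g n : (f - g) n = f n - g n. Proof. by []. Qed.
Lemma laur0 n : (0 : laurent F) n = 0. Proof. by []. Qed.

Lemma laur_sum (I : Type) (r : seq I) (P : pred I) (f : I -> laurent F) n :
  (\sum_(i <- r | P i) f i) n = \sum_(i <- r | P i) f i n.
Proof. by elim/big_rec2: _ => // i x y _ <-. Qed.

Lemma lmulE f g n : (f * g) n = \sum_(i \in [set: int]) f i * g (n - i).
Proof. by []. Qed.

Lemma lconst_mulE c f n : (lconst c * f) n = c * f n.
Proof.
by rewrite lmulE (@fsum1 _ 0) /= ?mulr1n ?subr0// => i /negbTE->; rewrite mul0r.
Qed.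

Lemma lmonom_mulE (k : int) f n : (lmonom 1 k * f) n = f (n - k).
Proof.
rewrite lmulE (@fsum1 _ k) /= ?eqxx ?mulr1n ?mul1r// => i /negbTE->.
by rewrite mul0r.
Qed.

Fact lconst_zmod_morphism : zmod_morphism (@lconst F).
Proof. by move=> a b; apply: eq_laurent => n; rewrite laurB /= mulrnBl. Qed.

Fact lconst_monoid_morphism : monoid_morphism (@lconst F).
Proof.
split=> // a b; apply: eq_laurent => n.
by rewrite lconst_mulE /= mulrnAr.
Qed.

HB.instance Definition _ :=
  GRing.isZmodMorphism.Build F (laurent F) lconst lconst_zmod_morphism.
HB.instance Definition _ :=
  GRing.isMonoidMorphism.Build F (laurent F) lconst lconst_monoid_morphism.

Fact lpoly_zmod_morphism : zmod_morphism (@lpoly F).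
Proof.
move=> a b; apply: eq_laurent => n; rewrite laurB /= /lseries_fun.
by case: n => n; rewrite ?coefB ?subr0.
Qed.

HB.instance Definition _ :=
  GRing.isZmodMorphism.Build {poly F} (laurent F) (@lpoly F) lpoly_zmod_morphism.

Lemma lpolyC c : lpoly c%:P = lconst c.
Proof.
by apply: eq_laurent => -[[|n]|n] /=; rewrite ?coefC ?mulr1n ?mulr0n.
Qed.

Lemma lpolyMX (q : {poly F}) : lpoly (q * 'X) = lmonom 1 1 * lpoly q.
Proof.
apply: eq_laurent => n; rewrite lmonom_mulE /= /lseries_fun.
case: n => [[|n]|n] //=; rewrite ?coefMX//=.
by rewrite subn1.
Qed.

Lemma lpolyX : lpoly ('X : {poly F}) = lmonom 1 1.
Proof. by rewrite -['X]mul1r lpolyMX lpolyC rmorph1 mulr1. Qed.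

Fact lpoly_monoid_morphism : monoid_morphism (@lpoly F).
Proof.
split=> [|a b]; first by rewrite lpolyC rmorph1.
elim/poly_ind: a => [|a c IH]; first by rewrite mul0r raddf0 mul0r.
rewrite mulrDl !raddfD /= mulrDl -mulrA ['X * b]mulrC mulrA !lpolyMX IH mulrA.
congr (_ + _); apply: eq_laurent => n; rewrite lpolyC lconst_mulE /=.
by rewrite /lseries_fun; case: n => n; rewrite ?coefCM ?mulr0.
Qed.

HB.instance Definition _ :=
  GRing.isMonoidMorphism.Build {poly F} (laurent F) (@lpoly F)
    lpoly_monoid_morphism.

Lemma lpoly_inj : injective (@lpoly F).
Proof.
by move=> a b ab; apply/polyP => k; have := congr1 (fun f : laurent F => f k) ab.
Qed.

Lemma lpoly_neg (q : {poly F}) (n : int) : n < 0 -> lpoly q n = 0.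
Proof. by case: n. Qed.

End LaurentExtra.

(* coefficientwise application of a map that fixes 0 *)
Definition lsmap (F F' : fieldType) (V : lmodType F) (V' : lmodType F')
  (al : V -> V') (f : lser V) : lser V' := to_lser (fun n => al (f n)).

Lemma lsmapE (F F' : fieldType) (V : lmodType F) (V' : lmodType F')
  (al : V -> V') (f : lser V) n : al 0 = 0 -> lsmap al f n = al (f n).
Proof.
move=> al0; rewrite /lsmap to_lserE//; have [N fN] := lserP f.
by exists N => k /fN ->.
Qed.

Section PropLinear.
Variables (F : pzRingType) (V V' : lmodType F) (al : V -> V').
Hypothesis al_lin : linear al.

(** The operators [a n] of a field are linear only as a proposition, with no morphism structure, so
    the usual consequences are derived from that proposition. *)
Lemma plin0 : al 0 = 0.
Proof. by have := al_lin (-1) 0 0; rewrite addr0 scaler0 scaleN1r addNr. Qed.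

Lemma plinD u v : al (u + v) = al u + al v.
Proof. by have := al_lin 1 u v; rewrite !scale1r. Qed.

Lemma plinZ c u : al (c *: u) = c *: al u.
Proof. by have := al_lin c u 0; rewrite plin0 !addr0. Qed.

Lemma plinN u : al (- u) = - al u.
Proof. by rewrite -scaleN1r plinZ scaleN1r. Qed.

Lemma plinB u v : al (u - v) = al u - al v.
Proof. by rewrite plinD plinN. Qed.

Lemma plin_sum (I : Type) (r : seq I) (P : pred I) (f : I -> V) :
  al (\sum_(i <- r | P i) f i) = \sum_(i <- r | P i) al (f i).
Proof. exact: (big_morph al plinD plin0). Qed.

Lemma plin_fsum N M (f : int -> V) :
  (forall i, i < N -> f i = 0) -> (forall i, M <= i -> f i = 0) ->
  al (\sum_(i \in [set: int]) f i) = \sum_(i \in [set: int]) al (f i).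
Proof.
move=> fN fM; rewrite !(@fsum_box _ N M) ?plin_sum// => i h.
  by rewrite fN ?plin0.
by rewrite fM ?plin0.
Qed.

End PropLinear.

Lemma lsmap_linear (F : fieldType) (V V' : lmodType F) (al : V -> V') :
  linear al -> linear (@lsmap F F V V' al).
Proof.
move=> lin c f g; apply: eq_lser => n.
have al0 := plin0 lin.
rewrite lserD !lsmapE// lserD plinD//; congr (_ + _).
have [N cN] := laurentP c; have [M fM] := lserP f.
rewrite !lscaleE (@plin_fsum _ _ _ _ lin N (n - M + 1)).
- by apply: eq_fsbigr => i _; rewrite plinZ// lsmapE.
- by move=> i /cN->; rewrite scale0r.
- by move=> i h; rewrite fM ?scaler0//; lia.
Qed.

Section Derivative.
Variables (F : fieldType) (V : lmodType F).
Implicit Types (c : laurent F) (f : lser V).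

Fact sderiv_bdd f : bounded_below (fun n : int => (n + 1)%:~R *: f (n + 1)).
Proof.
by have [N fN] := lserP f; exists (N - 1) => n nN; rewrite fN ?scaler0//; lia.
Qed.

Definition sderiv f : lser V := mk_lser (sderiv_bdd f).

Lemma sderivE f n : sderiv f n = (n + 1)%:~R *: f (n + 1). Proof. by []. Qed.

Lemma sderivD f g : sderiv (f + g) = sderiv f + sderiv g.
Proof. by apply: eq_lser => n; rewrite lserD !sderivE -scalerDr. Qed.

Lemma sderivN f : sderiv (- f) = - sderiv f.
Proof. by apply: eq_lser => n; rewrite lserN !sderivE -scalerN. Qed.

Lemma sderivZ c f : sderiv (c *: f) = lderiv c *: f + c *: sderiv f.
Proof.
apply: eq_lser => n; rewrite lserD sderivE !lscaleE.
have [N cN] := laurentP c; have [M fM] := lserP f.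
rewrite (@fsum_scale _ _ _ N (n - M + 2)); first last.
- by move=> i h; rewrite fM ?scaler0//; lia.
- by move=> i /cN->; rewrite scale0r.
have -> : \sum_(i \in [set: int]) lderiv c i *: f (n - i) =
    \sum_(i \in [set: int]) (i%:~R * c i) *: f (n + 1 - i).
  rewrite [RHS](fsum_shift (-1)); apply: eq_fsbigr => i _.
  by rewrite /= opprK; congr (_ *: f _); lia.
rewrite -(@fsumD _ N (n - M + 2)).
- apply: eq_fsbigr => i _; rewrite sderivE !scalerA.
  have -> : n - i + 1 = n + 1 - i by lia.
  rewrite -scalerDl; congr (_ *: _); rewrite [c i * _]mulrC -mulrDl -intrD.
  by congr (_%:~R * _); lia.
- by move=> i /cN->; rewrite mulr0 scale0r.
- by move=> i h; rewrite fM ?scaler0//; lia.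
- by move=> i /cN->; rewrite scale0r.
- by move=> i h; rewrite sderivE fM ?scaler0//; lia.
Qed.

End Derivative.

Section LDerivative.
Variables (F : fieldType).
Implicit Types (c f g : laurent F).

Lemma lderivE f n : lderiv f n = (n + 1)%:~R * f (n + 1). Proof. by []. Qed.

Lemma lderivD f g : lderiv (f + g) = lderiv f + lderiv g.
Proof. by apply: eq_laurent => n; rewrite laurD !lderivE -mulrDr. Qed.

Lemma lderivN f : lderiv (- f) = - lderiv f.
Proof. by apply: eq_laurent => n; rewrite laurN !lderivE -mulrN. Qed.

(** F((x)) as a module over itself, which makes the results on [lser] available for products of
    Laurent series. *)
Definition reg f : lser F^o := mk_lser (V := F^o) (laurentP f).

Lemma regM f g : reg (f * g) = f *: reg g.
Proof. exact: eq_lser. Qed.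

Lemma lderivM f g : lderiv (f * g) = lderiv f * g + f * lderiv g.
Proof.
have h n : (sderiv (reg (f * g))) n = (lderiv (f * g)) n by [].
apply: eq_laurent => n; rewrite -h regM sderivZ.
by congr (_ + _).
Qed.

Lemma lderiv_const (a : F) : lderiv (lconst a) = 0.
Proof.
apply: eq_laurent => n; rewrite lderivE laur0 /=.
by have [->|] := eqVneq (n + 1) 0; rewrite ?mul0r// mulr0n mulr0.
Qed.

End LDerivative.

Section PolyAction.
Variables (F : fieldType) (V : lmodType F).
Implicit Types (q r : {poly F}) (f g : int -> V).

(* q(x) acts on V[[x, x^-1]] *)
Definition pact q f : int -> V :=
  fun m => \sum_(i < size q) q`_i *: f (m - i%:Z).

Lemma pactE k q f m : (size q <= k)%N ->
  pact q f m = \sum_(i < k) q`_i *: f (m - i%:Z).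
Proof.
move=> qk; rewrite /pact (big_ord_widen k (fun i => q`_i *: f (m - i%:Z)) qk).
rewrite big_mkcond; apply: eq_bigr => i _; case: ltnP => // h.
by rewrite nth_default ?scale0r.
Qed.

Lemma pactDl q r f m : pact (q + r) f m = pact q f m + pact r f m.
Proof.
pose k := maxn (size q) (size r).
rewrite !(@pactE k) ?size_polyD ?leq_maxl ?leq_maxr// -big_split /=.
by apply: eq_bigr => i _; rewrite coefD scalerDl.
Qed.

Lemma pactC c f m : pact c%:P f m = c *: f m.
Proof.
rewrite (@pactE 1) ?size_polyC ?leq_b1// big_ord1 coefC /= subr0//.
Qed.

Lemma pactMX q f m : pact (q * 'X) f m = pact q (fun i => f (i - 1)) m.
Proof.
rewrite (@pactE (size q).+1); last first.
  by rewrite (leq_trans (size_polyMleq _ _))// size_polyX addn2.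
rewrite big_ord_recl coefMX /= scale0r add0r /pact; apply: eq_bigr => i _.
by rewrite coefMX /=; congr (_ *: f _); rewrite /bump; lia.
Qed.

Lemma pact0l f m : pact 0 f m = 0.
Proof. by rewrite -[0]/(0%:P) pactC scale0r. Qed.

Lemma pact1l f m : pact 1 f m = f m.
Proof. by rewrite pactC scale1r. Qed.

Lemma pactDr q f g m : pact q (fun i => f i + g i) m = pact q f m + pact q g m.
Proof. by rewrite -big_split; apply: eq_bigr => i _; rewrite scalerDr. Qed.

Lemma pactBr q f g m : pact q (fun i => f i - g i) m = pact q f m - pact q g m.
Proof.
rewrite /pact -sumrN -big_split; apply: eq_bigr => i _.
by rewrite scalerDr scalerN.
Qed.

Lemma pactZr q (c : F) f m : pact q (fun i => c *: f i) m = c *: pact q f m.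
Proof.
by rewrite /pact scaler_sumr; apply: eq_bigr => i _; rewrite !scalerA mulrC.
Qed.

Lemma pact_eqr q f g m : f =1 g -> pact q f m = pact q g m.
Proof. by move=> fg; apply: eq_bigr => i _; rewrite fg. Qed.

Lemma pact0r q f m : (forall i, f i = 0) -> pact q f m = 0.
Proof. by move=> f0; apply: big1 => i _; rewrite f0 scaler0. Qed.

Lemma pact_shift q f k m : pact q (fun i => f (i - k)) m = pact q f (m - k).
Proof. by apply: eq_bigr => i _; congr (_ *: f _); lia. Qed.

Lemma pact_ind q c f m :
  pact (q * 'X + c%:P) f m = pact q f (m - 1) + c *: f m.
Proof. by rewrite pactDl pactMX pact_shift pactC. Qed.

Lemma pactM q r f m : pact (q * r) f m = pact q (pact r f) m.
Proof.
elim/poly_ind: q m => [|q c IH] m; first by rewrite mul0r !pact0l.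
rewrite mulrDl pactDl -mulrA ['X * r]mulrC mulrA pactMX pact_shift IH pact_ind.
congr (_ + _); rewrite mul_polyC /pact.
have [->|c0] := eqVneq c 0.
  by rewrite !scale0r size_poly0 big_ord0.
rewrite size_scale// scaler_sumr; apply: eq_bigr => i _.
by rewrite coefZ scalerA.
Qed.

Lemma pact_lo q f N : (forall m, m < N -> f m = 0) ->
  forall m, m < N -> pact q f m = 0.
Proof.
by move=> fN m mN; apply: big1 => i _; rewrite fN ?scaler0//; lia.
Qed.

End PolyAction.

Lemma pact_lin (F : fieldType) (V V' : lmodType F) (al : V -> V')
    (q : {poly F}) (f : int -> V) m : linear al ->
  al (pact q f m) = pact q (fun i => al (f i)) m.
Proof.
by move=> lin; rewrite plin_sum//; apply: eq_bigr => i _; rewrite plinZ.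
Qed.

(** * Substitution of phi(z, z0) *)

Section Positive.
Variables (F : fieldType) (V : lmodType F).
Implicit Types (c : laurent F) (f : lser V).

Lemma lscale_pos c f : (forall n, n < 0 -> c n = 0) ->
  (forall n, n < 0 -> f n = 0) -> forall n, n < 0 -> (c *: f) n = 0.
Proof. by move=> c0 f0 n n0; apply: (lscale_lo c0 f0); rewrite addr0. Qed.

Lemma lscale_coef0 c f : (forall n, n < 0 -> c n = 0) ->
  (forall n, n < 0 -> f n = 0) -> (c *: f) 0 = c 0 *: f 0.
Proof.
move=> c0 f0; rewrite lscaleE (@fsum1 _ 0) ?subr0// => i i0.
have [/c0->|ip] := ltP i 0; first by rewrite scale0r.
by rewrite f0 ?scaler0//; lia.
Qed.

Lemma lscale_coef c f (n : nat) : (forall n, n < 0 -> c n = 0) ->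
  (forall n, n < 0 -> f n = 0) ->
  (c *: f) n = \sum_(i < n.+1) c i *: f (n%:Z - i%:Z).
Proof.
move=> c0 f0; rewrite lscaleE (@fsum_box _ 0 n.+1).
- rewrite subr0 absz_nat big_map -{1}[n.+1]subn0 -/(index_iota 0 _) big_mkord.
  by apply: eq_bigr => i _; rewrite add0r.
- by move=> i /c0->; rewrite scale0r.
- by move=> i h; rewrite f0 ?scaler0//; lia.
Qed.

End Positive.

Section Subst.
Variables (K : numFieldType) (W : lmodType K) (p : laurent K).
Implicit Types (B : int -> int -> W) (f : laurent K).

(** With some [N] this is membership in W((x, z)): one lower bound for both exponents. *)
Definition bdd2 (N : int) B : Prop :=
  forall m n, (m < N) || (n < N) -> B m n = 0.

Definition bounded2 B : Prop := exists N, bdd2 N B.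

Lemma bdd2_x N B m n : bdd2 N B -> m < N -> B m n = 0.
Proof. by move=> h mN; apply: h; rewrite mN. Qed.

Lemma bdd2_z N B m n : bdd2 N B -> n < N -> B m n = 0.
Proof. by move=> h mN; apply: h; rewrite mN orbT. Qed.

Lemma bounded2D B B' : bounded2 B -> bounded2 B' ->
  bounded2 (fun m n => B m n + B' m n).
Proof.
move=> [N BN] [N' BN']; exists (Num.min N N') => m n h.
by rewrite BN ?BN' ?addr0//; lia.
Qed.

Lemma bounded2Z c B : bounded2 B -> bounded2 (fun m n => c *: B m n).
Proof. by move=> [N BN]; exists N => m n h; rewrite BN ?scaler0. Qed.

Lemma bounded2_tr B : bounded2 B -> bounded2 (fun m n => B n m).
Proof. by move=> [N BN]; exists N => m n h; rewrite BN// orbC. Qed.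

Definition colx B (n : int) : lser W := to_lser (fun m => B m n).

Lemma colxE B m n : bounded2 B -> colx B n m = B m n.
Proof. by move=> [N BN]; rewrite to_lserE//; exists N => i /bdd2_x h; apply: h. Qed.

Lemma colxK (G : int -> lser W) n : colx (fun m n => G n m) n = G n.
Proof. by apply: eq_lser => m; rewrite to_lserE//; exact: lserP. Qed.

Definition Dl f : laurent K := p * lderiv f.
Definition Ds (g : lser W) : lser W := p *: sderiv g.

Lemma DlM f g : Dl (f * g) = Dl f * g + f * Dl g.
Proof. by rewrite /Dl lderivM mulrDr mulrA; congr (_ + _); rewrite mulrCA. Qed.

Lemma DlD f g : Dl (f + g) = Dl f + Dl g.
Proof. by rewrite /Dl lderivD mulrDr. Qed.

Lemma DsZ f g : Ds (f *: g) = Dl f *: g + f *: Ds g.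
Proof. by rewrite /Ds sderivZ scalerDr scalerA; congr (_ + _); rewrite !scalerA mulrC. Qed.

Lemma DsD (g h : lser W) : Ds (g + h) = Ds g + Ds h.
Proof. by rewrite /Ds sderivD scalerDr. Qed.

Lemma DsN (g : lser W) : Ds (- g) = - Ds g.
Proof. by rewrite /Ds sderivN scalerN. Qed.

Lemma Dl_const a : Dl (lconst a) = 0.
Proof. by rewrite /Dl lderiv_const mulr0. Qed.

Lemma Ds0 : Ds 0 = 0.
Proof. by apply: (addrI (Ds 0)); rewrite -DsD !addr0. Qed.

Lemma Ds_const a g : Ds (lconst a *: g) = lconst a *: Ds g.
Proof. by rewrite DsZ Dl_const scale0r add0r. Qed.

Lemma Ds_lo (N : int) : exists N', N' <= N /\ forall g : lser W,
  (forall n, n < N -> g n = 0) -> forall n, n < N' -> Ds g n = 0.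
Proof.
have [P pP] := laurentP p; exists (Num.min N (P + (N - 1))); split; first by lia.
move=> g gN n nN; apply: (lscale_lo pP (M := N - 1)); last by lia.
by move=> i iN; rewrite sderivE gN ?scaler0//; lia.
Qed.

Definition Dx B : int -> int -> W := fun m n => Ds (colx B n) m.

Lemma colx_Dx B n : colx (Dx B) n = Ds (colx B n).
Proof. by apply: eq_lser => m; rewrite to_lserE//; exact: lserP. Qed.

Lemma Dx_bdd N : exists N', forall B, bdd2 N B -> bdd2 N' (Dx B).
Proof.
have [N' [N'N h]] := Ds_lo N; exists N' => B BN m n.
have B2 : bounded2 B by exists N.
move=> /orP[mN|nN]; rewrite /Dx.
  by apply: h => // i iN; rewrite colxE// (bdd2_x _ BN).
suff -> : colx B n = 0 by rewrite Ds0.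
by apply: eq_lser => i; rewrite colxE// (bdd2_z _ BN)//; lia.
Qed.

Lemma bounded2_Dx B : bounded2 B -> bounded2 (Dx B).
Proof. by move=> [N BN]; have [N' h] := Dx_bdd N; exists N'; apply: h. Qed.

Lemma iter_Dx_bdd N j : exists N', forall B, bdd2 N B -> bdd2 N' (iter j Dx B).
Proof.
elim: j => [|j [N' IH]]; first by exists N.
by have [N'' h] := Dx_bdd N'; exists N'' => B BN /=; apply/h/IH.
Qed.

Lemma bounded2_iter j B : bounded2 B -> bounded2 (iter j Dx B).
Proof. by move=> [N BN]; have [N' h] := iter_Dx_bdd N j; exists N'; apply: h. Qed.

(* restriction to x = z *)
Definition Delta B (k : int) : W := \sum_(i \in [set: int]) B i (k - i).
Definition DeltaL B : lser W := to_lser (Delta B).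

Lemma Delta_lo N B : bdd2 N B -> forall k, k < N + N -> Delta B k = 0.
Proof. by move=> BN k kN; apply: fsum0 => i; apply: BN; lia. Qed.

Lemma DeltaLE B k : bounded2 B -> DeltaL B k = Delta B k.
Proof. by move=> [N BN]; rewrite to_lserE//; exists (N + N); apply: Delta_lo. Qed.

Lemma Delta_tr B k : Delta (fun m n => B n m) k = Delta B k.
Proof.
rewrite /Delta [RHS](fsum_rev k); apply: eq_fsbigr => i _.
by congr (B _ _); lia.
Qed.

Lemma DeltaL_tr B : DeltaL (fun m n => B n m) = DeltaL B.
Proof. by congr to_lser; apply/funext => k; rewrite Delta_tr. Qed.

Lemma DeltaLD B B' : bounded2 B -> bounded2 B' ->
  DeltaL (fun m n => B m n + B' m n) = DeltaL B + DeltaL B'.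
Proof.
move=> bB bB'; apply: eq_lser => k; rewrite lserD !DeltaLE//; last exact: bounded2D.
have [N BN] := bB; have [N' BN'] := bB'.
rewrite -(@fsumD _ (Num.min N N') (k - Num.min N N' + 1))// => i h;
  by [apply: BN; lia|apply: BN'; lia].
Qed.

Definition mulx f B : int -> int -> W := fun m n => (f *: colx B n) m.
Definition mulz f B : int -> int -> W := fun m n => mulx f (fun m n => B n m) n m.

Lemma bounded2_mulx f B : bounded2 B -> bounded2 (mulx f B).
Proof.
move=> bB; have [N BN] := bB; have [P fP] := laurentP f.
exists (Num.min N (P + N)) => m n h; rewrite /mulx.
have [mN|mN] := ltP m (P + N).
  by apply: (lscale_lo fP _ mN) => i iN; rewrite colxE// (bdd2_x _ BN).
suff -> : colx B n = 0 by rewrite scaler0.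
by apply: eq_lser => i; rewrite colxE// (bdd2_z _ BN)//; lia.
Qed.

Lemma bounded2_mulz f B : bounded2 B -> bounded2 (mulz f B).
Proof. by move=> bB; apply/bounded2_tr/bounded2_mulx/bounded2_tr. Qed.

Lemma DeltaL_mulx f B : bounded2 B -> DeltaL (mulx f B) = f *: DeltaL B.
Proof.
move=> bB; apply: eq_lser => k; rewrite DeltaLE; last exact: bounded2_mulx.
rewrite /Delta /mulx lscaleE.
have [N BN] := bB; have [P fP] := laurentP f.
transitivity (\sum_(i \in [set: int]) \sum_(h \in [set: int])
    f h *: B (i - h) (k - i)).
  by apply: eq_fsbigr => i _; rewrite lscaleE; apply: eq_fsbigr => h _; rewrite colxE.
rewrite (@fsum_exchange _ (N + P) (k - N + 1) P (k - N - N + 1)); first last.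
- move=> i h hN; have [lt|le] := ltP (i - h) N.
    by rewrite (bdd2_x _ BN) ?scaler0.
  by rewrite (bdd2_z _ BN) ?scaler0//; lia.
- by move=> i h /fP->; rewrite scale0r.
- by move=> i h iN; rewrite (bdd2_z _ BN) ?scaler0//; lia.
- move=> i h iN; have [/fP->|hP] := ltP h P; first by rewrite scale0r.
  by rewrite (bdd2_x _ BN) ?scaler0//; lia.
apply: eq_fsbigr => h _; rewrite DeltaLE//.
rewrite /Delta (@fsum_scale _ _ _ N (k - h - N + 1)).
- rewrite [RHS](fsum_shift h); apply: eq_fsbigr => i _.
  by congr (_ *: B _ _); lia.
- by move=> i iN; rewrite (bdd2_x _ BN).
- by move=> i iN; rewrite (bdd2_z _ BN)//; lia.
Qed.

Lemma DeltaL_mulz f B : bounded2 B -> DeltaL (mulz f B) = f *: DeltaL B.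
Proof.
move=> bB; have bB' := bounded2_tr bB.
by rewrite -(DeltaL_tr B) -(DeltaL_mulx f bB') -[RHS]DeltaL_tr.
Qed.

Lemma Dx_mulx f B : bounded2 B ->
  Dx (mulx f B) = fun m n => mulx (Dl f) B m n + mulx f (Dx B) m n.
Proof.
move=> bB; apply/funext => m; apply/funext => n; have e : colx (mulx f B) n = f *: colx B n.
  by apply: eq_lser => i; rewrite to_lserE//; exact: lserP.
by rewrite {1}/Dx e DsZ lserD /mulx colx_Dx.
Qed.

(** [Dx] treats z as a constant, but f(z) is a Laurent series: linearity over it is an exchange of
    two sums, both finite by boundedness. *)
Lemma Dx_mulz f B : bounded2 B -> Dx (mulz f B) = mulz f (Dx B).
Proof.
move=> bB; apply/funext => m; apply/funext => n; rewrite /Dx.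
have [N BN] := bB; have [P fP] := laurentP f; have [Q pQ] := laurentP p.
have brow : bounded2 (fun m n => B n m) by exact: bounded2_tr.
have bDrow : bounded2 (fun m n => Dx B n m) by apply/bounded2_tr/bounded2_Dx.
have bm := bounded2_mulz f bB.
rewrite /mulz /mulx !lscaleE.
have lhsE i : p i *: sderiv (colx (mulz f B) n) (m - i) =
   \sum_(h \in [set: int]) f h *: (p i *: sderiv (colx B (n - h)) (m - i)).
  rewrite sderivE colxE// {1}/mulz /mulx lscaleE.
  rewrite (@fsum_scale _ _ _ P (n - N + 1)); first last.
  - by move=> h hN; rewrite colxE// (bdd2_z _ BN) ?scaler0//; lia.
  - by move=> h /fP->; rewrite scale0r.
  rewrite (@fsum_scale _ _ _ P (n - N + 1)); first last.
  - by move=> h hN; rewrite colxE// (bdd2_z _ BN) ?scaler0//; lia.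
  - by move=> h /fP->; rewrite scale0r scaler0.
  apply: eq_fsbigr => h _; rewrite sderivE !colxE//.
  by rewrite !scalerA; congr (_ *: _); rewrite -[RHS]mulrA [RHS]mulrC.
under eq_fsbigr do rewrite lhsE.
rewrite (@fsum_exchange _ Q (m - N + 2) P (n - N + 1)); first last.
- move=> i h hN; rewrite sderivE colxE// (bdd2_z _ BN) ?scaler0//; lia.
- by move=> i h /fP->; rewrite scale0r.
- by move=> i h iN; rewrite sderivE colxE// (bdd2_x _ BN) ?scaler0//; lia.
- by move=> i h /pQ->; rewrite scale0r scaler0.
apply: eq_fsbigr => h _; rewrite colxE//.
rewrite -(@fsum_scale _ _ _ Q (m - N + 2))//.
- by move=> i /pQ->; rewrite scale0r.
- by move=> i iN; rewrite sderivE colxE// (bdd2_x _ BN) ?scaler0//; lia.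
Qed.

(* the coefficient of z0^j in B(x, z) at x = phi(z, z0) *)
Definition Tc (j : nat) B : lser W :=
  lconst (j`!%:R^-1) *: DeltaL (iter j Dx B).

Definition T_fun B : int -> lser W := fun n => if n is Posz j then Tc j B else 0.

Fact T_bdd B : bounded_below (T_fun B).
Proof. by exists 0; case. Qed.

Definition T B : lser (lser W) := mk_lser (T_bdd B).

Lemma T_pos B n : n < 0 -> T B n = 0. Proof. by case: n. Qed.

Lemma natr_laurent_neq0 j : (j.+1%:Z)%:~R != 0 :> laurent K.
Proof.
rewrite -(rmorph_int (@lconst K)) fmorph_eq0.
by rewrite intr_eq0.
Qed.

Lemma factS_inv j : (j%:Z + 1)%:~R * (j.+1)`!%:R^-1 = j`!%:R^-1 :> K.
Proof. by rewrite -PoszD addn1 factS natrM -pmulrn invfM mulrA mulfV ?mul1r// pnatr_eq0. Qed.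

(** [T] is e^(z0 [Dx]) followed by x = z, so d/dz0 acts as [Dx]. This differential equation takes
    the place of binomial identities in the inductions on the power of z0. *)
Lemma sderiv_T B : sderiv (T B) = T (Dx B).
Proof.
apply: eq_lser => n; rewrite sderivE; case: n => [j|[|j]] /=; last 2 first.
- by rewrite scale0r.
- by rewrite scaler0.
rewrite addn1 /Tc -iterSr scalerA; congr (_ *: _).
by rewrite -(rmorph_int (@lconst K)) -rmorphM factS_inv.
Qed.

(** This is f(phi(z, z0)), written as e^(z0 p d/dz) f. *)
Definition E f : laurent (laurent K) :=
  lseries (fun n => lconst (n`!%:R^-1) * iter n Dl f).

Lemma phiE : phi p = E (lmonom 1 1). Proof. by []. Qed.

Lemma E_pos f n : n < 0 -> E f n = 0. Proof. by case: n. Qed.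

Lemma lderiv_E f : lderiv (E f) = E (Dl f).
Proof.
apply: eq_laurent => n; rewrite lderivE; case: n => [j|[|j]] /=; last 2 first.
- by rewrite mul0r.
- by rewrite mulr0.
rewrite addn1 -iterSr mulrA; congr (_ * _).
by rewrite -(rmorph_int (@lconst K)) -rmorphM factS_inv.
Qed.

Lemma T_add B B' : bounded2 B -> bounded2 B' ->
  T (fun m n => B m n + B' m n) = T B + T B'.
Proof.
move=> bB bB'; apply: eq_lser => n; rewrite lserD; case: n => j //=; last by rewrite addr0.
rewrite /Tc -scalerDr; congr (_ *: _).
rewrite -DeltaLD; try exact: bounded2_iter.
congr DeltaL; elim: j B B' bB bB' => // j IH B B' bB bB'.
rewrite !iterSr -IH; try exact: bounded2_Dx.
congr (iter j Dx _); apply/funext => m; apply/funext => n.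
have e : colx (fun m n => B m n + B' m n) n = colx B n + colx B' n.
  by apply: eq_lser => i; rewrite lserD !colxE//; exact: bounded2D.
by rewrite {1}/Dx e DsD.
Qed.

(** A derivation exponentiates to a multiplicative map. Both sides agree at z0 = 0 and their
    z0-derivatives expand by the Leibniz rule, so the coefficient of z0^(j + 1) follows from that of
    z0^j, for other f and B, on dividing by j + 1. *)
Lemma T_mulx f B : bounded2 B -> T (mulx f B) = E f *: T B.
Proof.
move=> bB; apply: eq_lser => n.
case: n => j; last first.
  rewrite T_pos// lscale_pos//; [exact: E_pos|exact: T_pos].
elim: j f B bB => [|j IH] f B bB.
  rewrite lscale_coef0; [|exact: E_pos|exact: T_pos].
  rewrite /= /Tc /= fact0 invr1 rmorph1 !scale1r mul1r.
  exact: DeltaL_mulx.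
apply: (scalerI (natr_laurent_neq0 j)).
have h (X : lser (lser W)) : (j.+1%:Z)%:~R *: X j.+1 = sderiv X j.
  by rewrite sderivE; congr (_%:~R *: X _); lia.
rewrite !h sderiv_T sderivZ lderiv_E sderiv_T Dx_mulx//.
have bDB := bounded2_Dx bB.
rewrite (T_add (bounded2_mulx (Dl f) bB) (bounded2_mulx f bDB)) !lserD.
by rewrite (IH _ _ bB) (IH _ _ bDB).
Qed.

Lemma T_mulz f B : bounded2 B -> T (mulz f B) = lconst f *: T B.
Proof.
move=> bB; apply: eq_lser => n; rewrite lscale_const.
case: n => j; last by rewrite !T_pos// scaler0.
rewrite /= /Tc scalerA [f * _]mulrC -scalerA; congr (_ *: _).
rewrite -DeltaL_mulz; last exact: bounded2_iter.
congr DeltaL; elim: j B bB => // j IH B bB.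
by rewrite !iterSr Dx_mulz// IH//; exact: bounded2_Dx.
Qed.

Lemma T_const (a : K) B : bounded2 B ->
  T (fun m n => a *: B m n) = lconst (lconst a) *: T B.
Proof.
move=> bB; rewrite -T_mulz//; congr T; apply/funext => m; apply/funext => n.
by rewrite /mulz /mulx lscale_const colxE//; exact: bounded2_tr.
Qed.

Lemma T_eq0 B : (forall m n, B m n = 0) -> T B = 0.
Proof.
move=> B0; have bB : bounded2 B by exists 0 => m n _; exact: B0.
rewrite (_ : B = fun m n => 0 *: B m n); last first.
  by apply/funext => m; apply/funext => n; rewrite scale0r B0.
by rewrite T_const// !rmorph0 scale0r.
Qed.

Lemma T_sub B B' : bounded2 B -> bounded2 B' ->
  T (fun m n => B m n - B' m n) = T B - T B'.
Proof.
move=> bB bB'.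
rewrite (_ : (fun m n => _) = (fun m n => B m n + (-1) *: B' m n)); last first.
  by apply/funext => m; apply/funext => n; rewrite scaleN1r.
by rewrite T_add ?T_const ?rmorphN ?rmorph1 ?scaleN1r//; exact: bounded2Z.
Qed.

(* the image of q(x, z) in K((z))((z0)) at x = phi(z, z0) *)
Definition evphi (q : {poly (laurent K)}) : laurent (laurent K) :=
  (map_poly lconst q).[phi p].

Lemma evphiD : {morph evphi : q r / q + r}.
Proof. by move=> q r; rewrite /evphi rmorphD hornerD. Qed.

Lemma evphiM : {morph evphi : q r / q * r}.
Proof. by move=> q r; rewrite /evphi rmorphM hornerM. Qed.

Lemma evphiX : evphi 'X = phi p.
Proof. by rewrite /evphi map_polyX hornerX. Qed.

Lemma evphiC c : evphi c%:P = lconst c.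
Proof. by rewrite /evphi map_polyC hornerC. Qed.

Lemma bounded2_pact (q : {poly (laurent K)}) (G : int -> lser W) :
  bounded2 (fun m => G m) -> bounded2 (fun m => pact q G m).
Proof.
move=> [N GN].
elim/poly_ind: q => [|q c [N1 IH]]; first by exists 0 => m n _; rewrite pact0l.
have [P cP] := laurentP c.
exists (Num.min (Num.min N (N1 + 1)) (Num.min N1 (P + N))) => m n h.
rewrite pact_ind lserD IH; last by lia.
rewrite add0r; have [nP|nP] := ltP n (P + N).
  by apply: (lscale_lo cP _ nP) => i iN; rewrite (bdd2_z _ GN).
suff -> : G m = 0 by rewrite scaler0.
by apply: eq_lser => i; rewrite (bdd2_x _ GN)//; lia.
Qed.

Lemma bounded2_shift B k : bounded2 B -> bounded2 (fun m => B (m - k)).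
Proof.
by move=> [N BN]; exists (Num.max N (N + k) + Num.min 0 (Num.min k (- k))) => m n h;
   apply: BN; lia.
Qed.

Lemma T_shift B : bounded2 B -> T (fun m => B (m - 1)) = phi p *: T B.
Proof.
move=> bB; rewrite phiE -T_mulx//; congr T; apply/funext => m; apply/funext => n.
by rewrite /mulx lscale_monom colxE.
Qed.

Lemma T_scale f (G : int -> lser W) : bounded2 (fun m => G m) ->
  T (fun m => f *: G m) = lconst f *: T (fun m => G m).
Proof.
move=> bG; rewrite -T_mulz//; congr T; apply/funext => m; apply/funext => n.
by rewrite /mulz /mulx; congr (_ _ _); congr (_ *: _); rewrite colxK.
Qed.

Lemma T_pact q (G : int -> lser W) : bounded2 (fun m => G m) ->
  T (fun m => pact q G m) = evphi q *: T (fun m => G m).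
Proof.
move=> bG; elim/poly_ind: q => [|q c IH].
  rewrite T_eq0; first by rewrite /evphi rmorph0 horner0 scale0r.
  by move=> m n; rewrite pact0l.
rewrite evphiD evphiM evphiX evphiC scalerDl [_ * phi p]mulrC -scalerA -IH.
rewrite -T_scale// -T_shift; last exact: bounded2_pact.
have bc : bounded2 (fun m => c *: G m).
  have := bounded2_pact c%:P bG.
  by congr bounded2; apply/funext => m; rewrite pactC.
rewrite -(T_add (bounded2_shift 1 (bounded2_pact q bG)) bc).
by congr T; apply/funext => m; apply/funext => n; rewrite pact_ind lserD.
Qed.

End Subst.

(** * Evaluation of polynomials at phi(z, z0) *)

Section Mode.
Variables (K : numFieldType) (p : laurent K).
Hypothesis p_neq0 : p != 0.
Notation L := (laurent K).

Definition zL : L := lmonom 1 1.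

Definition lq (q : {poly {poly K}}) : {poly L} := map_poly (@lpoly K) q.

Lemma poly_phiE q : poly_phi p q = evphi p (lq q).
Proof.
rewrite /poly_phi /evphi /lq; congr (_.[_]).
by rewrite -map_poly_comp.
Qed.

Lemma lqM q r : lq (q * r) = lq q * lq r. Proof. exact: rmorphM. Qed.

Lemma lq_coef q i : (lq q)`_i = lpoly q`_i.
Proof. by rewrite coef_map. Qed.

Lemma size_lq q : size (lq q) = size q.
Proof.
rewrite /lq size_map_inj_poly ?raddf0//; exact: lpoly_inj.
Qed.

Lemma lmul_pos (f g : laurent L) : (forall n, n < 0 -> f n = 0) ->
  (forall n, n < 0 -> g n = 0) -> forall n, n < 0 -> (f * g) n = 0.
Proof. by move=> f0 g0 n n0; exact: (@lscale_pos _ _ f (reg g)). Qed.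

Lemma lmul_coef0 (f g : laurent L) : (forall n, n < 0 -> f n = 0) ->
  (forall n, n < 0 -> g n = 0) -> (f * g) 0 = f 0 * g 0.
Proof. by move=> f0 g0; exact: (@lscale_coef0 _ _ f (reg g)). Qed.

Lemma phi_pos n : n < 0 -> phi p n = 0. Proof. by case: n. Qed.

Lemma phi0 : phi p 0 = zL.
Proof. by rewrite /= /phi_coef /= fact0 invr1 rmorph1 mul1r. Qed.

Lemma lderiv_zL : lderiv zL = 1.
Proof.
apply: eq_laurent => n; rewrite lderivE /=.
have [->|n0] := eqVneq n 0; first by rewrite add0r eqxx mulr1n mul1r.
by rewrite (_ : (n + 1 == 1) = false) ?mulr0n ?mulr0//; lia.
Qed.

Lemma phi1 : phi p 1 = p.
Proof.
by rewrite /= /phi_coef /= invr1 rmorph1 mul1r -/zL lderiv_zL mulr1.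
Qed.

Lemma lconst_pos (c : L) n : n < 0 -> lconst c n = 0 :> L.
Proof. by case: n => [] //= n _; rewrite mulr0n. Qed.

Lemma lconst0 (c : L) : lconst c 0 = c :> L.
Proof. by rewrite /= mulr1n. Qed.

Lemma evphi_pos q n : n < 0 -> evphi p q n = 0.
Proof.
elim/poly_ind: q n => [|q c IH] n n0; first by rewrite /evphi rmorph0 horner0.
rewrite evphiD evphiM evphiX evphiC laurD lconst_pos// addr0.
by apply: lmul_pos => //; exact: phi_pos.
Qed.

Lemma evphi0 q : evphi p q 0 = q.[zL].
Proof.
elim/poly_ind: q => [|q c IH]; first by rewrite /evphi rmorph0 !horner0.
rewrite evphiD evphiM evphiX evphiC laurD lconst0 hornerMXaddC.
by rewrite lmul_coef0 ?phi0 ?IH//; [exact: evphi_pos|exact: phi_pos].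
Qed.

Lemma lq_hornerX q : (lq q).[zL] = lpoly q.['X].
Proof. by rewrite /lq /zL -lpolyX horner_map. Qed.

(** [k] is the multiplicity of z1 = z2 as a root of q. The cofactor is nonzero on the diagonal, and
    its diagonal value is what is left of it at z0 = 0, where phi(z, z0) = z. *)
Lemma diag_factor (q : {poly {poly K}}) : q != 0 ->
  exists k g, q = g * ('X - 'X%:P) ^+ k /\ lpoly g.['X] != 0.
Proof.
move=> q0; have [k [g]] := multiplicity_XsubC q 'X.
rewrite q0 /= => gX ->; exists k, g; split=> //.
apply: contra gX => /eqP h; apply/rootP/lpoly_inj.
by rewrite h raddf0.
Qed.

Lemma poly_phi_neq0 q : q != 0 -> poly_phi p q != 0.
Proof.
move=> /diag_factor[k [g [-> g0]]]; rewrite poly_phiE lqM evphiM mulf_neq0//.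
  apply: contra g0 => /eqP h.
  by rewrite -lq_hornerX -evphi0 h.
have -> : lq (('X - 'X%:P) ^+ k) = ('X - zL%:P) ^+ k.
  by rewrite /lq rmorphXn rmorphB /= map_polyX map_polyC /= lpolyX.
have -> : evphi p (('X - zL%:P) ^+ k) = (phi p - lconst zL) ^+ k.
  by rewrite /evphi rmorphXn rmorphB /= map_polyX map_polyC /= horner_exp hornerXsubC.
rewrite expf_neq0//; apply/eqP => /(congr1 (fun f : laurent L => f 1)).
by rewrite laurB phi1 /= mulr0n subr0 => /eqP; rewrite (negbTE p_neq0).
Qed.

End Mode.

(** * Products of quasi local fields *)

Section Fields.
Variables (K : numFieldType) (W : lmodType K) (p : laurent K).
Implicit Types (a b : distr W) (A : distr2 W) (q : {poly {poly K}}).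

Definition vec a (w : W) : lser W := to_lser (fun n => a n w).

Lemma vecE a w n : in_EW a -> vec a w n = a n w.
Proof. by move=> [_ /(_ w) ab]; rewrite to_lserE. Qed.

Lemma EW_lo a w : in_EW a -> exists N, forall n, n < N -> a n w = 0.
Proof. by move=> [_ /(_ w)]. Qed.

Definition zrow A (w : W) (m : int) : lser W := to_lser (fun n => A m n w).

(** The bound may vary with the power of z1: a commutator of fields satisfies no more than this, and
    it suffices for polynomials in z1 and z to act on the rows. *)
Definition rowb A : Prop := forall w m, bounded_below (fun n => A m n w).

Lemma zrowE A w m n : rowb A -> zrow A w m n = A m n w.
Proof. by move=> h; rewrite to_lserE. Qed.

Lemma distr0 a n : in_EW a -> a n 0 = 0.
Proof. by move=> [+ _] => /(_ n) /plin0. Qed.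

Lemma rowb_prod a b : in_EW a -> in_EW b -> rowb (distr_prod a b).
Proof.
move=> aE bE w m; have [N bN] := EW_lo w bE.
by exists N => n /bN h; rewrite /distr_prod h distr0.
Qed.

Lemma rowb_comm a b : in_EW a -> in_EW b -> rowb (distr_comm a b).
Proof.
move=> aE bE w m; have [N bN] := EW_lo w bE.
have [N' bN'] := EW_lo (a m w) bE.
exists (Num.min N N') => n h; rewrite /distr_comm bN ?bN' ?distr0 ?subrr//; lia.
Qed.

Notation prodv a b := (zrow (distr_prod a b)).
Notation commv a b := (zrow (distr_comm a b)).

Lemma prodvE a b w m n : in_EW a -> in_EW b -> prodv a b w m n = a m (b n w).
Proof. by move=> aE bE; rewrite zrowE//; exact: rowb_prod. Qed.

Lemma commvE a b w m n : in_EW a -> in_EW b ->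
  commv a b w m n = a m (b n w) - b n (a m w).
Proof. by move=> aE bE; rewrite zrowE//; exact: rowb_comm. Qed.

Lemma commv_prodv a b w m : in_EW a -> in_EW b ->
  prodv a b w m = commv a b w m + vec b (a m w).
Proof.
move=> aE bE; apply: eq_lser => n.
by rewrite lserD prodvE// commvE// vecE// subrK.
Qed.

Lemma lpoly_scale (r : {poly K}) (f : lser W) n :
  (lpoly r *: f) n = \sum_(j < size r) r`_j *: f (n - j%:Z).
Proof.
rewrite lscaleE (@fsum_box _ 0 (size r)).
- rewrite subr0 absz_nat big_map -{1}[size r]subn0 -/(index_iota 0 _) big_mkord.
  by apply: eq_bigr => i _; rewrite add0r.
- by move=> i i0; rewrite lpoly_neg// scale0r.
- by case=> i //= h; rewrite nth_default ?scale0r//; lia.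
Qed.

Lemma poly2_mulE q A w m n : rowb A ->
  poly2_mul q A m n w = pact (lq q) (zrow A w) m n.
Proof.
move=> hA; rewrite /pact lser_sum size_lq; apply: eq_bigr => i _.
rewrite lq_coef lpoly_scale; apply: eq_bigr => j _.
by rewrite zrowE.
Qed.

Definition kills q a b := forall w m, pact (lq q) (commv a b w) m = 0.

Lemma qlocalP q a b : in_EW a -> in_EW b ->
  qlocal_with q a b <-> q != 0 /\ kills q a b.
Proof.
move=> aE bE; split=> -[q0 h]; split=> //.
  move=> w m; apply: eq_lser => n; rewrite -poly2_mulE ?h//.
  exact: rowb_comm.
apply/funext => m; apply/funext => n; apply/funext => w.
by rewrite poly2_mulE ?h//; exact: rowb_comm.
Qed.

Lemma kills_mull q r a b : kills q a b -> kills (r * q) a b.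
Proof. by move=> h w m; rewrite lqM pactM; apply: pact0r => i; exact: h. Qed.

Lemma kills_mulr q r a b : kills q a b -> kills (q * r) a b.
Proof. by rewrite mulrC; exact: kills_mull. Qed.

Lemma pact_lq_lo q (G : int -> lser W) N :
  (forall m n, n < N -> G m n = 0) ->
  forall m n, n < N -> pact (lq q) G m n = 0.
Proof.
move=> GN m n nN; rewrite /pact lser_sum big1// => i _.
rewrite lq_coef lpoly_scale big1// => j _.
by rewrite GN ?scaler0//; lia.
Qed.

Lemma prod_kills q a b w m : in_EW a -> in_EW b -> kills q a b ->
  pact (lq q) (prodv a b w) m = pact (lq q) (fun m => vec b (a m w)) m.
Proof.
move=> aE bE h; rewrite -[RHS]add0r -(h w m) -pactDr.
by apply: pact_eqr => i; exact: commv_prodv.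
Qed.

(** The bound in z comes from a(z1) b(z), where b acts first. The bound in z1 comes from b(z) a(z1),
    to which the product becomes equal once multiplied by q. *)
Lemma prod_bounded q a b w : in_EW a -> in_EW b -> kills q a b ->
  bounded2 (fun m => pact (lq q) (prodv a b w) m).
Proof.
move=> aE bE h; have [N aN] := EW_lo w aE; have [N' bN'] := EW_lo w bE.
exists (Num.min N N') => m n /orP[mN|nN].
  rewrite prod_kills// (@pact_lo _ _ _ _ N)//; last by lia.
  move=> i /aN ->; apply: eq_lser => j.
  by rewrite vecE// distr0.
apply: (@pact_lq_lo _ _ N'); last by lia.
by move=> i j jN; rewrite prodvE// bN' ?distr0.
Qed.

Lemma iter_pderiv1 A w j i n : bounded2 (fun m n => A m n w) ->
  iter j (pderiv1 p) A i n w = iter j (Dx p) (fun m n => A m n w) i n.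
Proof.
move=> bA; elim: j i n => // j IH i n; rewrite !iterS {1}/pderiv1 /Dx.
rewrite lscaleE; apply: eq_fsbigr => h _; rewrite sderivE IH.
by rewrite colxE//; exact: bounded2_iter.
Qed.

Lemma subst_phiE A w k m : bounded2 (fun m n => A m n w) ->
  subst_phi p A k m w = T p (fun m n => A m n w) k m.
Proof.
move=> bA; case: k => j; last by [].
rewrite -[RHS]/(Tc p j _ m) /subst_phi /Tc lscale_const DeltaLE; last first.
  exact: bounded2_iter.
by congr (_ *: _); apply: eq_fsbigr => i _; exact: iter_pderiv1.
Qed.

Lemma distr_sumE (r : seq int) (f : int -> distr W) m w :
  (\sum_(i <- r) f i) m w = \sum_(i <- r) f i m w.
Proof. by elim: r => [|i r IH]; rewrite ?big_nil// !big_cons -IH. Qed.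

(** The sum over the powers of z0 is a sum of operators. The bound [N] on X, which holds for all w
    at once, makes it finite, and then it can be computed on one vector. *)
Lemma laurent2_actE (f : laurent (laurent K)) (X : int -> distr W) (N : int)
    (Xw : W -> lser (lser W)) n m w :
  (forall k, k < N -> X k = 0) ->
  (forall k m w, Xw w k m = X k m w) ->
  laurent2_act f X n m w = (f *: Xw w) n m.
Proof.
move=> XN XE; have [N' fN'] := laurentP f.
rewrite lscaleE /laurent2_act !(@fsum_box _ N' (n - N + 1)).
- rewrite distr_sumE lser_sum; apply: eq_bigr => i _.
  by rewrite /laurent_act lscaleE; apply: eq_fsbigr => j _; rewrite XE.
- by move=> i /fN'->; rewrite scale0r.
- move=> i h; rewrite [Xw _ _](_ : _ = 0) ?scaler0//; apply: eq_lser => j.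
  by rewrite XE XN//; lia.
- move=> i iN; apply/funext => j; apply/funext => v; apply: fsum0 => h.
  by rewrite fN'// scale0r.
- move=> i h; apply/funext => j; apply/funext => v; apply: fsum0 => h'.
  by rewrite XN ?scaler0//; lia.
Qed.

Definition ql a b := exists q, qlocal_with q a b.

Definition q0 a b : {poly {poly K}} := xget 0 [set q | qlocal_with q a b].

Lemma q0P a b : ql a b -> qlocal_with (q0 a b) a b.
Proof. by move=> h; exact: (xgetPex 0 h). Qed.

(* Y(a, z0) b applied to w *)
Definition Yv a b (w : W) : lser (lser W) :=
  (poly_phi p (q0 a b))^-1 *:
  T p (fun m => pact (lq (q0 a b)) (prodv a b w) m).

Lemma T_prodv q a b w k m : in_EW a -> in_EW b -> kills q a b ->
  T p (fun m => pact (lq q) (prodv a b w) m) k m =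
  subst_phi p (poly2_mul q (distr_prod a b)) k m w.
Proof.
move=> aE bE h.
have e : (fun m n => poly2_mul q (distr_prod a b) m n w) =
         (fun m => pact (lq q) (prodv a b w) m).
  apply/funext => i; apply/funext => j.
  by rewrite poly2_mulE//; exact: rowb_prod.
by rewrite subst_phiE e//; exact: prod_bounded.
Qed.

Lemma YphiE a b n m w : in_EW a -> in_EW b -> ql a b ->
  Yphi p a b n m w = Yv a b w n m.
Proof.
move=> aE bE abq; rewrite /Yphi.
apply: (@laurent2_actE _ _ 0 (fun w => T p (fun m => pact (lq (q0 a b)) (prodv a b w) m))).
  by case.
have [_ h] := (qlocalP _ aE bE).1 (q0P abq).
by move=> k i v; rewrite T_prodv.
Qed.

(** The bound is uniform in w, since negative powers of z0 can only come from the inverse of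
    q(phi(z, z0), z). *)
Lemma Yv_lo a b : exists N, forall w n, n < N -> Yv a b w n = 0.
Proof.
have [N fN] := laurentP (poly_phi p (q0 a b))^-1.
exists N => w n nN; apply: (lscale_lo fN (M := 0)); last by rewrite addr0.
exact: T_pos.
Qed.

Lemma nprodE a b n m w : in_EW a -> in_EW b -> ql a b ->
  nprod p a n b m w = Yv a b w (- n - 1) m.
Proof. exact: YphiE. Qed.

Definition kk (c : K) : laurent (laurent K) := lconst (lconst c).

Lemma kkE c (X : lser (lser W)) n m : (kk c *: X) n m = c *: X n m.
Proof. by rewrite !lscale_const. Qed.

Lemma T_pact_lin (q : {poly laurent K}) c (G G' H : int -> lser W) :
  bounded2 (fun m => pact q G m) -> bounded2 (fun m => pact q G' m) ->
  (forall i j, H i j = c *: G i j + G' i j) ->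
  T p (fun m => pact q H m) =
  kk c *: T p (fun m => pact q G m) + T p (fun m => pact q G' m).
Proof.
move=> bG bG' HE; rewrite -T_const// -T_add//; last exact: bounded2Z.
congr T; apply/funext => m; apply/funext => n.
transitivity ((lconst c *: pact q G m + pact q G' m) n); last first.
  by rewrite lserD lscale_const.
rewrite -pactZr -pactDr; congr (_ _ n); apply: pact_eqr => i.
by apply: eq_lser => j; rewrite lserD lscale_const HE.
Qed.

Lemma EW_lin c a b : in_EW a -> in_EW b -> in_EW (c *: a + b).
Proof.
move=> aE bE; split=> [n d u v|w].
  rewrite -[LHS]/(c *: a n (d *: u + v) + b n (d *: u + v)).
  rewrite -[RHS]/(d *: (c *: a n u + b n u) + (c *: a n v + b n v)).
  rewrite (aE.1 n) (bE.1 n) !scalerDr !scalerA mulrC -!addrA; congr (_ + _).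
  by rewrite addrCA.
have [N aN] := EW_lo w aE; have [N' bN'] := EW_lo w bE.
exists (Num.min N N') => n h.
by rewrite -[LHS]/(c *: a n w + b n w) aN ?bN' ?scaler0 ?addr0//; lia.
Qed.

Lemma kills_linl q c a a' b : in_EW a -> in_EW a' -> in_EW b ->
  kills q a b -> kills q a' b -> kills q (c *: a + a') b.
Proof.
move=> aE aE' bE h h' w m.
transitivity (pact (lq q)
  (fun i => lconst c *: commv a b w i + commv a' b w i) m); last first.
  by rewrite pactDr pactZr h h' scaler0 addr0.
apply: pact_eqr => i; apply: eq_lser => j.
rewrite lserD lscale_const !commvE//; last exact: EW_lin.
rewrite -[(c *: a + a') i _]/(c *: a i (b j w) + a' i (b j w)).
rewrite -[(c *: a + a') i w]/(c *: a i w + a' i w).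
rewrite (plinD (bE.1 j)) (plinZ (bE.1 j)) scalerBr.
by rewrite opprD addrACA.
Qed.

Lemma kills_linr q c a b b' : in_EW a -> in_EW b -> in_EW b' ->
  kills q a b -> kills q a b' -> kills q a (c *: b + b').
Proof.
move=> aE bE bE' h h' w m.
transitivity (pact (lq q)
  (fun i => lconst c *: commv a b w i + commv a b' w i) m); last first.
  by rewrite pactDr pactZr h h' scaler0 addr0.
apply: pact_eqr => i; apply: eq_lser => j.
rewrite lserD lscale_const !commvE//; last exact: EW_lin.
rewrite -[(c *: b + b') j _]/(c *: b j w + b' j w).
rewrite -[(c *: b + b') j (a i w)]/(c *: b j (a i w) + b' j (a i w)).
rewrite (plinD (aE.1 i)) (plinZ (aE.1 i)) scalerBr.
by rewrite opprD addrACA.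
Qed.

Lemma ql_common a b a' b' : in_EW a -> in_EW b -> in_EW a' -> in_EW b' ->
  ql a b -> ql a' b' -> exists q, [/\ q != 0, kills q a b & kills q a' b'].
Proof.
move=> aE bE aE' bE' [q /(qlocalP _ aE bE)[q0 qk]] [r /(qlocalP _ aE' bE')[r0 rk]].
exists (q * r); split; [by rewrite mulf_neq0|exact: kills_mulr|exact: kills_mull].
Qed.

Hypothesis p_neq0 : p != 0.

(** Independence of the choice in [Yphi]: after multiplication by the value of [q0 a b] at phi, both
    sides are the substitution in a(z1) b(z) multiplied by q and by [q0 a b], and polynomials
    commute. *)
Lemma Yv_spec q a b w : in_EW a -> in_EW b -> ql a b -> q != 0 -> kills q a b ->
  poly_phi p q *: Yv a b w = T p (fun m => pact (lq q) (prodv a b w) m).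
Proof.
move=> aE bE abq qn0 qk; have [q0n0 q0k] := (qlocalP _ aE bE).1 (q0P abq).
have Q0 := poly_phi_neq0 p_neq0 q0n0.
apply: (scalerI Q0); rewrite /Yv !scalerA mulrAC mulfV// mul1r.
rewrite !poly_phiE -!T_pact; try exact: prod_bounded.
congr T; apply/funext => m; apply/funext => n.
by rewrite -!pactM mulrC.
Qed.

Lemma Yv_unique q a b w X : in_EW a -> in_EW b -> ql a b -> q != 0 -> kills q a b ->
  poly_phi p q *: X = T p (fun m => pact (lq q) (prodv a b w) m) -> X = Yv a b w.
Proof.
move=> aE bE abq qn0 qk; rewrite -Yv_spec//.
exact/scalerI/poly_phi_neq0.
Qed.

Lemma Yv_linear_r a b c w w' : in_EW a -> in_EW b -> ql a b ->
  Yv a b (c *: w + w') = kk c *: Yv a b w + Yv a b w'.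
Proof.
move=> aE bE abq; have [qn0 qk] := (qlocalP _ aE bE).1 (q0P abq).
apply/esym/(Yv_unique (q := q0 a b)) => //.
rewrite scalerDr scalerA mulrC -scalerA !Yv_spec//.
apply/esym/T_pact_lin; try exact: prod_bounded.
move=> i j; rewrite !prodvE//.
by rewrite (plinD (bE.1 j)) (plinZ (bE.1 j)) (plinD (aE.1 i)) (plinZ (aE.1 i)).
Qed.

Lemma nprod_EW a b n : in_EW a -> in_EW b -> ql a b -> in_EW (nprod p a n b).
Proof.
move=> aE bE abq; split=> [m c w w'|w].
  by rewrite !nprodE// Yv_linear_r// lserD kkE.
by have [N h] := lserP (Yv a b w (- n - 1)); exists N => m /h; rewrite nprodE.
Qed.

Lemma vec_nprod a b n w : in_EW a -> in_EW b -> ql a b ->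
  vec (nprod p a n b) w = Yv a b w (- n - 1).
Proof.
move=> aE bE abq; apply: eq_lser => m; rewrite vecE ?nprodE//.
exact: nprod_EW.
Qed.

Lemma Yv_linl c a a' b w : in_EW a -> in_EW a' -> in_EW b -> ql a b -> ql a' b ->
  Yv (c *: a + a') b w = kk c *: Yv a b w + Yv a' b w.
Proof.
move=> aE aE' bE h h'; have [q [qn0 qk qk']] := ql_common aE bE aE' bE h h'.
have cE := EW_lin c aE aE'; have ck := kills_linl c aE aE' bE qk qk'.
apply/esym/(Yv_unique (q := q)) => //; first by exists q; apply/qlocalP.
rewrite scalerDr scalerA mulrC -scalerA !Yv_spec//.
apply/esym/T_pact_lin; try exact: prod_bounded.
by move=> i j; rewrite !prodvE.
Qed.

Lemma Yv_linr c a b b' w : in_EW a -> in_EW b -> in_EW b' -> ql a b -> ql a b' ->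
  Yv a (c *: b + b') w = kk c *: Yv a b w + Yv a b' w.
Proof.
move=> aE bE bE' h h'; have [q [qn0 qk qk']] := ql_common aE bE aE bE' h h'.
have cE := EW_lin c bE bE'; have ck := kills_linr c aE bE bE' qk qk'.
apply/esym/(Yv_unique (q := q)) => //; first by exists q; apply/qlocalP.
rewrite scalerDr scalerA mulrC -scalerA !Yv_spec//.
apply/esym/T_pact_lin; try exact: prod_bounded.
move=> i j; rewrite !prodvE//.
rewrite -[(c *: b + b') j w]/(c *: b j w + b' j w).
by rewrite (plinD (aE.1 i)) (plinZ (aE.1 i)).
Qed.

Lemma nprod_linl c a a' b n : in_EW a -> in_EW a' -> in_EW b -> ql a b -> ql a' b ->
  ql (c *: a + a') b ->
  nprod p (c *: a + a') n b = c *: nprod p a n b + nprod p a' n b.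
Proof.
move=> aE aE' bE h h' h''; apply/funext => m; apply/funext => w.
rewrite -[RHS]/(c *: nprod p a n b m w + nprod p a' n b m w).
rewrite (nprodE _ _ _ aE bE h) (nprodE _ _ _ aE' bE h').
rewrite (nprodE _ _ _ (EW_lin c aE aE') bE h'') (Yv_linl _ _ aE aE' bE h h').
by rewrite lserD kkE.
Qed.

Lemma nprod_linr c a b b' n : in_EW a -> in_EW b -> in_EW b' -> ql a b -> ql a b' ->
  ql a (c *: b + b') ->
  nprod p a n (c *: b + b') = c *: nprod p a n b + nprod p a n b'.
Proof.
move=> aE bE bE' h h' h''; apply/funext => m; apply/funext => w.
rewrite -[RHS]/(c *: nprod p a n b m w + nprod p a n b' m w).
rewrite (nprodE _ _ _ aE bE h) (nprodE _ _ _ aE bE' h').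
rewrite (nprodE _ _ _ aE (EW_lin c bE bE') h'') (Yv_linr _ _ aE bE bE' h h').
by rewrite lserD kkE.
Qed.

Lemma nprod_trunc a b : in_EW a -> in_EW b -> ql a b ->
  exists N : int, forall n, N <= n -> nprod p a n b = 0.
Proof.
move=> aE bE abq; have [N h] := Yv_lo a b; exists (- N) => n nN.
apply/funext => m; apply/funext => w; rewrite nprodE// h//.
by move: nN; clear; lia.
Qed.

Lemma nprod_assoc a b : in_EW a -> in_EW b -> ql a b ->
  exists f : {poly {poly K}},
    [/\ f != 0, in_EW2 (poly2_mul f (distr_prod a b)) &
        laurent2_act (poly_phi p f) (fun k => nprod p a (- k - 1) b) =
        subst_phi p (poly2_mul f (distr_prod a b))].
Proof.
move=> aE bE abq; have [qn0 qk] := (qlocalP _ aE bE).1 (q0P abq).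
have rb := rowb_prod aE bE.
exists (q0 a b); split=> //.
  split=> [m n c u v|w].
    rewrite /poly2_mul scaler_sumr -big_split; apply: eq_bigr => i _ /=.
    rewrite scaler_sumr -big_split; apply: eq_bigr => j _ /=.
    rewrite /distr_prod (bE.1 _) (aE.1 _) scalerDr !scalerA.
    by rewrite [_ * c]mulrC.
  have [N h] := prod_bounded w aE bE qk; exists N => m n mn.
  by rewrite poly2_mulE// h.
apply/funext => k; apply/funext => m; apply/funext => w.
have [N h] := Yv_lo a b.
rewrite (@laurent2_actE _ _ N (Yv a b)).
- by rewrite Yv_spec// T_prodv.
- move=> j jN; apply/funext => i; apply/funext => v.
  by rewrite nprodE// (_ : - _ - 1 = j) ?h//; lia.
- by move=> j i v; rewrite nprodE// (_ : - (- j - 1) - 1 = j)//; lia.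
Qed.

End Fields.
Notation prodv a b := (zrow (distr_prod a b)).
Notation commv a b := (zrow (distr_comm a b)).

(** * Locality of the products *)

Section PolyAction2.
Variables (F : fieldType) (V : lmodType F).
Implicit Types (t s : {poly {poly F}}) (r : {poly F}) (G : int -> int -> V).

(* t(x, y) acts on V[[x, x^-1, y, y^-1]]; y is the inner variable of t *)
Definition pact2 t G : int -> int -> V :=
  fun m n => \sum_(i < size t) pact t`_i (G (m - i%:Z)) n.

Lemma pact2E k t G m n : (size t <= k)%N ->
  pact2 t G m n = \sum_(i < k) pact t`_i (G (m - i%:Z)) n.
Proof.
move=> tk; rewrite /pact2.
rewrite (big_ord_widen k (fun i => pact t`_i (G (m - i%:Z)) n) tk).
rewrite big_mkcond; apply: eq_bigr => i _; case: ltnP => // h.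
by rewrite nth_default ?pact0l.
Qed.

Lemma pact2Dl t s G m n : pact2 (t + s) G m n = pact2 t G m n + pact2 s G m n.
Proof.
pose k := maxn (size t) (size s).
rewrite !(@pact2E k) ?size_polyD ?leq_maxl ?leq_maxr// -big_split /=.
by apply: eq_bigr => i _; rewrite coefD pactDl.
Qed.

Lemma pact2C r G m n : pact2 r%:P G m n = pact r (G m) n.
Proof.
by rewrite (@pact2E 1) ?size_polyC ?leq_b1// big_ord1 coefC /= subr0.
Qed.

Lemma pact2MX t G m n : pact2 (t * 'X) G m n = pact2 t G (m - 1) n.
Proof.
rewrite (@pact2E (size t).+1); last first.
  by rewrite (leq_trans (size_polyMleq _ _))// size_polyX addn2.
rewrite big_ord_recl coefMX /= pact0l add0r /pact2; apply: eq_bigr => i _.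
by rewrite coefMX /=; congr (pact _ (G _) _); rewrite /bump; lia.
Qed.

Lemma pact2_ind t r G m n :
  pact2 (t * 'X + r%:P) G m n = pact2 t G (m - 1) n + pact r (G m) n.
Proof. by rewrite pact2Dl pact2MX pact2C. Qed.

Lemma pact2_0l G m n : pact2 0 G m n = 0.
Proof. by rewrite /pact2 size_poly0 big_ord0. Qed.

Lemma pact2_CM r t G m n :
  pact2 (r%:P * t) G m n = pact r (pact2 t G m) n.
Proof.
rewrite (@pact2E (size t)).
  rewrite {2}/pact; under [RHS]eq_bigr do rewrite /pact2 scaler_sumr.
  rewrite exchange_big; apply: eq_bigr => i _.
  by rewrite coefCM pactM.
by rewrite mul_polyC size_scale_leq.
Qed.

Lemma pact2M t s G m n : pact2 (t * s) G m n = pact2 t (pact2 s G) m n.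
Proof.
elim/poly_ind: t m n => [|t r IH] m n; first by rewrite mul0r !pact2_0l.
rewrite mulrDl pact2Dl -mulrA ['X * s]mulrC mulrA pact2MX IH pact2_ind.
by rewrite pact2_CM.
Qed.

Lemma pact2_mapC r G m n :
  pact2 (map_poly polyC r) G m n = pact r (fun m => G m n) m.
Proof.
rewrite (@pact2E (size r)); last by rewrite size_map_polyC.
by apply: eq_bigr => i _; rewrite coef_map pactC.
Qed.

Lemma pact2_coefE k t G m n : (forall i, (size (t`_i)%R <= k)%N) -> (size t <= k)%N ->
  pact2 t G m n = \sum_(i < k) \sum_(j < k) t`_i`_j *: G (m - i%:Z) (n - j%:Z).
Proof.
move=> h tk; rewrite (pact2E _ _ _ tk); apply: eq_bigr => i _.
exact: pactE.
Qed.

Lemma poly2_bound t : exists k, (forall i, (size (t`_i)%R <= k)%N) /\ (size t <= k)%N.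
Proof.
exists (maxn (size t) (\max_(i < size t) size (t`_i)%R)); split=> [i|]; last first.
  exact: leq_maxl.
have [it|it] := ltnP i (size t); last by rewrite nth_default ?size_poly0.
apply: leq_trans (leq_maxr _ _).
exact: (leq_bigmax (Ordinal it)).
Qed.

Lemma pact2_swap t G m n :
  pact2 (swapXY t) (fun n m => G m n) n m = pact2 t G m n.
Proof.
have [k [h tk]] := poly2_bound t; have [k' [h' tk']] := poly2_bound (swapXY t).
pose K := maxn k k'.
have kK : (k <= K)%N by exact: leq_maxl.
have kK' : (k' <= K)%N by exact: leq_maxr.
rewrite !(@pact2_coefE K)//; try by [
  move=> i; exact: leq_trans (h _) _ | move=> i; exact: leq_trans (h' _) _
  |exact: leq_trans tk _|exact: leq_trans tk' _].
rewrite exchange_big; apply: eq_bigr => i _; apply: eq_bigr => j _.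
by rewrite coef_swapXY.
Qed.

Lemma pact2_0r t G m n : (forall m n, G m n = 0) -> pact2 t G m n = 0.
Proof. by move=> e; apply: big1 => i _; apply: pact0r. Qed.

Lemma pact2Br t G G' m n :
  pact2 t (fun m n => G m n - G' m n) m n = pact2 t G m n - pact2 t G' m n.
Proof.
rewrite /pact2 -sumrN -big_split; apply: eq_bigr => i _.
exact: pactBr.
Qed.

Lemma pact2_ylo t G N : (forall m n, n < N -> G m n = 0) ->
  forall m n, n < N -> pact2 t G m n = 0.
Proof.
by move=> GN m n nN; apply: big1 => i _; apply: (@pact_lo _ _ _ _ N) => // j; exact: GN.
Qed.

End PolyAction2.

(** * Double series and the exchange of their two variables *)

Section DoubleSeries.
Variable L : fieldType.
Notation L2 := (laurent (laurent L)).

(* f and g have the same coefficients, up to the order of the variables, and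
   no negative exponents *)
Definition sym (V : nmodType) (f g : int -> int -> V) : Prop :=
  (forall i j, f j i = g i j) /\ (forall i j, (i < 0) || (j < 0) -> f i j = 0).

Lemma sym_sym (V : nmodType) (f g : int -> int -> V) : sym f g -> sym g f.
Proof.
by move=> [e z]; split=> i j; [rewrite e|rewrite -e => h; apply: z; rewrite orbC].
Qed.

Section Module.
Variable V : lmodType L.

Lemma quad_row (x : lser (lser V)) :
  (forall i j, (i < 0) || (j < 0) -> x i j = 0) -> forall i, i < 0 -> x i = 0.
Proof. by move=> h i i0; apply: eq_lser => j; rewrite h// i0. Qed.

Lemma quad_rowl (u : L2) :
  (forall i j, (i < 0) || (j < 0) -> u i j = 0) -> forall i, i < 0 -> u i = 0.
Proof. by move=> h i i0; apply: eq_laurent => j; rewrite h// i0. Qed.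

Lemma quad_coef (u : L2) (x : lser (lser V)) (i j : nat) :
  (forall i j, (i < 0) || (j < 0) -> u i j = 0) ->
  (forall i j, (i < 0) || (j < 0) -> x i j = 0) ->
  (u *: x) i j = \sum_(h < i.+1) \sum_(l < j.+1)
    u h l *: x (i%:Z - h%:Z) (j%:Z - l%:Z).
Proof.
move=> u0 x0; rewrite lscale_coef; [|exact: quad_rowl|exact: quad_row].
rewrite lser_sum; apply: eq_bigr => h _.
by rewrite lscale_coef// => n n0; [apply: u0|apply: x0]; rewrite n0 orbT.
Qed.

Lemma quad_scale (u : L2) (x : lser (lser V)) :
  (forall i j, (i < 0) || (j < 0) -> u i j = 0) ->
  (forall i j, (i < 0) || (j < 0) -> x i j = 0) ->
  forall i j, (i < 0) || (j < 0) -> (u *: x) i j = 0.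
Proof.
move=> u0 x0 i j; have [i0 _|i0] := ltP i 0; last rewrite orFb => j0.
  by rewrite (lscale_pos (quad_rowl u0) (quad_row x0) i0).
case: i i0 => // i _; rewrite lscale_coef; [|exact: quad_rowl|exact: quad_row].
rewrite lser_sum big1// => h _; apply: lscale_pos => // n n0.
  by rewrite u0// n0 orbT.
by rewrite x0// n0 orbT.
Qed.

Lemma sym_scale (u u' : L2) (x x' : lser (lser V)) :
  sym (fun i => u i) (fun i => u' i) -> sym (fun i => x i) (fun i => x' i) ->
  sym (fun i => (u *: x) i) (fun i => (u' *: x') i).
Proof.
move=> su sx; have su' := sym_sym su; have sx' := sym_sym sx.
case: (su) => ue uz; case: (su') => _ uz'; case: (sx) => xe xz; case: (sx') => _ xz'.
split; last exact: quad_scale.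
move=> i j; have [neg|] := boolP ((i < 0) || (j < 0)).
  by rewrite !quad_scale// orbC.
case: i => i //; case: j => j //.
move=> _; rewrite !quad_coef// exchange_big /=.
by apply: eq_bigr => h _; apply: eq_bigr => l _; rewrite ue xe.
Qed.

(* c is c 0 to leading order, so the coefficients of y are recovered from those of
   c *: y one after the other, starting from the lowest one. *)
Lemma lscale_unit_closed (F : fieldType) (M : lmodType F) (P : M -> Prop)
    (c : laurent F) (y : lser M) (k : int) :
  P 0 -> (forall u v, P u -> P v -> P (u - v)) ->
  (forall h v, P v -> P (c h *: v)) -> (forall v, P (c 0 *: v) -> P v) ->
  (forall n, n < 0 -> c n = 0) ->
  (forall n, n < k -> P ((c *: y) n)) -> forall n, n < k -> P (y n).
Proof.
move=> P0 PB Pc PV c0 Py; have [N yN] := lserP y.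
have PD u v : P u -> P v -> P (u + v).
  move=> Pu Pv; rewrite -[v]opprK; apply: (PB) => //.
  by rewrite -[- v]add0r; exact: PB.
suff h d n : n < N + d%:Z -> n < k -> P (y n).
  by move=> n; apply: (h (absz (n - N + 1))); lia.
elim: d n => [|d IH] n nd nk; first by rewrite yN//; lia.
apply: PV.
have -> : c 0 *: y n =
    (c *: y) n - \sum_(i <- zrange 1 (absz (n - N))) c i *: y (n - i).
  apply/esym/eqP; rewrite subr_eq; apply/eqP.
  rewrite lscaleE (@fsum_seq _ (0 :: zrange 1 (absz (n - N)))).
  - by rewrite big_cons subr0.
  - by rewrite /= zrange_uniq mem_zrange.
  - move=> i; rewrite inE mem_zrange negb_or => /andP[i0 iN].
    have [/c0->|ip] := ltP i 0; first by rewrite scale0r.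
    by rewrite yN ?scaler0//; lia.
apply: PB; first exact: Py.
rewrite big_seq; elim/big_rec: _ => // i v; rewrite mem_zrange => iN Pv.
by apply: (PD) => //; apply/Pc/IH; lia.
Qed.

(** Division by u is carried out coefficientwise, since x and x' live in spaces where the two
    variables play different roles. The coefficient [u 0 0] is the invertible leading term. *)
Lemma sym_unit (u u' : L2) (x x' : lser (lser V)) :
  sym (fun i => u i) (fun i => u' i) -> u 0 0 != 0 ->
  sym (fun i => (u *: x) i) (fun i => (u' *: x') i) ->
  sym (fun i => x i) (fun i => x' i).
Proof.
(* Negative powers of the outer variable are excluded first. Then each coefficient is freed of
   negative powers of the inner variable, by division by [v 0], a power series with invertible
   constant term. *)
have quad (v : L2) (y : lser (lser V)) :
    (forall i j, (i < 0) || (j < 0) -> v i j = 0) -> v 0 0 != 0 ->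
    (forall i j, (i < 0) || (j < 0) -> (v *: y) i j = 0) ->
    forall i j, (i < 0) || (j < 0) -> y i j = 0.
  move=> vz v00 vyz.
  have v0 : v 0 != 0 by apply: contra v00 => /eqP ->.
  have vrow h n : n < 0 -> v h n = 0 by move=> n0; rewrite vz// n0 orbT.
  have yneg i : i < 0 -> y i = 0.
    apply: (@lscale_unit_closed _ _ (fun z => z = 0) v).
    - by [].
    - by move=> ? ? -> ->; rewrite subr0.
    - by move=> h ? ->; rewrite scaler0.
    - by move=> z /eqP; rewrite scaler_eq0 (negbTE v0) => /eqP.
    - exact: quad_rowl.
    - exact: quad_row.
  move=> i j /orP[/yneg->//|j0].
  suff h k n : n < k -> forall m, m < 0 -> y n m = 0.
    by apply: (h (i + 1)) => //; lia.
  apply: (@lscale_unit_closed _ _ (fun z : lser V => forall m : int, m < 0 -> z m = 0) v).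
  - by [].
  - by move=> a b ha hb m m0; rewrite lserB ha ?hb ?subr0.
  - by move=> h z hz; apply: lscale_pos => //; exact: vrow.
  - move=> z hz; apply: (@lscale_unit_closed _ _ (fun z => z = 0) (v 0)) => //.
    + by move=> ? ? -> ->; rewrite subr0.
    + by move=> h ? ->; rewrite scaler0.
    + by move=> ? /eqP; rewrite scaler_eq0 (negbTE v00) => /eqP.
    + exact: vrow.
  - exact: quad_rowl.
  - by move=> m _ l l0; rewrite vyz// l0 orbT.
move=> su u00 sux; have su' := sym_sym su; have sux' := sym_sym sux.
case: (su) => ue uz; case: (su') => _ uz'; case: (sux) => xe xz; case: (sux') => _ xz'.
have u00' : u' 0 0 != 0 by rewrite -ue.
have qx := quad _ _ uz u00 xz; have qx' := quad _ _ uz' u00' xz'.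
split=> // i j; have [neg|] := boolP ((i < 0) || (j < 0)).
  by rewrite qx ?qx'// orbC.
case: i => i //; case: j => j //.
(* Induction on the total degree: in a coefficient of u x, every term other than the one with
   [u 0 0] involves x in lower total degree. *)
move=> _; have [d] := ubnP (i + j); elim: d i j => // d IH i j ijd.
have := xe i j; rewrite !quad_coef// [in RHS]exchange_big /=.
rewrite (bigD1 ord0)//= [in RHS](bigD1 ord0)//= (bigD1 ord0)//= [in RHS](bigD1 ord0)//=.
rewrite !subr0 -!addrA ue => e.
have u0i : injective ( *:%R (u' 0 0) : V -> V) by exact: scalerI.
apply: u0i; apply: (addIr _ (etrans e _)); congr (_ + _); apply/esym.
have eqD (h l : nat) : (h <= j)%N -> (l <= i)%N -> (0 < h + l)%N ->
    u h l *: x (j%:Z - h%:Z) (i%:Z - l%:Z) = u' l h *: x' (i%:Z - l%:Z) (j%:Z - h%:Z).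
  move=> hj li hl; rewrite ue !subzn// IH//; lia.
congr (_ + _).
  apply: eq_bigr => l l0; have := eqD 0 l; rewrite subr0; apply => //.
    by rewrite -ltnS ltn_ord.
  by rewrite add0n lt0n.
apply: eq_bigr => h h0; apply: eq_bigr => l _; apply: eqD.
- by rewrite -ltnS ltn_ord.
- by rewrite -ltnS ltn_ord.
- by rewrite addn_gt0 lt0n h0.
Qed.

End Module.

Definition dreg (u : L2) : lser (lser L^o) := to_lser (fun i => reg (u i)).

Lemma dregE (u : L2) i : dreg u i = reg (u i).
Proof.
rewrite to_lserE//; have [N uN] := laurentP u; exists N => n /uN ->.
exact: eq_lser.
Qed.

Lemma dregM (u v : L2) i j : (u * v) i j = (u *: dreg v) i j.
Proof.
have [N uN] := laurentP u; have [M vM] := laurentP v.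
rewrite lmulE lscaleE !(@fsum_box _ N (i - M + 1)).
- by rewrite laur_sum lser_sum; apply: eq_bigr => h _; rewrite dregE.
- by move=> h /uN->; rewrite scale0r.
- move=> h hM; rewrite dregE vM; last by lia.
  have -> : reg (0 : laurent L) = 0 by exact: eq_lser.
  by rewrite scaler0.
- by move=> h /uN->; rewrite mul0r.
- by move=> h hM; rewrite vM ?mulr0//; lia.
Qed.

Lemma sym_mul (u u' v v' : L2) :
  sym (fun i => u i) (fun i => u' i) -> sym (fun i => v i) (fun i => v' i) ->
  sym (fun i => (u * v) i) (fun i => (u' * v') i).
Proof.
move=> su [ve vz].
have sv : sym (fun i => dreg v i) (fun i => dreg v' i).
  have lE (w : L2) a b : dreg w a b = w a b by rewrite dregE.
  by split=> [i j|i j h]; rewrite !lE; [exact: ve|exact: vz].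
have [e z] := sym_scale su sv.
split=> [i j|i j h]; last exact: etrans (dregM _ _ _ _) (z i j h).
exact: etrans (dregM _ _ _ _) (etrans (e i j) (esym (dregM _ _ _ _))).
Qed.

Lemma sym_add (u u' v v' : L2) :
  sym (fun i => u i) (fun i => u' i) -> sym (fun i => v i) (fun i => v' i) ->
  sym (fun i => (u + v) i) (fun i => (u' + v') i).
Proof.
move=> [ue uz] [ve vz]; split=> [i j|i j h].
  by rewrite !laurD ue ve.
by rewrite !laurD uz// vz// addr0.
Qed.

Lemma sym_exp (u u' : L2) k : sym (fun i => u i) (fun i => u' i) ->
  sym (fun i => (u ^+ k) i) (fun i => (u' ^+ k) i).
Proof.
move=> su; elim: k => [|k IH]; last by rewrite !exprS; exact: sym_mul.
have e i j : (1 : L2) i j = (i == 0)%:R *+ (j == 0).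
  by rewrite /=; case: (i == 0); rewrite //= mulr0n mul0rn.
split=> [i j|i j h]; rewrite !expr0 !e; first by do 2!case: eqP.
by do 2!(case: eqP => ?; rewrite ?mul0rn ?mulr0n//); lia.
Qed.

End DoubleSeries.

(** * Substitution of phi in two variables *)

Section SubstTwice.
Variables (K : numFieldType) (W : lmodType K) (p : laurent K).
Notation L := (laurent K).
Implicit Types (B : int -> int -> W).

Lemma Ds_shift : exists c : int, forall N (g : lser W),
  (forall n, n < N -> g n = 0) -> forall n, n < N + c -> Ds p g n = 0.
Proof.
have [P pP] := laurentP p; exists (P - 1) => N g gN n nN.
apply: (lscale_lo pP (M := N - 1)); last by lia.
by move=> i iN; rewrite sderivE gN ?scaler0//; lia.
Qed.

(** Separate bounds for x and z, because [Dx] lowers only the order in x. *)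
Definition bdxz (N N' : int) B : Prop :=
  forall m n, (m < N) || (n < N') -> B m n = 0.

Lemma bdxz_bounded N N' B : bdxz N N' B -> bounded2 B.
Proof. by move=> h; exists (Num.min N N') => m n mn; apply: h; lia. Qed.

Lemma iter_Dx_shift j : exists c : int, forall N N' B,
  bdxz N N' B -> bdxz (N + c) N' (iter j (Dx p) B).
Proof.
have [d hd] := Ds_shift.
elim: j => [|j [c IH]]; first by exists 0 => N N' B h; rewrite addr0.
exists (c + d) => N N' B /IH h m n; have bI := bdxz_bounded h.
rewrite iterS /Dx => /orP[mN|nN].
  by apply: (hd (N + c)); [move=> i iN; rewrite colxE// h ?iN|lia].
suff -> : colx (iter j (Dx p) B) n = 0 by rewrite Ds0.
by apply: eq_lser => i; rewrite colxE// h// nN orbT.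
Qed.

(** The loss of order [c] depends on p and j only. So, for a fixed power of z0, terms of high order
    in x do not reach a given power of z. *)
Lemma T_shift_lo (j : int) : exists c : int, forall N N' B, bdxz N N' B ->
  forall k, k < N + N' + c -> T p B j k = 0.
Proof.
case: j => j; last by exists 0.
have [c hc] := iter_Dx_shift j; exists c => N N' B /hc h k kN.
rewrite -[LHS]/(Tc p j B k) lscale_const DeltaLE; last exact: bdxz_bounded h.
by rewrite /Delta fsum0 ?scaler0// => i; apply: h; lia.
Qed.

Lemma T_xconst (f : lser W) B :
  (forall m n, B m n = if m == 0 then f n else 0) ->
  forall j : int, T p B j = if j == 0 then f else 0.
Proof.
move=> BE j.
have bB : bounded2 B.
  have [N fN] := lserP f; exists (Num.min N 0) => m n h; rewrite BE.
  by case: eqP => // m0; apply: fN; lia.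
have D0 : Dx p B = fun _ _ => 0.
  apply/funext => m; apply/funext => n; rewrite /Dx.
  suff e : sderiv (colx B n) = 0 by rewrite /Ds e scaler0.
  apply: eq_lser => i; rewrite sderivE colxE// BE; case: eqP => [->|].
    by rewrite scale0r.
  by rewrite scaler0.
case: j => [[|j]|j] //.
  rewrite -[LHS]/(lconst (0`!%:R^-1) *: DeltaL B) fact0 invr1 rmorph1 scale1r.
  apply: eq_lser => k; rewrite DeltaLE// /Delta (@fsum1 _ 0) ?BE ?subr0//.
  by move=> i /negbTE i0; rewrite BE i0.
have := congr1 (fun X : lser (lser W) => X j) (sderiv_T p B).
rewrite /= D0 -[RHS]/(T p (fun _ _ => 0) j) T_eq0// => /eqP.
rewrite (_ : (j + 1)%N = j.+1); last by lia.
rewrite scaler_eq0 (_ : Posz j + 1 = j.+1); last by lia.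
by rewrite (negbTE (natr_laurent_neq0 K j)) => /eqP.
Qed.

Lemma T_ext B B' : (forall m n, B m n = B' m n) -> T p B = T p B'.
Proof.
by move=> e; congr T; apply/funext => m; apply/funext => n.
Qed.

Lemma T_xmonom (m0 : int) (f : lser W) B :
  (forall m n, B m n = if m == m0 then f n else 0) ->
  forall j : int, T p B j = E p (lmonom 1 m0) j *: f.
Proof.
move=> BE j; pose B0 (m n : int) := if m == 0 then f n else 0.
have b0 : bounded2 B0.
  have [N fN] := lserP f; exists (Num.min N 0) => m n h; rewrite /B0.
  by case: eqP => // e; apply: fN; lia.
have -> : T p B = E p (lmonom 1 m0) *: T p B0.
  rewrite -T_mulx//; apply: T_ext => m n.
  by rewrite /mulx lscale_monom colxE// BE /B0 subr_eq0.
rewrite lscaleE (@fsum1 _ j) => [|i ij]; rewrite (T_xconst (f := f))//.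
  by rewrite subrr.
by rewrite subr_eq0 eq_sym (negbTE ij) scaler0.
Qed.

Definition bdd3 (N : int) (A : int -> int -> lser W) : Prop :=
  forall m n k, [|| m < N, n < N | k < N] -> A m n k = 0.

Definition bounded3 A := exists N, bdd3 N A.

(** The coefficient of z1^i z2^j in A(x, y, z) at x = phi(z, z1) and y = phi(z, z2), where y is
    substituted first. *)
Definition TT (A : int -> int -> lser W) (i j : int) : lser W :=
  T p (fun m => T p (fun n => A m n) j) i.

Lemma bounded3_row A m : bounded3 A -> bounded2 (fun n => A m n).
Proof. by move=> [N h]; exists N => n k nk; apply: h; rewrite nk orbT. Qed.

Lemma bounded3_T A j : bounded3 A -> bounded2 (fun m => T p (fun n => A m n) j).
Proof.
move=> [N h]; have [c hc] := T_shift_lo j.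
exists (Num.min N (N + N + c)) => m n /orP[mN|nN].
  by rewrite T_eq0// => i l; apply: h; lia.
apply: (hc N N); last by lia.
by move=> i l il; apply: h; rewrite il orbT.
Qed.

Lemma bounded3_tr A : bounded3 A -> bounded3 (fun m n => A n m).
Proof. by move=> [N h]; exists N => m n k mnk; apply: h; lia. Qed.

Lemma TT_ext A A' i j : (forall m n, A m n = A' m n) -> TT A i j = TT A' i j.
Proof.
move=> e; congr (T p _ i); apply/funext => m; congr (T p _ j).
by apply/funext => n; rewrite e.
Qed.

Lemma TT_add A A' i j : bounded3 A -> bounded3 A' ->
  TT (fun m n => A m n + A' m n) i j = TT A i j + TT A' i j.
Proof.
move=> bA bA'; rewrite /TT -lserD -T_add; try exact: bounded3_T.
congr (T p _ i); apply/funext => m; apply/funext => k.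
by rewrite -lserD -(lserD (T p _)) -T_add//; exact: bounded3_row.
Qed.

Lemma TT_eq0 A i j : (forall m n, A m n = 0) -> TT A i j = 0.
Proof.
move=> A0; rewrite /TT T_eq0// => m k.
by rewrite T_eq0// => n l; rewrite A0.
Qed.

Lemma bounded3_sum (I : eqType) (r : seq I) (A : I -> int -> int -> lser W) :
  (forall s, bounded3 (A s)) -> bounded3 (fun m n => \sum_(s <- r) A s m n).
Proof.
move=> bA; elim: r => [|s r [N IH]].
  by exists 0 => m n k _; rewrite big_nil.
have [N' h] := bA s; exists (Num.min N N') => m n k mnk.
by rewrite big_cons lserD IH ?h ?addr0//; lia.
Qed.

Lemma TT_sum (I : eqType) (r : seq I) (A : I -> int -> int -> lser W) i j :
  (forall s, bounded3 (A s)) ->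
  TT (fun m n => \sum_(s <- r) A s m n) i j = \sum_(s <- r) TT (A s) i j.
Proof.
move=> bA; elim: r => [|s r IH].
  by rewrite big_nil TT_eq0// => m n; rewrite big_nil.
rewrite big_cons -IH -TT_add//; last exact: bounded3_sum.
by apply: TT_ext => m n; rewrite big_cons.
Qed.

(* A is a finite sum of monomials in x, y plus terms that do not contribute to a given
   coefficient, and both sides agree on monomials. *)
Lemma TT_comm A i j : bounded3 A -> TT A i j = TT (fun n m => A m n) j i.
Proof.
move=> [N AN]; apply: eq_lser => k.
have [ci hi] := T_shift_lo i; have [cj hj] := T_shift_lo j.
(* [R] is such that a part of A of order at least [R] in x or in y, and at least [N] in the other
   variables, contributes nothing to the coefficient of z^k. *)
pose R := Num.max N (k - N - N - ci - cj + 1).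
have RN : N <= R by rewrite /R; lia.
have Rk : k < R + N + N + ci + cj by rewrite /R; lia.
have hix (A' : int -> int -> lser W) (a b : int) (ca cb : int) :
    (forall N N' B, bdxz N N' B -> forall k, k < N + N' + ca -> T p B a k = 0) ->
    (forall N N' B, bdxz N N' B -> forall k, k < N + N' + cb -> T p B b k = 0) ->
    ca + cb = ci + cj -> bdd3 N A' -> (forall m n, m < R -> A' m n = 0) ->
    TT A' a b k = 0.
  move=> ha hb cab bA' hR; apply: (ha R (N + N + cb)); last by lia.
  move=> m l /orP[mR|lN]; first by rewrite T_eq0// => n q; rewrite hR.
  by apply: (hb N N); [move=> n q nq; apply: bA'; rewrite nq orbT|lia].
have hiy (A' : int -> int -> lser W) (a b : int) (ca cb : int) :
    (forall N N' B, bdxz N N' B -> forall k, k < N + N' + ca -> T p B a k = 0) ->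
    (forall N N' B, bdxz N N' B -> forall k, k < N + N' + cb -> T p B b k = 0) ->
    ca + cb = ci + cj -> bdd3 N A' -> (forall m n, n < R -> A' m n = 0) ->
    TT A' a b k = 0.
  move=> ha hb cab bA' hR; apply: (ha N (R + N + cb)); last by lia.
  move=> m l /orP[mR|lN].
    by rewrite T_eq0// => n q; apply: bA'; rewrite mR.
  apply: (hb R N); last by lia.
  by move=> n q /orP[nR|qN]; [rewrite hR|apply: bA'; rewrite qN !orbT].
have cji : cj + ci = ci + cj by rewrite addrC.
(* [A1] carries the exponents at least [R] in x, and [A2] those at least [R] in y only. What
   remains, [A0], is a finite sum of monomials. *)
pose A1 m n := if R <= m then A m n else 0.
pose A2 m n := if (m < R) && (R <= n) then A m n else 0.
pose r := zrange N (absz (R - N)).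
pose mon (s : int * int) m n := if (m == s.1) && (n == s.2) then A s.1 s.2 else 0.
pose A0 m n := \sum_(s <- allpairs pair r r) mon s m n.
have b1 : bdd3 N A1 by move=> m n q h; rewrite /A1; case: ifP => // _; exact: AN.
have b2 : bdd3 N A2 by move=> m n q h; rewrite /A2; case: ifP => // _; exact: AN.
have bm s : bounded3 (mon s).
  exists N => m n q h; rewrite /mon; case: ifP => // /andP[/eqP <- /eqP <-].
  exact: AN.
have b0 : bounded3 A0 by exact: bounded3_sum.
have AE m n : A m n = A0 m n + (A1 m n + A2 m n).
  rewrite /A0 /A1 /A2; have [Rm|mR] := leP R m.
    rewrite /= addr0 big1_seq ?add0r// => -[a b] /andP[_].
    move=> /allpairsP[[a' b'] [/= ar br [-> ->]]]; rewrite /mon /=.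
    by case: eqP => //= e; move: ar; rewrite mem_zrange; lia.
  have [Rn|nR] := leP R n.
    rewrite /= add0r big1_seq ?add0r// => -[a b] /andP[_].
    move=> /allpairsP[[a' b'] [/= ar br [-> ->]]]; rewrite /mon /= andbC.
    by case: eqP => //= e; move: br; rewrite mem_zrange; lia.
  rewrite /= !addr0; have [h|] := boolP ((m < N) || (n < N)).
    rewrite big1_seq; first by apply: eq_lser => q; rewrite AN// orbA h.
    move=> -[a b] /andP[_] /allpairsP[[a' b'] [/= ar br [-> ->]]].
    rewrite /mon /=; case: eqP => //= e; case: eqP => //= e'.
    by move: ar br; rewrite !mem_zrange; lia.
  rewrite negb_or -!leNgt => /andP[Nm Nn].
  rewrite (bigD1_seq (m, n)) /=.
  - rewrite /mon !eqxx /= big1 ?addr0// => -[a b] ab.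
    case: ifP => // /andP[/eqP e /eqP e']; move: ab.
    by rewrite e e' /= eqxx.
  - by apply/allpairsP; exists (m, n); rewrite !mem_zrange; split=> //=; lia.
  - by rewrite allpairs_uniq ?zrange_uniq// => -[? ?] [? ?].
have bounded12 : bounded3 (fun m n => A1 m n + A2 m n).
  by exists N => m n q h; rewrite lserD b1 ?b2 ?addr0.
have b1' : bounded3 A1 by exists N.
have b2' : bounded3 A2 by exists N.
have b1t : bdd3 N (fun m n => A1 n m) by move=> m n q h; apply: b1; lia.
have b2t : bdd3 N (fun m n => A2 n m) by move=> m n q h; apply: b2; lia.
have monE s a b : TT (mon s) a b = E p (lmonom 1 s.1) a *: (E p (lmonom 1 s.2) b *: A s.1 s.2).
  apply: T_xmonom => m l; case: (eqVneq m s.1) => ms; last first.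
    by rewrite T_eq0// => n q; rewrite /mon (negbTE ms).
  congr (_ _ l); apply: T_xmonom => n q.
  by rewrite /mon ms eqxx /=; case: eqP.
have monE' s a b : TT (fun m n => mon s n m) a b =
    E p (lmonom 1 s.2) a *: (E p (lmonom 1 s.1) b *: A s.1 s.2).
  apply: T_xmonom => m l; case: (eqVneq m s.2) => ms; last first.
    by rewrite T_eq0// => n q; rewrite /mon (negbTE ms) andbF.
  congr (_ _ l); apply: T_xmonom => n q.
  by rewrite /mon ms eqxx andbT; case: eqP.
rewrite (TT_ext _ _ AE) TT_add// TT_add// !lserD.
rewrite (hix A1 i j ci cj)//; last by move=> m n mR; rewrite /A1 leNgt mR.
rewrite (hiy A2 i j ci cj)//; last first.
  by move=> m n nR; rewrite /A2 [R <= _]leNgt nR andbF.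
rewrite (TT_ext _ _ (fun n m => AE m n)) TT_add; last 2 first.
- exact: bounded3_tr.
- exact: (bounded3_tr bounded12).
rewrite (TT_add (A := fun n m => A1 m n) (A' := fun n m => A2 m n)); last 2 first.
- exact: (bounded3_tr b1').
- exact: (bounded3_tr b2').
rewrite !lserD (hiy (fun n m => A1 m n) j i cj ci)//; last first.
  by move=> m n mR; rewrite /A1 leNgt mR.
rewrite (hix (fun n m => A2 m n) j i cj ci)//; last first.
  by move=> m n nR; rewrite /A2 [R <= _]leNgt nR andbF.
rewrite !addr0 (TT_sum _ _ _ bm) (@TT_sum _ _ (fun s n m => mon s m n)); last first.
  by move=> s; exact: (bounded3_tr (bm s)).
congr (_ _ k); apply: eq_bigr => s _; rewrite monE monE' !scalerA.
by rewrite mulrC.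
Qed.

End SubstTwice.

Lemma scaleCA (R : comPzRingType) (V : lmodType R) (a b : R) (v : V) :
  a *: (b *: v) = b *: (a *: v).
Proof. by rewrite !scalerA mulrC. Qed.

Lemma big_zrange0 (V : nmodType) (J : nat) (F : int -> V) :
  \sum_(i <- zrange 0 J) F i = \sum_(h < J) F h%:Z.
Proof.
rewrite big_map -[X in iota _ X]subn0 -/(index_iota 0 _) big_mkord.
by apply: eq_bigr => h _; rewrite add0r.
Qed.

(** * Polynomials at phi(z, z1) and phi(z, z2) *)

Section CoefMap.
Variable F : fieldType.

Fact lmapc_bdd (f : laurent F) : bounded_below (fun n => lconst (f n)).
Proof. by have [N fN] := laurentP f; exists N => n /fN->; rewrite raddf0. Qed.

(** The series f in the outer variable, with coefficients constant in the inner one. The same series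
    in the inner variable is [lconst f]. *)
Definition lmapc (f : laurent F) : laurent (laurent F) := mk_laurent (lmapc_bdd f).

Lemma lmapcE f n : lmapc f n = lconst (f n). Proof. by []. Qed.

Fact lmapc_zmod_morphism : zmod_morphism lmapc.
Proof.
by move=> f g; apply: eq_laurent => n; rewrite laurB !lmapcE laurB raddfB.
Qed.

Fact lmapc_monoid_morphism : monoid_morphism lmapc.
Proof.
split=> [|f g].
  apply: eq_laurent => n; rewrite lmapcE -[1]/(lmonom 1 0) /=.
  by case: (n == 0); rewrite ?mulr1n ?mulr0n ?rmorph1 ?rmorph0.
apply: eq_laurent => n; rewrite lmapcE !lmulE.
have [N fN] := laurentP f; have [M gM] := laurentP g.
rewrite (@fsum_additive _ _ lconst N (n - M + 1)).
- by apply: eq_fsbigr => i _; exact: (rmorphM (@lconst F)).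
- by move=> i /fN->; rewrite mul0r.
- by move=> i h; rewrite gM ?mulr0//; lia.
Qed.

HB.instance Definition _ := GRing.isZmodMorphism.Build _ _ lmapc
  lmapc_zmod_morphism.
HB.instance Definition _ := GRing.isMonoidMorphism.Build _ _ lmapc
  lmapc_monoid_morphism.

End CoefMap.

Section EvPhi2.
Variables (K : numFieldType) (p : laurent K).
Notation L := (laurent K).

Fact evphi_zmod_morphism : zmod_morphism (evphi p).
Proof. by move=> q r; rewrite /evphi raddfB hornerD hornerN. Qed.

Fact evphi_monoid_morphism : monoid_morphism (evphi p).
Proof. by split=> [|q r]; rewrite /evphi ?rmorph1 ?hornerC// rmorphM hornerM. Qed.

HB.instance Definition _ := GRing.isZmodMorphism.Build _ _ (evphi p)
  evphi_zmod_morphism.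
HB.instance Definition _ := GRing.isMonoidMorphism.Build _ _ (evphi p)
  evphi_monoid_morphism.

(* t(x, y) at x = phi(z, z1) and y = phi(z, z2), in L((z1))((z2)) *)
Definition ev2 (t : {poly {poly L}}) : laurent (laurent L) :=
  (map_poly (@lmapc L \o evphi p) t).[lconst (phi p)].

Fact ev2_zmod_morphism : zmod_morphism ev2.
Proof. by move=> q r; rewrite /ev2 raddfB hornerD hornerN. Qed.

Fact ev2_monoid_morphism : monoid_morphism ev2.
Proof. by split=> [|q r]; rewrite /ev2 ?rmorph1 ?hornerC// rmorphM hornerM. Qed.

HB.instance Definition _ := GRing.isZmodMorphism.Build _ _ ev2 ev2_zmod_morphism.
HB.instance Definition _ := GRing.isMonoidMorphism.Build _ _ ev2
  ev2_monoid_morphism.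

Lemma ev2X : ev2 'X = lconst (phi p).
Proof. by rewrite /ev2 map_polyX hornerX. Qed.

Lemma ev2C r : ev2 r%:P = lmapc (evphi p r).
Proof. by rewrite /ev2 map_polyC hornerC. Qed.

Lemma lmapc_const (c : L) : lmapc (lconst c) = lconst (lconst c).
Proof.
by apply: eq_laurent => n /=; case: (n == 0); rewrite ?mulr1n ?mulr0n ?rmorph0.
Qed.

Lemma ev2_mapC r : ev2 (map_poly polyC r) = lconst (evphi p r).
Proof.
elim/poly_ind: r => [|r c IH]; first by rewrite !rmorph0.
rewrite !rmorphD !rmorphM /= map_polyX map_polyC /= ev2X IH ev2C.
by rewrite evphiC lmapc_const evphiX.
Qed.

Lemma sym_lconst (f : laurent L) : (forall n, n < 0 -> f n = 0) ->
  sym (fun i => (lconst f : laurent (laurent L)) i) (fun i => lmapc f i).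
Proof.
move=> f0; split=> [i j|i j h] /=; first by case: (j == 0); rewrite ?mulr1n ?mulr0n.
by case: eqP => [i0|_]; rewrite ?mulr0n// mulr1n f0//; lia.
Qed.

Lemma sym_ev2 t : sym (fun i => ev2 t i) (fun i => ev2 (swapXY t) i).
Proof.
elim/poly_ind: t => [|t r IH].
  by rewrite !rmorph0; split.
rewrite !rmorphD !rmorphM /= swapXY_X swapXY_polyC ev2X !ev2C evphiX ev2_mapC.
have sX := sym_lconst (@phi_pos _ p); have sr := sym_lconst (@evphi_pos _ p r).
exact: (sym_add (sym_mul IH sX) (sym_sym sr)).
Qed.

Lemma quad_mul00 (u v : laurent (laurent L)) :
  (forall i j, (i < 0) || (j < 0) -> u i j = 0) ->
  (forall i j, (i < 0) || (j < 0) -> v i j = 0) ->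
  (u * v) 0 0 = u 0 0 * v 0 0.
Proof.
move=> u0 v0.
have lE (w : laurent (laurent L)) a b : dreg w a b = w a b by rewrite dregE.
have lv n : n < 0 -> dreg v n = 0.
  by move=> n0; apply: eq_lser => j; rewrite lE v0// n0.
have e1 := lscale_coef0 (quad_rowl u0) lv.
have e2 : (u 0 *: dreg v 0) 0 = u 0 0 *: dreg v 0 0.
  by apply: lscale_coef0 => n n0; rewrite ?lE ?u0 ?v0// n0 orbT.
by rewrite (dregM u v) e1 e2 lE.
Qed.

Lemma ev2D t s : ev2 (t + s) = ev2 t + ev2 s. Proof. exact: rmorphD. Qed.

Lemma ev2M t s : ev2 (t * s) = ev2 t * ev2 s. Proof. exact: rmorphM. Qed.

Lemma ev2B (t s : {poly {poly L}}) : ev2 (t - s) = ev2 t - ev2 s.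
Proof. exact: (raddfB ev2). Qed.

Lemma ev2Xn (t : {poly {poly L}}) n : ev2 (t ^+ n) = ev2 t ^+ n.
Proof. by elim: n => [|n IH]; rewrite ?exprS ?ev2M ?IH// !expr0 rmorph1. Qed.

(** At z1 = z2 = 0 both phi(z, z1) and phi(z, z2) equal z, so the leading coefficient is the
    restriction to the diagonal. *)
Lemma ev2_00 (g : {poly {poly K}}) :
  ev2 (map_poly (map_poly (@lconst K)) g) 0 0 = lpoly g.['X].
Proof.
elim/poly_ind: g => [|g r IH]; first by rewrite !rmorph0 horner0 rmorph0.
have -> : map_poly (map_poly (@lconst K)) (g * 'X + r%:P) =
    map_poly (map_poly (@lconst K)) g * 'X + (map_poly (@lconst K) r)%:P.
  by rewrite rmorphD rmorphM /= map_polyX map_polyC.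
rewrite hornerMXaddC ev2D ev2M !laurD quad_mul00; first last.
- by rewrite ev2X; have [] := sym_lconst (@phi_pos _ p).
- by have [] := sym_ev2 (map_poly (map_poly lconst) g).
rewrite IH ev2X ev2C lmapcE !lconst0 phi0 evphi0.
have lpD (a b : {poly K}) : lpoly (a + b) = lpoly a + lpoly b by exact: raddfD.
rewrite lpD lpolyMX mulrC; congr (_ + _).
elim/poly_ind: r => [|r c IHr]; first by rewrite !rmorph0 horner0.
rewrite rmorphD rmorphM /= map_polyX map_polyC hornerMXaddC IHr.
by rewrite lpD lpolyMX lpolyC mulrC.
Qed.

End EvPhi2.

(** * Iterated products as double substitutions *)

Section Locality.
Variables (K : numFieldType) (W : lmodType K) (p : laurent K).
Hypothesis p_neq0 : p != 0.
Notation L := (laurent K).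
Implicit Types (a b c : distr W).

(** Used to pass one coefficient of a field through the substitution made in a product of two
    others: a linear map of W commutes with p d/dx and with the restriction to the diagonal. *)
Lemma T_map (al : W -> W) (B : int -> int -> W) : linear al -> bounded2 B ->
  T p (fun m n => al (B m n)) = lsmap (lsmap al) (T p B).
Proof.
move=> lin [N BN]; have al0 := plin0 lin.
have lin1 := lsmap_linear lin; have lin2 := lsmap_linear lin1.
have bB : bounded2 B by exists N.
have bB' : bounded2 (fun m n => al (B m n)) by exists N => m n h; rewrite BN.
have DxE (C : int -> int -> W) : bounded2 C ->
    Dx p (fun m n => al (C m n)) = fun m n => al (Dx p C m n).
  move=> bC; apply/funext => m; apply/funext => n; rewrite /Dx.
  have -> : colx (fun m n => al (C m n)) n = lsmap al (colx C n).
    apply: eq_lser => i; rewrite lsmapE// !colxE//.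
    by have [M CM] := bC; exists M => ? ? h; rewrite CM.
  rewrite -lsmapE// /Ds (plinZ lin1); congr (_ _ m); congr (_ *: _).
  by apply: eq_lser => i; rewrite lsmapE// !sderivE lsmapE// plinZ.
apply: eq_lser => -[j|j]; rewrite (lsmapE _ _ (plin0 lin1)); last by rewrite plin0.
rewrite -[LHS]/(Tc p j _) -[T p B _]/(Tc p j B) /Tc (plinZ lin1); congr (_ *: _).
have -> : iter j (Dx p) (fun m n => al (B m n)) =
          fun m n => al (iter j (Dx p) B m n).
  by elim: j => // j IH; rewrite !iterS IH DxE//; exact: bounded2_iter.
have bI := bounded2_iter p j bB; move: (iter j _ B) bI => C bC.
have bC' : bounded2 (fun m n => al (C m n)).
  by have [M CM] := bC; exists M => ? ? h; rewrite CM.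
apply: eq_lser => k; rewrite lsmapE// !DeltaLE// /Delta.
have [M CM] := bC; rewrite (@plin_fsum _ _ _ _ lin M (k - M + 1))//.
- by move=> i iM; rewrite CM// iM.
- by move=> i iM; rewrite CM//; lia.
Qed.

Lemma T_sum (I : eqType) (r : seq I) (G : I -> int -> lser W) :
  (forall i, i \in r -> bounded2 (fun m => G i m)) ->
  bounded2 (fun m => \sum_(i <- r) G i m) /\
  T p (fun m => \sum_(i <- r) G i m) = \sum_(i <- r) T p (fun m => G i m).
Proof.
elim: r => [|i r IH] h.
  rewrite big_nil; split; first by exists 0 => m n _; rewrite big_nil.
  by rewrite T_eq0// => m n; rewrite big_nil.
have [|b e] := IH; first by move=> j jr; apply: h; rewrite inE jr orbT.
have bi := h i (mem_head _ _).
have eE : (fun m n => scoef (\sum_(j <- i :: r) G j m) n) =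
          (fun m n => G i m n + (\sum_(j <- r) G j m) n).
  by apply/funext => m; apply/funext => n; rewrite big_cons.
split.
  rewrite -[X in bounded2 X]/(fun m n => scoef (\sum_(j <- i :: r) G j m) n) eE.
  exact: bounded2D.
rewrite big_cons -e -T_add//.
by rewrite -[X in T p X]/(fun m n => scoef (\sum_(j <- i :: r) G j m) n) eE.
Qed.

Lemma kills_common J a (f : nat -> distr W) : in_EW a ->
  (forall h, in_EW (f h)) -> (forall h, ql a (f h)) ->
  exists q, q != 0 /\ forall h, (h < J)%N -> kills q a (f h).
Proof.
move=> aE fE fq; elim: J => [|J [q [q0 qk]]].
  by exists 1; split=> //; exact: oner_neq0.
have [r /(qlocalP _ aE (fE J))[r0 rk]] := fq J.
exists (q * r); split=> [|h]; first by rewrite mulf_neq0.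
by rewrite ltnS leq_eqVlt => /orP[/eqP->|/qk h'];
  [exact: kills_mull|exact: kills_mulr].
Qed.

Lemma Yv_zero a w : in_EW a -> Yv p a 0 w = 0.
Proof.
move=> aE; rewrite /Yv T_eq0 ?scaler0// => m n.
have e i : prodv a 0 w i = 0.
  apply: eq_lser => j; rewrite /zrow to_lserE; rewrite /distr_prod.
    exact: distr0.
  by exists 0 => k _; exact: distr0.
by rewrite pact0r.
Qed.

Section HalfProduct.
Variables (a b c : distr W) (w : W).
Hypotheses (aE : in_EW a) (bE : in_EW b) (cE : in_EW c).
Hypotheses (qbc : ql b c) (qabc : forall n, ql a (nprod p b n c)).

Definition prod3 (m n : int) : lser W := lsmap (a m) (prodv b c w n).

(** The coefficient of z2^j in Y(a, z1) Y(b, z2) c applied to w, as a series in z1. With z2 as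
    outermost variable, [YYs] is a vector over L((z1))((z2)). *)
Definition YYv (j : int) : lser (lser W) := Yv p a (nprod p b (- j - 1) c) w.

Lemma YYv_lo : exists N, (forall k, k < N -> YYv k = 0) /\
  forall k, k < N -> Yv p b c w k = 0.
Proof.
have [N h] := Yv_lo p b c; exists N; split=> k kN; last exact: h.
rewrite /YYv (_ : nprod _ _ _ _ = 0) ?Yv_zero//.
apply/funext => m; apply/funext => v; rewrite nprodE// h//; lia.
Qed.

Definition YYs : lser (lser (lser W)) := to_lser YYv.

Lemma YYsE j : YYs j = YYv j.
Proof. by rewrite to_lserE//; have [N [h _]] := YYv_lo; exists N. Qed.

Variables (t : {poly {poly L}}) (q3 : {poly {poly K}}).
Let s := t * (lq q3)%:P.
Hypotheses (q3n0 : q3 != 0) (q3k : kills q3 b c).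
Hypothesis s_bdd : bounded3 (fun m n => pact2 s prod3 m n).

Let P : {poly laurent L} := map_poly (evphi p) s.

Let alin m : linear (a m) := aE.1 m.

(** Only y = phi(z, z2) is substituted here. The factor q3 makes this possible in b(y) c(z) w, and
    the coefficients of s, polynomials in y, become elements of L((z2)), collected in [P]. *)
Lemma half_inner m : T p (fun n => pact2 s prod3 m n) =
  pact P (fun m => lsmap (lsmap (a m)) (Yv p b c w)) m.
Proof.
pose B m n := lsmap (a m) (pact (lq q3) (prodv b c w) n).
have BE m' n : pact2 (lq q3)%:P prod3 m' n = B m' n.
  by rewrite pact2C /B pact_lin//; exact: lsmap_linear.
have bB m' : bounded2 (fun n => B m' n).
  have [N h] := prod_bounded w bE cE q3k; exists N => n k nk.
  by rewrite lsmapE ?h// distr0.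
have TB m' : T p (fun n => B m' n) =
    poly_phi p q3 *: lsmap (lsmap (a m')) (Yv p b c w).
  rewrite -(plinZ (lsmap_linear (lsmap_linear (alin m')))) Yv_spec//.
  rewrite -T_map//; last exact: prod_bounded.
  by apply: T_ext => i j; rewrite lsmapE// distr0.
have -> : T p (fun n => pact2 s prod3 m n) =
  T p (fun n => \sum_(i <- index_enum 'I_(size t)) pact t`_i (B (m - i%:Z)) n).
  apply: T_ext => n k; congr (_ _ k); rewrite pact2M.
  apply: eq_bigr => i _; apply: pact_eqr => j; exact: BE.
rewrite (T_sum _).2; last by move=> i _; apply/bounded2_pact/bB.
rewrite (@pactE _ _ (size t)); last first.
  by rewrite (leq_trans (size_poly _ _))// /s mulrC mul_polyC size_scale_leq.
apply: eq_bigr => i _; rewrite (T_pact p t`_i (bB _)) TB scalerA.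
have -> : P`_i = evphi p s`_i by exact: coef_map.
by rewrite /s coefMC evphiM -poly_phiE.
Qed.

Let Pc (h : int) : {poly L} := \poly_(i < size P) (P`_i h).

Lemma half_coef j (J : nat) : (forall k, k <= j - J%:Z -> Yv p b c w k = 0) ->
  forall m, T p (fun n => pact2 s prod3 m n) j =
  \sum_(h < J) pact (Pc h) (prodv a (nprod p b (- (j - h%:Z) - 1) c) w) m.
Proof.
move=> hJ m; rewrite half_inner {1}/pact lser_sum.
transitivity (\sum_(i < size P) \sum_(h < J)
    P`_i h *: lsmap (a (m - i%:Z)) (Yv p b c w (j - h%:Z))).
  apply: eq_bigr => i _; rewrite lscaleE (@fsum_box _ 0 J).
  - rewrite subr0 absz_nat big_zrange0.
    apply: eq_bigr => h _; rewrite lsmapE//.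
    exact: plin0 (lsmap_linear (alin _)).
  - by move=> h h0; rewrite coef_map evphi_pos// scale0r.
  - move=> h hJ'; rewrite lsmapE; last exact: plin0 (lsmap_linear (alin _)).
    by rewrite hJ ?(plin0 (lsmap_linear (alin _))) ?scaler0//; lia.
rewrite exchange_big; apply: eq_bigr => h _.
rewrite (@pactE _ _ (size P)); last exact: size_poly.
apply: eq_bigr => i _; rewrite [(Pc h)`_i]coef_poly ltn_ord; congr (_ *: _).
apply: eq_lser => l; have nE := nprod_EW p_neq0 (- (j - h%:Z) - 1) bE cE qbc.
rewrite lsmapE ?distr0// prodvE// nprodE//.
by have -> : - (- (j - h%:Z) - 1) - 1 = j - h%:Z by lia.
Qed.

Lemma ev2_coef (h : int) : ev2 p s h = evphi p (Pc h).
Proof.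
rewrite /ev2 (horner_coef_wide _ (n := size s)); last exact: size_poly.
rewrite laur_sum /evphi (horner_coef_wide _ (n := size s)); last first.
  rewrite (leq_trans (size_poly _ _))// (leq_trans (size_poly _ _))//.
  exact: size_poly.
apply: eq_bigr => i _.
have e1 : (map_poly (@lmapc L \o evphi p) s)`_i = lmapc (evphi p s`_i).
  exact: coef_map.
have e2 : (map_poly lconst (Pc h))`_i = lconst ((Pc h)`_i) by exact: coef_map.
have PE : P`_i = evphi p s`_i by exact: coef_map.
have e3 : (Pc h)`_i = evphi p s`_i h.
  rewrite [LHS]coef_poly; case: ltnP => iP; first by rewrite PE.
  by rewrite -PE nth_default.
by rewrite e1 e2 e3 -rmorphXn mulrC lconst_mulE lmapcE mulrC.
Qed.

(** The polynomial that kills the commutator of a with b_n c depends on n, so no single one serves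
    for all of Y(b, z2) c. For a fixed power of z2 only finitely many b_n c occur: a common [q] for
    these is multiplied in, and its value at phi is cancelled at the end. *)
Lemma half_product i j : TT p (pact2 s prod3) i j = (ev2 p s *: YYs) j i.
Proof.
have [N [ZN XN]] := YYv_lo.
(* The series Y(b, z2) c starts at z2^N at the earliest and the coefficients of s involve no
   negative powers of z2, so the powers z2^(j - h) with h < J are all that matter for z2^j. *)
pose J := absz (j - N + 1); pose f (h : nat) := nprod p b (- (j - h%:Z) - 1) c.
have fE h : in_EW (f h) by exact: nprod_EW.
have [q [qn0 qk]] := kills_common J aE fE (fun h => qabc _).
have XJ k : k <= j - J%:Z -> Yv p b c w k = 0.
  move=> kj; have [jN|Nj] := ltP j N; first by apply: XN; lia.
  by apply: XN; rewrite /J in kj; lia.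
have ZJ k : k <= j - J%:Z -> YYv k = 0.
  move=> kj; have [jN|Nj] := ltP j N; first by apply: ZN; lia.
  by apply: ZN; rewrite /J in kj; lia.
pose C (m : int) : lser W := T p (fun n => pact2 s prod3 m n) j.
suff e : T p (fun m => C m) = (ev2 p s *: YYs) j.
  by rewrite -[LHS]/(T p (fun m => C m) i) e.
have bC : bounded2 (fun m => C m) by exact: bounded3_T.
have CE := half_coef XJ.
apply: (scalerI (poly_phi_neq0 p_neq0 qn0)).
rewrite {1}poly_phiE -(T_pact p (lq q) bC).
have -> : T p (fun m => pact (lq q) C m) = T p (fun m =>
    \sum_(h <- index_enum 'I_J) pact (Pc h) (pact (lq q) (prodv a (f h) w)) m).
  apply: T_ext => m k; congr (_ _ k).
  rewrite (pact_eqr _ _ CE) /pact; under eq_bigr do rewrite scaler_sumr.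
  rewrite exchange_big; apply: eq_bigr => h _.
  by rewrite -[LHS]/(pact (lq q) (pact (Pc h) _) m) -pactM mulrC pactM.
rewrite (T_sum _).2; last first.
  by move=> h _; apply: bounded2_pact; apply: prod_bounded => //; exact: qk.
rewrite lscaleE (@fsum_box _ 0 J).
- rewrite subr0 absz_nat big_zrange0.
  rewrite scaler_sumr; apply: eq_bigr => h _.
  have kh := qk h (ltn_ord h).
  rewrite T_pact; last exact: prod_bounded.
  rewrite -Yv_spec//; last exact: qabc.
  by rewrite YYsE ev2_coef scaleCA.
- move=> h h0; rewrite ev2_coef; have -> : Pc h = 0.
    apply/polyP => k; rewrite coef_poly coef0; case: ifP => // _.
    by rewrite coef_map evphi_pos.
  by rewrite rmorph0 scale0r.
- by move=> h hJ; rewrite YYsE ZJ ?scaler0//; lia.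
Qed.

End HalfProduct.

End Locality.

Lemma mulr3_natr (R : comPzRingType) (s x y : R) n :
  s * x * y *+ n = s * n%:R * (x * y).
Proof. by rewrite -mulr_natr; ring. Qed.

Section Shifts.
Variable L : fieldType.

Lemma lmonomM (a b : int) : lmonom 1 a * lmonom 1 b = lmonom 1 (a + b) :> laurent L.
Proof.
apply: eq_laurent => n; rewrite lmonom_mulE /=; congr (_ *+ nat_of_bool _).
by lia.
Qed.

Lemma lmonomX (k : nat) : lmonom 1 1 ^+ k = lmonom 1 k%:Z :> laurent L.
Proof.
elim: k => [|k IH]; first by [].
by rewrite exprS IH lmonomM; congr (lmonom _ _); lia.
Qed.

End Shifts.

Section Shifts2.
Variable L : fieldType.

(* the inner and the outer variable of L((z1))((z2)) *)
Definition zin : laurent (laurent L) := lconst (lmonom 1 1).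
Definition zout : laurent (laurent L) := lmonom 1 1.

Lemma shift_scale (V : lmodType L) (a b : nat) (x : lser (lser V)) j l :
  ((zin ^+ a * zout ^+ b) *: x) j l = x (j - b%:Z) (l - a%:Z).
Proof.
rewrite /zin /zout lmonomX -rmorphXn lmonomX -scalerA lscale_const.
by rewrite lscale_monom lscale_monom.
Qed.

Lemma lscale_const2 (V : lmodType L) (c : L) (x : lser (lser V)) j l :
  (lconst (lconst c) *: x) j l = c *: x j l.
Proof.
by rewrite (lscale_const (lconst c) x j) (lscale_const c (x j) l).
Qed.

Lemma binomial_scale (V : lmodType L) (k : nat) (x : lser (lser V)) j l :
  ((zin - zout) ^+ k *: x) j l = \sum_(h < k.+1)
    ((-1) ^+ h * 'C(k, h)%:R) *: x (j - h%:Z) (l - (k - h)%N%:Z).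
Proof.
rewrite exprBn scaler_suml !lser_sum; apply: eq_bigr => h _.
have -> : (((-1) ^+ h * zin ^+ (k - h) * zout ^+ h) *+ 'C(k, h)) =
   lconst (lconst ((-1) ^+ h * 'C(k, h)%:R)) * (zin ^+ (k - h) * zout ^+ h).
  have -> : lconst (lconst ((-1) ^+ h * 'C(k, h)%:R)) =
      (-1) ^+ h * 'C(k, h)%:R :> laurent (laurent L).
    by rewrite (rmorphMsign (@lconst L)) (rmorphMsign (@lconst (laurent L)))
      (rmorph_nat (@lconst L)) (rmorph_nat (@lconst (laurent L))).
  exact: mulr3_natr.
rewrite -(shift_scale (k - h) h x j l) -lscale_const2.
by rewrite [in RHS]scalerA.
Qed.

Lemma binomial_scale_tr (V : lmodType L) (k : nat) (x : lser (lser V)) j l :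
  ((zout - zin) ^+ k *: x) l j = \sum_(h < k.+1)
    ((-1) ^+ h * 'C(k, h)%:R) *: x (l - (k - h)%N%:Z) (j - h%:Z).
Proof.
rewrite exprBn scaler_suml !lser_sum; apply: eq_bigr => h _.
have -> : (((-1) ^+ h * zout ^+ (k - h) * zin ^+ h) *+ 'C(k, h)) =
   lconst (lconst ((-1) ^+ h * 'C(k, h)%:R)) * (zout ^+ (k - h) * zin ^+ h).
  have -> : lconst (lconst ((-1) ^+ h * 'C(k, h)%:R)) =
      (-1) ^+ h * 'C(k, h)%:R :> laurent (laurent L).
    by rewrite (rmorphMsign (@lconst L)) (rmorphMsign (@lconst (laurent L)))
      (rmorph_nat (@lconst L)) (rmorph_nat (@lconst (laurent L))).
  exact: mulr3_natr.
rewrite -(shift_scale h (k - h) x l j) -lscale_const2.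
by rewrite [in RHS]scalerA [zin ^+ h * _]mulrC.
Qed.

End Shifts2.
Arguments zin {L}.
Arguments zout {L}.

Lemma factor_rearrange (R : comPzRingType) (g d u v x y : R) :
  g * d * (u * x) * (v * y) = (g * u * v) * (x * y * d).
Proof. by ring. Qed.

(** * Weak commutativity of the products *)

Section FullLocality.
Variables (K : numFieldType) (W : lmodType K) (p : laurent K).
Hypothesis p_neq0 : p != 0.
Notation L := (laurent K).
Implicit Types (a b c : distr W).

(** This is (phi(z, z1) - phi(z, z2)) / (z1 - z2), each z1^n - z2^n being divided separately. It is
    symmetric and its constant term is p, so it is a unit. *)
Definition phi_quot : laurent (laurent L) :=
  lseries (fun j => lseries (fun i => phi p (i + j).+1)).

Lemma phi_quotE : lconst (phi p) - lmapc (phi p) = (zin - zout) * phi_quot.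
Proof.
apply: eq_laurent => j; apply: eq_laurent => l.
have subE (f g : laurent (laurent L)) : (f - g) j l = f j l - g j l by [].
rewrite mulrBl !subE /zin /zout lconst_mulE !lmonom_mulE {subE}.
case: j => [[|j]|j]; case: l => [[|l]|l] //=;
  rewrite ?mulr0n ?mulr1n ?subrr ?subr0 ?sub0r ?subn1 ?addn0 ?addnS//=.
by rewrite addSn subrr.
Qed.

Lemma sym_phi_quot : sym (fun i => phi_quot i) (fun i => phi_quot i).
Proof.
split=> [[i|i] [j|j]|[i|i] [j|j] h] //=.
by rewrite addnC.
Qed.

(** This is (phi(z, z0) - z) / z0, with constant term p. *)
Definition phi_quot0 : laurent L := lseries (fun i => phi p i.+1).

Lemma phi_quot0E : phi p - lconst (zL K) = lmonom 1 1 * phi_quot0.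
Proof.
apply: eq_laurent => n; rewrite laurB lmonom_mulE.
case: n => [[|n]|n]; last by rewrite /= mulr0n subr0.
  by rewrite phi0 lconst0 subrr.
by rewrite /= mulr0n subr0 subn1.
Qed.

Lemma poly_phi_factor (q : {poly {poly K}}) : q != 0 ->
  exists (k : nat) (u : laurent L), [/\ poly_phi p q = u * lmonom 1 1 ^+ k,
    forall n, n < 0 -> u n = 0 & u 0 != 0].
Proof.
move=> /diag_factor[k [g [-> g0]]]; exists k, (evphi p (lq g) * phi_quot0 ^+ k).
have quot_pos i n : n < 0 -> (phi_quot0 ^+ i) n = 0.
  elim: i n => [|i IH] n n0; first by rewrite expr0 (lconst_pos 1).
  by rewrite exprS; apply: lmul_pos => //; case.
have quot0 i : (phi_quot0 ^+ i) 0 = p ^+ i.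
  elim: i => [|i IH]; first by rewrite !expr0 -[1]/(lconst 1) lconst0.
  rewrite !exprS lmul_coef0 ?IH//; [|by case|exact: quot_pos].
  by rewrite -[phi_quot0 0]/(phi p 1) phi1.
split.
- rewrite poly_phiE lqM evphiM -mulrA; congr (_ * _).
  have -> : lq (('X - 'X%:P) ^+ k) = ('X - (zL K)%:P) ^+ k.
    by rewrite /lq rmorphXn rmorphB /= map_polyX map_polyC /= lpolyX.
  have -> : evphi p (('X - (zL K)%:P) ^+ k) = (phi p - lconst (zL K)) ^+ k.
    by rewrite /evphi rmorphXn rmorphB /= map_polyX map_polyC /= horner_exp hornerXsubC.
  by rewrite phi_quot0E exprMn mulrC.
- by move=> n n0; apply: lmul_pos => //; [exact: evphi_pos|exact: quot_pos].
- rewrite lmul_coef0; [|exact: evphi_pos|exact: quot_pos].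
  by rewrite quot0 evphi0 lq_hornerX mulf_neq0// expf_neq0.
Qed.

Notation polyK2 q := (map_poly (map_poly (@lconst K)) q).

(** After [swapXY] the outer variable stands for z1 and the inner one for z2, so both displayed
    powers are powers of z1 - z2, and u and u' are one unit written in two rings. *)
Lemma ev2_factor (q : {poly {poly K}}) : q != 0 ->
  exists (k : nat) (u u' : laurent (laurent L)),
  [/\ ev2 p (polyK2 q) = u * (zin - zout) ^+ k,
      ev2 p (swapXY (polyK2 q)) = u' * (zout - zin) ^+ k,
      sym (fun i => u i) (fun i => u' i) & u 0 0 != 0].
Proof.
move=> /diag_factor[k [g [-> g0]]].
exists k, (ev2 p (polyK2 g) * phi_quot ^+ k), (ev2 p (swapXY (polyK2 g)) * phi_quot ^+ k).
have -> : polyK2 (g * ('X - 'X%:P) ^+ k) = polyK2 g * ('X - 'X%:P) ^+ k.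
  by rewrite rmorphM rmorphXn rmorphB /= map_polyX map_polyC /= map_polyX.
have sym_quot : sym (fun i => (phi_quot ^+ k) i) (fun i => (phi_quot ^+ k) i).
  exact: sym_exp sym_phi_quot.
split.
- rewrite ev2M -mulrA; congr (_ * _).
  have -> : ev2 p (('X - 'X%:P) ^+ k) = (lconst (phi p) - lmapc (phi p)) ^+ k.
    by rewrite ev2Xn ev2B ev2X ev2C evphiX.
  by rewrite phi_quotE exprMn mulrC.
- rewrite [swapXY (_ * _)]rmorphM /= ev2M -mulrA; congr (_ * _).
  have -> : swapXY (('X - 'X%:P) ^+ k) = ('X%:P - 'X) ^+ k :> {poly {poly L}}.
    by rewrite rmorphXn rmorphB /= swapXY_X swapXY_Y.
  have -> : ev2 p (('X%:P - 'X) ^+ k) = (lmapc (phi p) - lconst (phi p)) ^+ k.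
    by rewrite ev2Xn ev2B ev2X ev2C evphiX.
  by rewrite -opprB phi_quotE -mulNr opprB exprMn mulrC.
- exact: sym_mul (sym_ev2 p (polyK2 g)) sym_quot.
- rewrite quad_mul00; [|by have [] := sym_ev2 p (polyK2 g)|by have [] := sym_quot].
  rewrite ev2_00 mulf_neq0//.
  have -> : (phi_quot ^+ k) 0 0 = p ^+ k; last by rewrite expf_neq0.
  elim: {sym_quot} k => [|k IH]; first by rewrite !expr0 /= mulr1n.
  rewrite !exprS quad_mul00; first by rewrite IH -[phi_quot 0 0]/(phi p 1) phi1.
    by have [] := sym_phi_quot.
  by have [] := sym_exp k sym_phi_quot.
Qed.

Section Commute.
Variables (a b c : distr W) (w : W).
Hypotheses (aE : in_EW a) (bE : in_EW b) (cE : in_EW c).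
Hypotheses (qac : ql a c) (qbc : ql b c).
Hypotheses (qabc : forall n, ql a (nprod p b n c)) (qbac : forall n, ql b (nprod p a n c)).
Variables q1 q2 q3 : {poly {poly K}}.
Hypotheses (q1k : kills q1 a b) (q2n0 : q2 != 0) (q2k : kills q2 a c)
  (q3n0 : q3 != 0) (q3k : kills q3 b c).

(** This is q1(x, y) q2(x, z) q3(y, z), with one factor for each pair among a(x), b(y), c(z). *)
Definition tri : {poly {poly L}} :=
  polyK2 q1 * map_poly polyC (lq q2) * (lq q3)%:P.

Lemma prod3E m n k : prod3 a b c w m n k = a m (b n (c k w)).
Proof. by rewrite /prod3 lsmapE ?distr0// prodvE. Qed.

Lemma polyK2_pact2 (G : int -> int -> lser W) m n k :
  pact2 (polyK2 q1) G m n k =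
  \sum_(i < size q1) \sum_(j < size q1`_i) q1`_i`_j *: G (m - i%:Z) (n - j%:Z) k.
Proof.
have sz (q : {poly K}) : size (map_poly (@lconst K) q) = size q by exact: size_map_poly.
rewrite (@pact2E _ _ (size q1)); last exact: size_poly.
rewrite lser_sum; apply: eq_bigr => i _.
rewrite coef_map /= (@pactE _ _ (size q1`_i)) ?sz// lser_sum; apply: eq_bigr => j _.
transitivity ((lconst q1`_i`_j *: G (m - i%:Z) (n - j%:Z)) k).
  by rewrite coef_map.
exact: lscale_const.
Qed.

Lemma tri_swap m n :
  pact2 tri (prod3 a b c w) m n = pact2 (swapXY tri) (prod3 b a c w) n m.
Proof.
rewrite (pact2_swap tri (fun m n => prod3 b a c w n m)).
apply/eqP; rewrite -subr_eq0 -pact2Br; apply/eqP.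
rewrite /tri -mulrA mulrC pact2M; apply: pact2_0r => m' n'.
apply: eq_lser => k; rewrite polyK2_pact2.
have := congr1 (fun f : lser W => f n') (q1k (c k w) m').
rewrite -poly2_mulE; last exact: rowb_comm.
rewrite lser0 => e; rewrite [RHS]lser0; apply: etrans e; apply: eq_bigr => i _; apply: eq_bigr => j _; congr (_ *: _).
rewrite lserB prod3E /distr_comm; congr (_ - _).
by rewrite /prod3 lsmapE ?distr0// prodvE.
Qed.

Lemma tri_ylo : exists N : int, forall m n, n < N ->
  pact2 tri (prod3 a b c w) m n = 0.
Proof.
have [N h] := prod_bounded w bE cE q3k; exists N => m n nN.
rewrite /tri pact2M; apply: (@pact2_ylo _ _ _ _ N) => // m' n' nN'.
rewrite pact2C.
have -> : pact (lq q3) (prod3 a b c w m') n' =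
          lsmap (a m') (pact (lq q3) (prodv b c w) n').
  rewrite pact_lin//; apply: lsmap_linear; exact: aE.1.
by apply: eq_lser => k; rewrite lsmapE ?distr0// h ?distr0// nN'.
Qed.

Lemma tri_zlo : exists N : int, forall m n k, k < N ->
  pact2 tri (prod3 a b c w) m n k = 0.
Proof.
have [N h] := EW_lo w cE; exists N => m n k kN.
rewrite /tri -mulrA pact2M polyK2_pact2 big1// => i _; rewrite big1// => j _.
rewrite pact2M pact2_mapC (@pact_lq_lo _ _ _ _ N) ?scaler0// => m' n' nN'.
rewrite pact2C (@pact_lq_lo _ _ _ _ N)// => m'' n'' nN''.
by rewrite prod3E h// !distr0.
Qed.

End Commute.

Section Commute2.
Variables (a b c : distr W) (w : W).
Hypotheses (aE : in_EW a) (bE : in_EW b) (cE : in_EW c).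
Hypotheses (qac : ql a c) (qbc : ql b c).
Hypotheses (qabc : forall n, ql a (nprod p b n c)) (qbac : forall n, ql b (nprod p a n c)).
Variables q1 q2 q3 : {poly {poly K}}.
Hypotheses (q1k : kills q1 a b) (q2n0 : q2 != 0) (q2k : kills q2 a c)
  (q3n0 : q3 != 0) (q3k : kills q3 b c).
Notation s := (tri q1 q2 q3).

Lemma swap_tri : swapXY s =
  swapXY (polyK2 q1) * map_poly polyC (lq q3) * (lq q2)%:P.
Proof.
rewrite /tri !rmorphM /= swapXY_map_polyC swapXY_polyC.
by rewrite -!mulrA [X in _ * X = _]mulrC.
Qed.

(** The exponents of z are bounded because c(z) acts first, those of y because q3 bounds b(y) c(z),
    and those of x because q1 allows the order b(y) a(x) c(z), in which q2 bounds a(x) c(z). *)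
Lemma tri_bounded : bounded3 (fun m n => pact2 s (prod3 a b c w) m n).
Proof.
have [N1 h1] := tri_ylo w aE bE cE q1 q2 q3k.
have [N2 h2] := tri_zlo w aE bE cE q1 q2 q3.
have [N3 h3] : exists N : int, forall m n, n < N ->
    pact2 (swapXY s) (prod3 b a c w) m n = 0.
  have [N h] := prod_bounded w aE cE q2k; exists N => m n nN.
  rewrite swap_tri pact2M; apply: (@pact2_ylo _ _ _ _ N) => // m' n' nN'.
  rewrite pact2C.
  have -> : pact (lq q2) (prod3 b a c w m') n' =
            lsmap (b m') (pact (lq q2) (prodv a c w) n').
    rewrite pact_lin//; apply: lsmap_linear; exact: bE.1.
  by apply: eq_lser => k; rewrite lsmapE ?distr0// h ?distr0// nN'.
exists (Num.min N1 (Num.min N2 N3)) => m n k /or3P[mN|nN|kN].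
- by rewrite (tri_swap w aE bE cE q2 q3 q1k) h3//; lia.
- by rewrite h1//; lia.
- by rewrite h2//; lia.
Qed.

Lemma tri_sym : sym (fun j => (ev2 p s *: YYs p a b c w) j)
                    (fun i => (ev2 p (swapXY s) *: YYs p b a c w) i).
Proof.
have bA := tri_bounded.
have bA' : bounded3 (fun n m => pact2 (swapXY s) (prod3 b a c w) n m).
  have [N h] := bounded3_tr bA; exists N => n m k /h.
  by rewrite (tri_swap w aE bE cE q2 q3 q1k).
have H1 i j : (ev2 p s *: YYs p a b c w) j i = TT p (pact2 s (prod3 a b c w)) i j.
  exact: esym (half_product p_neq0 aE bE cE qbc qabc q3n0 q3k bA _ _).
have H2 i j : (ev2 p (swapXY s) *: YYs p b a c w) i j =
    TT p (pact2 (swapXY s) (prod3 b a c w)) j i.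
  rewrite swap_tri in bA' *.
  exact: esym (half_product p_neq0 bE aE cE qac qbac q2n0 q2k bA' _ _).
split=> [i j|i j h].
  rewrite H1 H2 TT_comm//; apply: TT_ext => n m.
  exact: tri_swap.
rewrite H1 /TT; move: h => /orP[i0|j0]; last by rewrite T_pos.
by rewrite T_eq0// => m k; rewrite T_pos.
Qed.

End Commute2.

(** The exponent [N] is the multiplicity of z1 = z2 in q1, which belongs to a and b alone. The
    polynomials q2 and q3 vary with c but contribute only units and powers of z1 and z2. Hence [N]
    is uniform in c and w. *)
Lemma nprod_comm a b q1 : in_EW a -> in_EW b -> q1 != 0 -> kills q1 a b ->
  exists N : nat, forall c w,
  in_EW c -> ql a c -> ql b c -> (forall n, ql a (nprod p b n c)) ->
  (forall n, ql b (nprod p a n c)) -> forall j l : int,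
  \sum_(h < N.+1) ((-1) ^+ h * 'C(N, h)%:R) *:
    Yv p a (nprod p b (- (j - h%:Z) - 1) c) w (l - (N - h)%N%:Z) =
  \sum_(h < N.+1) ((-1) ^+ h * 'C(N, h)%:R) *:
    Yv p b (nprod p a (- (l - (N - h)%N%:Z) - 1) c) w (j - h%:Z).
Proof.
move=> aE bE q1n0 q1k; have [k [u [u' [e1 e1' su u00]]]] := ev2_factor q1n0.
exists k => c w cE qac qbc qabc qbac.
have [q2 /(qlocalP _ aE cE)[q2n0 q2k]] := qac.
have [q3 /(qlocalP _ bE cE)[q3n0 q3k]] := qbc.
have [k2 [u2 [e2 u2pos u20]]] := poly_phi_factor q2n0.
have [k3 [u3 [e3 u3pos u30]]] := poly_phi_factor q3n0.
have H := tri_sym w aE bE cE qac qbc qabc qbac q1k q2n0 q2k q3n0 q3k.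
have mo : lmapc (lmonom 1 1) = zout :> laurent (laurent L).
  by apply: eq_laurent => n /=; case: (n == 1); rewrite ?mulr1n ?mulr0n ?rmorph0.
have lcE (v : laurent L) n : lconst (v * lmonom 1 1 ^+ n) = lconst v * zin ^+ n.
  by rewrite rmorphM rmorphXn.
have lmE (v : laurent L) n : lmapc (v * lmonom 1 1 ^+ n) = lmapc v * zout ^+ n.
  by rewrite -mo rmorphM rmorphXn.
have E1 : ev2 p (tri q1 q2 q3) = (u * lconst u2 * lmapc u3) *
    (zin ^+ k2 * zout ^+ k3 * (zin - zout) ^+ k).
  rewrite /tri !ev2M ev2_mapC ev2C -!poly_phiE e1 e2 e3.
  rewrite lcE lmE; exact: factor_rearrange.
have E2 : ev2 p (swapXY (tri q1 q2 q3)) = (u' * lmapc u2 * lconst u3) *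
    (zin ^+ k3 * zout ^+ k2 * (zout - zin) ^+ k).
  rewrite swap_tri !ev2M ev2_mapC ev2C -!poly_phiE e1' e2 e3.
  rewrite lcE lmE (mulrAC u' (lmapc u2) (lconst u3)).
  exact: factor_rearrange.
have s2 := sym_lconst u2pos; have s3 := sym_lconst u3pos.
have sU : sym (fun i => (u * lconst u2 * lmapc u3) i)
              (fun i => (u' * lmapc u2 * lconst u3) i).
  exact: (sym_mul (sym_mul su s2) (sym_sym s3)).
have U00 : (u * lconst u2 * lmapc u3) 0 0 != 0.
  have [_ z1] := su; have [_ z2] := s2; have [_ z3] := sym_sym s3.
  have [_ z12] := sym_mul su s2.
  by rewrite (quad_mul00 z12 z3) (quad_mul00 z1 z2) !lconst0 !mulf_neq0.
rewrite E1 E2 -(scalerA (u * _ * _)) -(scalerA (u' * _ * _)) in H.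
have [{}H _] := sym_unit sU U00 H.
move=> j l.
(* The shifts by [k3] and [k2] undo the factors z2^k3 and z1^k2, so that only the power of z1 - z2
   is left. *)
have e : ((zin ^+ k2 * zout ^+ k3 * (zin - zout) ^+ k) *: YYs p a b c w)
      (j + k3%:Z) (l + k2%:Z) =
    ((zin ^+ k3 * zout ^+ k2 * (zout - zin) ^+ k) *: YYs p b a c w)
      (l + k2%:Z) (j + k3%:Z) by exact: H.
rewrite -(scalerA (zin ^+ k2 * _)) -(scalerA (zin ^+ k3 * _)) in e.
rewrite (shift_scale k2 k3) (shift_scale k3 k2) !addrK in e.
rewrite binomial_scale binomial_scale_tr in e.
transitivity (\sum_(h < k.+1) ((-1) ^+ h * 'C(k, h)%:R) *:
    YYs p a b c w (j - h%:Z) (l - (k - h)%N%:Z)).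
  by apply: eq_bigr => h _; rewrite YYsE.
by rewrite e; apply: eq_bigr => h _; rewrite YYsE.
Qed.

End FullLocality.

(** * Translation operator and vacuum *)

Lemma addr2K (V : zmodType) (a b : V) : a + (a + b) - a - a = b.
Proof. by rewrite [a + (_ + _)]addrC addrK [a + b]addrC addrK. Qed.

Section Translation.
Variables (K : numFieldType) (W : lmodType K) (p : laurent K).
Notation L := (laurent K).
Implicit Types (a b : distr W) (B : int -> int -> W).

Notation Dp := (Dl p).
Notation DW := (@Ds K W p).

Fact Dl_zmod_morphism : zmod_morphism Dp.
Proof.
by move=> f g; rewrite DlD /Dl lderivN mulrN.
Qed.

HB.instance Definition _ := GRing.isZmodMorphism.Build L L (Dl p) Dl_zmod_morphism.

Lemma Dl0 : Dp 0 = 0. Proof. exact: (raddf0 (Dl p)). Qed.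

Fact Ds_zmod_morphism : zmod_morphism DW.
Proof. by move=> f g; rewrite DsD DsN. Qed.

HB.instance Definition _ :=
  GRing.isZmodMorphism.Build (lser W) (lser W) DW Ds_zmod_morphism.

Lemma Ds_map (al : W -> W) (f : lser W) : linear al ->
  DW (lsmap al f) = lsmap al (DW f).
Proof.
move=> lin; rewrite /Ds (plinZ (lsmap_linear lin)); congr (_ *: _).
have al0 := plin0 lin.
by apply: eq_lser => i; rewrite lsmapE// !sderivE lsmapE// plinZ.
Qed.

Lemma pact_Ds (q : {poly L}) (G : int -> lser W) m :
  DW (pact q G m) = pact (map_poly Dp q) G m + pact q (fun i => DW (G i)) m.
Proof.
rewrite (@pactE _ _ (size q) (map_poly _ _)) ?size_poly// -big_split raddf_sum.
by apply: eq_bigr => i _; rewrite -[LHS]/(DW _) DsZ coef_map.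
Qed.

Definition dx B : int -> int -> W := fun m n => (m + 1)%:~R *: B (m + 1) n.
Definition dz B : int -> int -> W := fun m n => (n + 1)%:~R *: B m (n + 1).
Definition Dz B : int -> int -> W := mulz p (dz B).

Lemma bounded2_dx B : bounded2 B -> bounded2 (dx B).
Proof.
by move=> [N h]; exists (N - 1) => m n mn; rewrite /dx h ?scaler0//; lia.
Qed.

Lemma bounded2_dz B : bounded2 B -> bounded2 (dz B).
Proof. by move=> bB; apply/bounded2_tr/(bounded2_dx (bounded2_tr bB)). Qed.

Lemma colx_dx B n : bounded2 B -> colx (dx B) n = sderiv (colx B n).
Proof.
move=> bB; apply: eq_lser => m; rewrite sderivE !colxE//.
exact: bounded2_dx.
Qed.

Lemma DxE B : bounded2 B -> Dx p B = mulx p (dx B).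
Proof.
move=> bB; apply/funext => m; apply/funext => n.
by rewrite /mulx colx_dx.
Qed.

Lemma DzE (G : int -> lser W) : bounded2 (fun m => G m) ->
  Dz (fun m => G m) = fun m => DW (G m).
Proof.
move=> bG; apply/funext => m; apply/funext => n.
rewrite /Dz /mulz /mulx; congr (_ _ n); congr (_ *: _); apply: eq_lser => i.
by rewrite colxE//; exact/bounded2_tr/bounded2_dz.
Qed.

Lemma bounded2_Dz B : bounded2 B -> bounded2 (Dz B).
Proof. by move=> bB; apply/bounded2_mulz/bounded2_dz. Qed.

Lemma sderiv_Delta B : bounded2 B ->
  sderiv (DeltaL B) = DeltaL (dx B) + DeltaL (dz B).
Proof.
move=> bB; have [N BN] := bB.
apply: eq_lser => k; rewrite sderivE lserD !DeltaLE//; last 2 first.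
- exact: bounded2_dz.
- exact: bounded2_dx.
rewrite /Delta (@fsum_scale _ _ _ N (k + 1 - N + 1)); first last.
- by move=> i h; rewrite BN//; lia.
- by move=> i h; rewrite BN// h.
rewrite [\sum_(i \in _) dx _ _ _](fsum_shift 1).
rewrite -(@fsumD _ N (k + 1 - N + 1)).
- apply: eq_fsbigr => i _; rewrite /dx /dz.
  have -> : i - 1 + 1 = i by lia.
  have -> : k - (i - 1) = k + 1 - i by lia.
  have -> : k - i + 1 = k + 1 - i by lia.
  rewrite -scalerDl -intrD; congr (_%:~R *: _); lia.
- by move=> i h; rewrite /dx BN ?scaler0//; lia.
- by move=> i h; rewrite /dx BN ?scaler0//; lia.
- by move=> i h; rewrite /dz BN ?scaler0//; lia.
- by move=> i h; rewrite /dz BN ?scaler0//; lia.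
Qed.

Lemma Ds_Delta B : bounded2 B ->
  DW (DeltaL B) = DeltaL (Dx p B) + DeltaL (Dz B).
Proof.
move=> bB; rewrite DxE// /Dz /Ds sderiv_Delta// scalerDr.
rewrite DeltaL_mulx; last exact: bounded2_dx.
by rewrite DeltaL_mulz//; exact: bounded2_dz.
Qed.

Lemma Dx_Dz B : bounded2 B -> Dx p (Dz B) = Dz (Dx p B).
Proof.
move=> bB; rewrite Dx_mulz; last exact: bounded2_dz.
congr mulz; apply/funext => m; apply/funext => n.
rewrite /Dx /dz.
have -> : colx (dz B) n = lconst (n + 1)%:~R *: colx B (n + 1).
  apply: eq_lser => i; rewrite lscale_const !colxE//.
  exact: bounded2_dz.
by rewrite Ds_const lscale_const.
Qed.

(** The operator p d/dz - d/dz0. It annihilates phi(z, z0), so under the substitution x = phi(z, z0)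
    it corresponds to p(z) d/dz acting on the z of B(x, z) alone. *)
Definition dD (X : lser (lser W)) : lser (lser W) := lsmap DW X - sderiv X.

Lemma dDE X j : dD X j = DW (X j) - (j + 1)%:~R *: X (j + 1).
Proof. by rewrite lserB sderivE lsmapE// Ds0. Qed.

Fact dDl_bdd (f : laurent L) : bounded_below (fun n => Dp (f n)).
Proof. by have [N fN] := laurentP f; exists N => n /fN->; rewrite raddf0. Qed.

Definition dDl (f : laurent L) : laurent L := mk_laurent (dDl_bdd f) - lderiv f.

Lemma dD_scale (f : laurent L) (X : lser (lser W)) :
  dD (f *: X) = dDl f *: X + f *: dD X.
Proof.
rewrite /dD /dDl sderivZ scalerBl scalerBr opprD addrACA; congr (_ + _).
apply: eq_lser => n; rewrite lserD lsmapE ?Ds0// !lscaleE.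
have [N fN] := laurentP f; have [M XM] := lserP X.
rewrite (@fsum_additive _ _ DW N (n - M + 1)); first last.
- by move=> i h; rewrite XM ?scaler0//; lia.
- by move=> i /fN->; rewrite scale0r.
rewrite -(@fsumD _ N (n - M + 1)).
- by apply: eq_fsbigr => i _; rewrite lsmapE ?Ds0//; exact: DsZ.
- by move=> i /fN e; rewrite -[mk_laurent _ i]/(Dp (f i)) e Dl0 scale0r.
- by move=> i h; rewrite XM ?scaler0//; lia.
- by move=> i /fN->; rewrite scale0r.
- by move=> i h; rewrite lsmapE ?Ds0// XM ?Ds0 ?scaler0//; lia.
Qed.

Lemma dD_T B : bounded2 B -> dD (T p B) = T p (Dz B).
Proof.
move=> bB; rewrite /dD sderiv_T; apply: eq_lser => n; rewrite lserB lsmapE ?Ds0//.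
case: n => j; last by rewrite !T_pos// Ds0 subr0.
rewrite -[T p B j]/(Tc p j B) -[T p (Dx p B) j]/(Tc p j (Dx p B)).
rewrite -[RHS]/(Tc p j (Dz B)) /Tc Ds_const.
rewrite (Ds_Delta (bounded2_iter p j bB)) scalerDr -iterSr /= addrAC subrr add0r.
congr (_ *: DeltaL _); elim: j B bB => // j IH B bB.
by rewrite !iterSr IH ?Dx_Dz//; exact: bounded2_Dx.
Qed.

Lemma dDl_evphi (q : {poly L}) : dDl (evphi p q) = evphi p (map_poly Dp q).
Proof.
have dDlD f g : dDl (f + g) = dDl f + dDl g.
  apply: eq_laurent => n; rewrite /dDl lderivD laurD !laurB laurD /= DlD.
  by rewrite opprD addrACA.
have dDlM f g : dDl (f * g) = dDl f * g + f * dDl g.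
  rewrite /dDl lderivM mulrBl mulrBr opprD addrACA; congr (_ + _).
  apply: eq_laurent => n; rewrite laurD /= /lmul_fun /=.
  have [N fN] := laurentP f; have [M gM] := laurentP g.
  rewrite (@fsum_additive _ _ Dp N (n - M + 1)); first last.
  - by move=> i h; rewrite gM ?mulr0//; lia.
  - by move=> i /fN->; rewrite mul0r.
  rewrite -(@fsumD _ N (n - M + 1)).
  - by apply: eq_fsbigr => i _; exact: DlM.
  - by move=> i /fN->; rewrite raddf0 mul0r.
  - by move=> i h; rewrite gM ?mulr0//; lia.
  - by move=> i /fN->; rewrite mul0r.
  - by move=> i h; rewrite gM ?raddf0 ?mulr0//; lia.
(* On phi = e^(z0 p d/dz) z the derivations d/dz0 and p d/dz agree. *)
have dDl_phi : dDl (phi p) = 0.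
  rewrite /dDl phiE lderiv_E; apply/eqP; rewrite subr_eq0; apply/eqP.
  apply: eq_laurent => n /=; case: n => j /=; last by rewrite raddf0.
  by rewrite DlM Dl_const mul0r add0r -iterSr.
have dDlC c : dDl (lconst c) = lconst (Dp c).
  rewrite /dDl lderiv_const subr0; apply: eq_laurent => n /=.
  by case: (n == 0); rewrite ?mulr1n ?mulr0n ?raddf0.
elim/poly_ind: q => [|q c IH].
  have ev0 : evphi p 0 = 0 by exact: (rmorph0 (evphi p)).
  rewrite map_poly0 ev0; apply: eq_laurent => n.
  by rewrite /dDl laurB lderivE laur0 mulr0 subr0 -[LHS]/(Dp 0) Dl0.
have -> : map_poly Dp (q * 'X + c%:P) = map_poly Dp q * 'X + (Dp c)%:P.
  apply/polyP => i; rewrite coef_map !coefD !coefMX !coefC coef_map.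
  by rewrite [LHS]raddfD /=; case: i => [|i] /=; rewrite ?raddf0.
rewrite !evphiD !evphiM !evphiC evphiX dDlD dDlM dDl_phi dDlC IH.
by rewrite mulr0 addr0.
Qed.

(* the translation operator, cf. [nprod_idr] *)
Definition Dd a : distr W := fun m w => DW (vec a w) m.

Lemma vec_Dd a w : vec (Dd a) w = DW (vec a w).
Proof. by apply: eq_lser => m; rewrite to_lserE//; exact: lserP. Qed.

Lemma EW_Dd a : in_EW a -> in_EW (Dd a).
Proof.
move=> aE; split=> [m c u v|w]; last exact: (lserP (DW (vec a w))).
rewrite /Dd; have -> : vec a (c *: u + v) = lconst c *: vec a u + vec a v.
  by apply: eq_lser => n; rewrite lserD lscale_const !vecE// (aE.1 n).
by rewrite DsD Ds_const lserD lscale_const.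
Qed.

Lemma prodv_Dd a b w m : in_EW a -> in_EW b ->
  prodv a (Dd b) w m = DW (prodv a b w m).
Proof.
move=> aE bE; have bD := EW_Dd bE.
have e : prodv a b w m = lsmap (a m) (vec b w).
  by apply: eq_lser => n; rewrite lsmapE ?distr0// vecE// prodvE.
rewrite e (Ds_map _ (aE.1 m)) -vec_Dd.
by apply: eq_lser => n; rewrite lsmapE ?distr0// vecE// prodvE.
Qed.

Lemma commv_Dd a b w m : in_EW a -> in_EW b ->
  commv a (Dd b) w m = DW (commv a b w m).
Proof.
move=> aE bE; have bD := EW_Dd bE.
apply: (addIr (vec (Dd b) (a m w))); rewrite -commv_prodv// prodv_Dd//.
by rewrite commv_prodv// DsD vec_Dd.
Qed.

Lemma pact_sqr_Ds (q : {poly L}) (G : int -> lser W) m :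
  pact (q * q) (fun i => DW (G i)) m =
  DW (pact (q * q) G m) - pact (map_poly Dp q) (pact q G) m
  - pact (map_poly Dp q) (pact q G) m.
Proof.
have e1 : DW (pact (q * q) G m) = pact (map_poly Dp q) (pact q G) m +
    pact q (fun i => DW (pact q G i)) m by rewrite pactM pact_Ds.
have e2 : pact q (fun i => DW (pact q G i)) m =
    pact (map_poly Dp q) (pact q G) m + pact (q * q) (fun i => DW (G i)) m.
  rewrite (pact_eqr _ _ (pact_Ds q G)) pactDr -!pactM.
  by rewrite [q * map_poly _ _]mulrC.
by rewrite e1 e2 addr2K.
Qed.

(** With the derivation p d/dz written as a prime, q C = 0 gives q C' = - q' C, and a second factor
    q kills the right-hand side. *)
Lemma kills_Dd q a b : in_EW a -> in_EW b -> kills q a b -> kills (q * q) a (Dd b).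
Proof.
move=> aE bE h w m.
rewrite lqM (pact_eqr _ _ (fun i => commv_Dd w i aE bE)) pact_sqr_Ds.
by rewrite pactM !(pact0r _ _ (h w)) Ds0 !subr0.
Qed.

Hypothesis p_neq0 : p != 0.

(** The sides are compared after multiplication by Q^2, where Q is the value of q at phi. Deriving
    q^2 inside the substitution and deriving Q^2 outside it produce the same two correction terms,
    by [dDl_evphi]. *)
Lemma Yv_Dd a b w : in_EW a -> in_EW b -> ql a b -> Yv p a (Dd b) w = dD (Yv p a b w).
Proof.
move=> aE bE abq; have [q /(qlocalP _ aE bE)[qn0 qk]] := abq.
have bD := EW_Dd bE; have kD := kills_Dd aE bE qk; have qq0 : q * q != 0 by rewrite mulf_neq0.
have abD : ql a (Dd b) by exists (q * q); apply/qlocalP.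
apply/esym/(Yv_unique p_neq0 (q := q * q)) => //.
have bB := prod_bounded w aE bE qk.
have bB2 := bounded2_pact (lq q) bB.
have bBD := bounded2_pact (map_poly Dp (lq q)) bB.
set X := Yv p a b w; set Q := poly_phi p q.
have TB : T p (fun m => pact (lq q) (prodv a b w) m) = Q *: X by rewrite Yv_spec.
pose G m : lser W := DW (pact (lq q) (pact (lq q) (prodv a b w)) m).
pose H m : lser W := pact (map_poly Dp (lq q)) (pact (lq q) (prodv a b w)) m.
have GE : (fun m => scoef (G m)) =
    Dz (fun m => pact (lq q) (pact (lq q) (prodv a b w)) m) by rewrite DzE.
have bG : bounded2 (fun m => G m).
  by rewrite -[X in bounded2 X]/(fun m => scoef (G m)) GE; exact: bounded2_Dz.
have -> : T p (fun m => pact (lq (q * q)) (prodv a (Dd b) w) m) =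
    T p (fun m n => (G m n - H m n) - H m n).
  apply: T_ext => m n.
  rewrite lqM (pact_eqr _ _ (fun i => prodv_Dd w i aE bE)) pact_sqr_Ds.
  by rewrite pactM.
have bGH : bounded2 (fun m n => G m n - H m n).
  have [N1 h1] := bG; have [N2 h2] := bBD; exists (Num.min N1 N2) => m n mn.
  by rewrite h1 ?h2 ?subr0//; lia.
rewrite (T_sub p bGH bBD) (T_sub p bG bBD).
have -> : T p (fun m => H m) = dDl Q *: (Q *: X).
  by rewrite /H T_pact// TB -dDl_evphi -poly_phiE.
have -> : T p (fun m => G m) = dD (Q *: (Q *: X)).
  rewrite -[X in T p X]/(fun m => scoef (G m)) GE -dD_T//; congr dD.
  by rewrite T_pact// TB -poly_phiE.
have -> : poly_phi p (q * q) = Q * Q by rewrite poly_phiE lqM evphiM -poly_phiE.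
rewrite dD_scale (dD_scale Q X) (scalerDr Q (dDl Q *: X)) (scaleCA Q (dDl Q) X).
rewrite -(scalerA Q Q).
by move: (dDl Q *: _) (Q *: (Q *: _)) => u v; rewrite addr2K.
Qed.

Lemma Dd_nprod a b n : in_EW a -> in_EW b -> ql a b ->
  Dd (nprod p a n b) = nprod p a n (Dd b) - n%:~R *: nprod p a (n - 1) b.
Proof.
move=> aE bE abq; apply/funext => m; apply/funext => w.
have abD : ql a (Dd b).
  have [q /(qlocalP _ aE bE)[qn0 qk]] := abq.
  exists (q * q); apply/qlocalP => //; first exact: EW_Dd.
  by split; [rewrite mulf_neq0|exact: kills_Dd].
rewrite -[RHS]/(nprod p a n (Dd b) m w - n%:~R *: nprod p a (n - 1) b m w).
rewrite (nprodE p _ _ _ aE (EW_Dd bE) abD) (nprodE p _ _ _ aE bE abq).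
rewrite Yv_Dd// dDE lserB /Dd (vec_nprod p_neq0 _ _ aE bE abq).
have -> : - (n - 1) - 1 = - n - 1 + 1 by lia.
have -> : (- n - 1 + 1)%:~R = lconst ((- n)%:~R) :> L.
  by rewrite (rmorph_int (@lconst K)); congr (_%:~R); lia.
move: (Yv p a b w (- n - 1 + 1)) => f.
have -> : (lconst (- n)%:~R *: f) m = - (n%:~R *: f m).
  by rewrite -scaleNr -mulrNz; exact: lscale_const.
by rewrite opprK addrK.
Qed.

Lemma kills_idr q a : in_EW a -> kills q a (id_distr W).
Proof.
move=> aE w m; apply: pact0r => i; apply: eq_lser => j.
rewrite /zrow to_lserE /distr_comm /id_distr; last first.
  by exists 0 => n n0; rewrite (_ : n == 0 = false) ?distr0 ?subr0//; lia.
by case: ifP; rewrite ?subrr ?distr0 ?subrr.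
Qed.

Lemma EW_id : in_EW (id_distr W).
Proof.
split=> [n c u v|w]; rewrite /id_distr.
  by case: ifP => // _; rewrite scaler0 addr0.
by exists 0 => n n0; rewrite (lt_eqF n0).
Qed.

Lemma kills_idl q a : in_EW a -> kills q (id_distr W) a.
Proof.
move=> aE w m; apply: pact0r => i; apply: eq_lser => j.
rewrite commvE//; last exact: EW_id.
by rewrite /id_distr; case: ifP; rewrite ?distr0 ?subrr.
Qed.

Lemma ql_idr a : in_EW a -> ql a (id_distr W).
Proof.
move=> aE; exists 1; apply/(qlocalP _ aE EW_id); split; first exact: oner_neq0.
exact: kills_idr.
Qed.

Lemma ql_idl a : in_EW a -> ql (id_distr W) a.
Proof.
move=> aE; exists 1; apply/(qlocalP _ EW_id aE); split; first exact: oner_neq0.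
exact: kills_idl.
Qed.

Lemma lq1 : lq (1 : {poly {poly K}}) = 1.
Proof. exact: (rmorph1 (map_poly (@lpoly K))). Qed.

Lemma poly_phi1 : poly_phi p 1 = 1.
Proof. by rewrite poly_phiE lq1; exact: (rmorph1 (evphi p)). Qed.

Lemma Yv_idl a w j : in_EW a -> Yv p (id_distr W) a w j = if j == 0 then vec a w else 0.
Proof.
move=> aE; have := Yv_spec p_neq0 w EW_id aE (ql_idl aE) (oner_neq0 _) (kills_idl 1 aE).
rewrite poly_phi1 scale1r => ->; apply: T_xconst => m n.
rewrite lq1 pact1l prodvE//; last exact: EW_id.
by rewrite /id_distr vecE.
Qed.

Lemma nprod_idl a n : in_EW a -> nprod p (id_distr W) n a = if n == -1 then a else 0.
Proof.
move=> aE; apply/funext => m; apply/funext => w.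
rewrite (nprodE p _ _ _ EW_id aE (ql_idl aE)) Yv_idl//.
rewrite (_ : (- n - 1 == 0) = (n == -1)); last by lia.
by case: ifP => // _; rewrite vecE.
Qed.

(** The product a(x) 1_W does not involve z, so on the diagonal [Dx] becomes p d/dz and Y(a, z0) 1
    is e^(z0 p d/dz) a(z). Its coefficient of z0 identifies [Dd] with the translation operator. *)
Lemma Yv_idr a w (j : nat) : in_EW a ->
  Yv p a (id_distr W) w j = lconst (j`!%:R^-1) *: iter j DW (vec a w).
Proof.
move=> aE; have := Yv_spec p_neq0 w aE EW_id (ql_idr aE) (oner_neq0 _) (kills_idr 1 aE).
rewrite poly_phi1 scale1r => ->; rewrite -[LHS]/(lconst _ *: DeltaL _); congr (_ *: _).
have -> : (fun m => scoef (pact (lq 1) (prodv a (id_distr W) w) m)) =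
    fun m n => if n == 0 then vec a w m else 0.
  apply/funext => m; apply/funext => n; rewrite lq1 pact1l prodvE//; last exact: EW_id.
  by rewrite /id_distr vecE//; case: ifP => // _; rewrite distr0.
move: (vec a w) => f; have bf (g : lser W) : bounded2 (fun m n => if n == 0 then g m else 0).
  have [N gN] := lserP g; exists (Num.min N 0) => m n mn; case: eqP => // n0.
  by apply: gN; lia.
elim: j f => [|j IH] f.
  apply: eq_lser => k; rewrite -[iter 0 DW f]/f.
  rewrite -[iter 0 _ _]/(fun m n => if n == 0 then f m else 0) DeltaLE; last exact: bf.
  rewrite /Delta (@fsum1 _ k) ?subrr// => i ik.
  by rewrite (_ : (k - i == 0) = false)//; lia.
rewrite !iterSr -IH; congr (DeltaL (iter j _ _)).
apply/funext => m; apply/funext => n; rewrite /Dx.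
case: eqP => [->|n0].
  congr (_ (DW _) m); apply: eq_lser => i; rewrite colxE//.
rewrite (_ : colx _ n = 0) ?Ds0//; apply: eq_lser => i; rewrite colxE//.
by case: eqP.
Qed.

Lemma nprod_idr a : in_EW a ->
  [/\ nprod p a (-1) (id_distr W) = a, nprod p a (-2) (id_distr W) = Dd a &
      forall n : int, 0 <= n -> nprod p a n (id_distr W) = 0].
Proof.
move=> aE; have h n m w : nprod p a n (id_distr W) m w =
    Yv p a (id_distr W) w (- n - 1) m by rewrite nprodE//; [exact: EW_id|exact: ql_idr].
split.
- apply/funext => m; apply/funext => w; rewrite h (Yv_idr w 0)// fact0 invr1 rmorph1.
  by rewrite scale1r vecE.
- apply/funext => m; apply/funext => w; rewrite h (Yv_idr w 1)// invr1 rmorph1.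
  by rewrite scale1r.
- move=> n n0; apply/funext => m; apply/funext => w; rewrite h.
  have := Yv_spec p_neq0 w aE EW_id (ql_idr aE) (oner_neq0 _) (kills_idr 1 aE).
  by rewrite poly_phi1 scale1r => ->; rewrite T_pos//; lia.
Qed.

End Translation.

(** * The Jacobi identity from locality *)

Section NatSums.
Variable V : zmodType.
Implicit Types f g : nat -> V.

Definition evz f := exists k, forall i, (k <= i)%N -> f i = 0.

Lemma nsumE k f : (forall i, (k <= i)%N -> f i = 0) ->
  \sum_(i \in [set: nat]) f i = \sum_(i < k) f i.
Proof.
move=> fk; rewrite (fsbigE (iota 0 k)) ?iota_uniq//; last first.
  by move=> i _; rewrite mem_iota add0n /= -leqNgt => /fk.
rewrite -[k in iota _ k]subn0 -/(index_iota 0 k) big_mkord.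
by apply: eq_bigl => i; rewrite in_setT.
Qed.

Lemma evzD f g : evz f -> evz g -> evz (fun i => f i + g i).
Proof.
move=> [k fk] [l gl]; exists (maxn k l) => i; rewrite geq_max => /andP[/fk-> /gl->].
by rewrite addr0.
Qed.

Lemma nsumD f g : evz f -> evz g ->
  \sum_(i \in [set: nat]) (f i + g i) =
  \sum_(i \in [set: nat]) f i + \sum_(i \in [set: nat]) g i.
Proof.
move=> [k fk] [l gl].
have fm i : (maxn k l <= i)%N -> f i = 0 by rewrite geq_max => /andP[/fk].
have gm i : (maxn k l <= i)%N -> g i = 0 by rewrite geq_max => /andP[_ /gl].
rewrite !(@nsumE (maxn k l))// ?big_split// => i h.
by rewrite fm ?gm ?addr0.
Qed.

Lemma nsum0 f : (forall i, f i = 0) -> \sum_(i \in [set: nat]) f i = 0.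
Proof. by move=> f0; rewrite fsbig1. Qed.

Lemma nsum_recl f : evz f ->
  \sum_(i \in [set: nat]) f i = f 0%N + \sum_(i \in [set: nat]) f i.+1.
Proof.
move=> [k fk]; rewrite (@nsumE k.+1) => [|i ki]; last by apply: fk; exact: ltnW.
rewrite big_ord_recl (@nsumE k)// => i ki; apply: fk; exact: leqW.
Qed.

Lemma evzS f : evz f -> evz (fun i => f i.+1).
Proof. by move=> [k fk]; exists k => i ki; apply: fk; exact: leqW. Qed.

Lemma nsum_sum (I : Type) (r : seq I) (F : I -> nat -> V) : (forall s, evz (F s)) ->
  evz (fun i => \sum_(s <- r) F s i) /\
  \sum_(s <- r) \sum_(i \in [set: nat]) F s i =
  \sum_(i \in [set: nat]) \sum_(s <- r) F s i.
Proof.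
move=> hF; elim: r => [|s r [ez e]].
  split; first by exists 0%N => i _; rewrite big_nil.
  by rewrite big_nil nsum0// => i; rewrite big_nil.
have eE : (fun i => \sum_(j <- s :: r) F j i) = (fun i => F s i + \sum_(j <- r) F j i).
  by apply/funext => i; rewrite big_cons.
split; first by rewrite eE; exact: evzD (hF s) ez.
rewrite big_cons e -(nsumD (hF s) ez); apply: eq_fsbigr => i _.
by rewrite big_cons.
Qed.

End NatSums.

Lemma nsum_lin (F : pzRingType) (V V' : lmodType F) (al : V -> V') (f : nat -> V) :
  linear al -> evz f ->
  al (\sum_(i \in [set: nat]) f i) = \sum_(i \in [set: nat]) al (f i).
Proof.
move=> lin [k fk]; rewrite !(@nsumE _ k) ?plin_sum// => i /fk->.
exact: plin0.
Qed.

Lemma nsum_scale (F : pzRingType) (V : lmodType F) (c : F) (f : nat -> V) : evz f ->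
  c *: (\sum_(i \in [set: nat]) f i) = \sum_(i \in [set: nat]) c *: f i.
Proof.
by move=> [k fk]; rewrite !(@nsumE _ k) ?scaler_sumr// => i /fk->; rewrite scaler0.
Qed.

Section Binomials.
Variable K : numFieldType.
Notation gb := (@gbinom K).

Lemma gbinom0 m : gb m 0 = 1.
Proof. by rewrite /gbinom big_ord0 fact0 divr1. Qed.

Lemma gbinom_absorb m i : (i.+1)%:R * gb m i.+1 = (m - i%:Z)%:~R * gb m i.
Proof.
rewrite /gbinom big_ord_recr /= factS natrM invfM.
have i0 : (i.+1)%:R != 0 :> K by rewrite pnatr_eq0.
by rewrite mulrCA [_.+1%:R * _]mulrA mulfV// mul1r mulrAC mulrC.
Qed.

Lemma gbinom_pascal m i : gb (m + 1) i.+1 = gb m i.+1 + gb m i.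
Proof.
have i0 : (i.+1)%:R != 0 :> K by rewrite pnatr_eq0.
apply: (mulfI i0); rewrite mulrDr [in RHS]gbinom_absorb.
have -> : (i.+1)%:R * gb (m + 1) i.+1 = (m + 1)%:~R * gb m i.
  rewrite /gbinom big_ord_recl /= subr0 factS natrM invfM.
  rewrite mulrCA [_.+1%:R * _]mulrA mulfV// mul1r -!mulrA; congr (_ * (_ * _)).
  by apply: eq_bigr => j _; congr (_%:~R); rewrite /bump /=; lia.
rewrite -mulrDl; congr (_ * _).
by rewrite -[(i.+1)%:R]/((i.+1)%:Z%:~R) -intrD; congr (_%:~R); lia.
Qed.

Lemma gbinom_nat (n i : nat) : gb n%:Z i = 'C(n, i)%:R.
Proof.
elim: n i => [|n IH] [|i]; rewrite ?gbinom0 ?bin0//.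
  by rewrite /gbinom big_ord_recl subr0 !mul0r bin0n.
have -> : n.+1%:Z = n%:Z + 1 by lia.
by rewrite gbinom_pascal !IH binS natrD.
Qed.

Variable V : lmodType K.
Implicit Types F : nat -> V.

(** The sign e is -1 in expansions of (z1 - z2)^l and 1 in that of (z2 + z0)^m, so that one Pascal
    rule serves both. *)
Definition gsum (e : K) (m : int) F : V :=
  \sum_(i \in [set: nat]) (e ^+ i * gb m i) *: F i.

Lemma evz_scale (c : nat -> K) F : evz F -> evz (fun i => c i *: F i).
Proof. by move=> [k Fk]; exists k => i /Fk->; rewrite scaler0. Qed.

Lemma gsum_pascal e m F : evz F ->
  gsum e (m + 1) F = gsum e m F + e *: gsum e m (fun i => F i.+1).
Proof.
move=> eF; have eFS := evzS eF.
rewrite /gsum nsum_recl; last exact: evz_scale.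
rewrite [in RHS]nsum_recl; last exact: evz_scale.
rewrite !gbinom0 -addrA; congr (_ + _).
rewrite nsum_scale; last exact: evz_scale.
rewrite -nsumD; last 2 first.
- exact: (evz_scale (fun i => e ^+ i.+1 * gb m i.+1)).
- exact/(evz_scale (fun=> e))/evz_scale.
apply: eq_fsbigr => i _; rewrite scalerA -scalerDl; congr (_ *: _).
by rewrite gbinom_pascal mulrDr; congr (_ + _); rewrite exprS -mulrA.
Qed.

Lemma gsum_ext e m F F' : (forall i, F i = F' i) -> gsum e m F = gsum e m F'.
Proof. by move=> h; apply: eq_fsbigr => i _; rewrite h. Qed.

End Binomials.

Section AbstractJacobi.
Variables (K : numFieldType) (V : lmodType K) (Y : V -> int -> V -> V) (vac : V).
Implicit Types (u v w x : V).
Hypothesis linl : forall n v, linear (fun u => Y u n v).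
Hypothesis linr : forall u n, linear (Y u n).
Hypothesis trunc : forall u v, exists N : int, forall n, N <= n -> Y u n v = 0.
Hypothesis vacuum : forall n v, Y vac n v = if n == -1 then v else 0.
Hypothesis creation : forall v, Y v (-1) vac = v /\ forall n : int, 0 <= n -> Y v n vac = 0.
Hypothesis transl : forall u v n,
  Y (Y u n v) (-2) vac = Y u n (Y v (-2) vac) - n%:~R *: Y u (n - 1) v.
Hypothesis locality : forall u v, exists N : nat, forall m n w,
  \sum_(i < N.+1) ((-1) ^+ i * 'C(N, i)%:R) *: Y u (m + (N - i)%N%:Z) (Y v (n + i%:Z) w) =
  \sum_(i < N.+1) ((-1) ^+ i * 'C(N, i)%:R) *: Y v (n + i%:Z) (Y u (m + (N - i)%N%:Z) w).

Let Y0 u n : Y u n 0 = 0. Proof. exact: plin0 (linr u n). Qed.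
Let Y0l n v : Y 0 n v = 0. Proof. exact: plin0 (linl n v). Qed.

Lemma trunc_nat u v (n : int) : evz (fun i : nat => Y u (n + i%:Z) v).
Proof.
by have [N h] := trunc u v; exists (absz (N - n)) => i iN; apply: h; lia.
Qed.

(** In the components of the Jacobi identity, [itA] pairs Y(u, z1) Y(v, z2) with z1^m z2^n (z1 -
    z2)^l, and [itB] pairs Y(v, z2) Y(u, z1) with z1^m z2^n (z2 - z1)^l. The power is expanded in
    nonnegative powers of the variable of the operator that acts first. The iterate gives [itL], and
    [Jac] is the defect. *)
Definition itA u v (l m n : int) w : V :=
  gsum (-1) l (fun i => Y u (m + l - i%:Z) (Y v (n + i%:Z) w)).
Definition itB u v (l m n : int) w : V :=
  gsum (-1) l (fun i => Y v (n + l - i%:Z) (Y u (m + i%:Z) w)).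
Definition itC u v (l m n : int) w : V := itA u v l m n w - (-1) ^ l *: itB u v l m n w.
Definition itL u v (l m n : int) w : V :=
  gsum 1 m (fun i => Y (Y u (l + i%:Z) v) (m + n - i%:Z) w).
Definition Jac u v l m n w := itL u v l m n w - itC u v l m n w.

Lemma evzA u v l m n w : evz (fun i : nat => Y u (m + l - i%:Z) (Y v (n + i%:Z) w)).
Proof. by have [k h] := trunc_nat v w n; exists k => i /h->. Qed.

Lemma evzB u v l m n w : evz (fun i : nat => Y v (n + l - i%:Z) (Y u (m + i%:Z) w)).
Proof. exact: evzA. Qed.

Lemma evzL u v l m n w : evz (fun i : nat => Y (Y u (l + i%:Z) v) (m + n - i%:Z) w).
Proof. by have [k h] := trunc_nat u v l; exists k => i /h->. Qed.

Lemma itA_rec u v l m n w :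
  itA u v (l + 1) m n w = itA u v l (m + 1) n w - itA u v l m (n + 1) w.
Proof.
rewrite /itA gsum_pascal; last exact: evzA.
rewrite scaleN1r; congr (_ - _); apply: gsum_ext => i.
  by congr (Y u _ _); lia.
by congr (Y u _ (Y v _ _)); lia.
Qed.

Lemma itB_rec u v l m n w :
  itB u v (l + 1) m n w = itB u v l m (n + 1) w - itB u v l (m + 1) n w.
Proof.
rewrite /itB gsum_pascal; last exact: evzB.
rewrite scaleN1r; congr (_ - _); apply: gsum_ext => i.
  by congr (Y v _ _); lia.
by congr (Y v _ (Y u _ _)); lia.
Qed.

Lemma itC_rec u v l m n w :
  itC u v (l + 1) m n w = itC u v l (m + 1) n w - itC u v l m (n + 1) w.
Proof.
rewrite /itC itA_rec itB_rec exprzDr ?unitrN1// expr1z mulrN1 scaleNr -scalerN opprB.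
by rewrite scalerBr opprD addrACA -opprD.
Qed.

Lemma itL_rec u v l m n w :
  itL u v (l + 1) m n w = itL u v l (m + 1) n w - itL u v l m (n + 1) w.
Proof.
rewrite /itL gsum_pascal; last exact: evzL.
have -> : gsum 1 m (fun i => Y (Y u (l + i%:Z) v) (m + 1 + n - i%:Z) w) =
    gsum 1 m (fun i => Y (Y u (l + i%:Z) v) (m + (n + 1) - i%:Z) w).
  by apply: gsum_ext => i; congr (Y _ _ w); lia.
rewrite scale1r [X in X - _]addrC addrK; apply: gsum_ext => i.
by congr (Y (Y u _ v) _ w); lia.
Qed.

Lemma Jac_rec u v l m n w :
  Jac u v (l + 1) m n w = Jac u v l (m + 1) n w - Jac u v l m (n + 1) w.
Proof.
by rewrite /Jac itL_rec itC_rec opprD addrACA -opprD.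
Qed.

Lemma itC_nat u v (N : nat) m n w : itC u v N m n w =
  \sum_(i < N.+1) ((-1) ^+ i * 'C(N, i)%:R) *: Y u (m + (N - i)%N%:Z) (Y v (n + i%:Z) w) -
  \sum_(i < N.+1) ((-1) ^+ i * 'C(N, i)%:R) *: Y v (n + i%:Z) (Y u (m + (N - i)%N%:Z) w).
Proof.
rewrite /itC /itA /itB /gsum !(@nsumE _ N.+1) => [|i Ni|i Ni]; last 2 first.
- by rewrite gbinom_nat bin_small// mulr0 scale0r.
- by rewrite gbinom_nat bin_small// mulr0 scale0r.
congr (_ - _).
  apply: eq_bigr => i _; rewrite gbinom_nat; congr (_ *: Y u _ _).
  by have := ltn_ord i; lia.
(* Reversing the second sum, i -> N - i, absorbs the sign (-1)^N and makes both sums run over the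
   same pairs of modes. *)
rewrite scaler_sumr (reindex_inj rev_ord_inj) /=; apply: eq_bigr => i _.
have iN := ltn_ord i; rewrite subSS.
have iN' : (i <= N)%N by lia.
have sgE : (-1) ^+ N * (-1) ^+ (N - i) = (-1) ^+ i :> K.
  rewrite -exprD (_ : (N + (N - i) = i + 2 * (N - i))%N); last by lia.
  by rewrite exprD exprM sqrrN !expr1n mulr1.
rewrite gbinom_nat bin_sub// scalerA mulrA -exprnP sgE.
by congr (_ *: Y v _ _); lia.
Qed.

(** The recursion in l carries the vanishing from N to every larger exponent, so that finitely many
    pairs can later be given a common one. *)
Lemma itC_loc u v : exists N : nat, forall N', (N <= N')%N -> forall m n w,
  itC u v N'%:Z m n w = 0.
Proof.
have [N h] := locality u v; exists N => N' /subnK <-.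
elim: (N' - N)%N => [|d IH] m n w; first by rewrite itC_nat h subrr.
have -> : (d.+1 + N)%N%:Z = (d + N)%N%:Z + 1 by lia.
by rewrite itC_rec !IH subrr.
Qed.

Section Commutant.
Variables (x : V) (P Q : nat).
Notation sg N i := ((-1) ^+ i * 'C(N, i)%:R : K).

(* (z1 - z3)^P (z2 - z3)^Q [T(z1, z2), Y(x, z3)] = 0, by coefficients *)
Definition commutes (T : int -> int -> V -> V) := forall m n r w,
  \sum_(j < P.+1) sg P j *: \sum_(k < Q.+1) sg Q k *:
    T (m + (P - j)%N%:Z) (n + (Q - k)%N%:Z) (Y x (r + j%:Z + k%:Z) w) =
  \sum_(j < P.+1) sg P j *: \sum_(k < Q.+1) sg Q k *:
    Y x (r + j%:Z + k%:Z) (T (m + (P - j)%N%:Z) (n + (Q - k)%N%:Z) w).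

Lemma commutes_sum (T : nat -> int -> int -> V -> V) :
  (forall m n w, evz (fun i => T i m n w)) -> (forall i, commutes (T i)) ->
  commutes (fun m n w => \sum_(i \in [set: nat]) T i m n w).
Proof.
move=> eT cT m n r w.
pose G (j k : nat) i := T i (m + (P - j)%N%:Z) (n + (Q - k)%N%:Z) (Y x (r + j%:Z + k%:Z) w).
pose H (j k : nat) i := Y x (r + j%:Z + k%:Z) (T i (m + (P - j)%N%:Z) (n + (Q - k)%N%:Z) w).
have eG j k : evz (G j k) by exact: eT.
have eH j k : evz (H j k) by have [N h] := eT (m + (P - j)%N%:Z) (n + (Q - k)%N%:Z) w; exists N => i /h e; rewrite /H e.
have key (Z : nat -> nat -> nat -> V) : (forall j k, evz (Z j k)) ->
    \sum_(j < P.+1) sg P j *: (\sum_(k < Q.+1) sg Q k *: \sum_(i \in [set: nat]) Z j k i) =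
    \sum_(i \in [set: nat]) \sum_(j < P.+1) sg P j *: \sum_(k < Q.+1) sg Q k *: Z j k i.
  move=> eZ; pose Z1 (j k : nat) i := sg Q k *: Z j k i.
  have eZ1 j k : evz (Z1 j k) by exact: (evz_scale (fun=> sg Q k)).
  have h1 j : evz (fun i => \sum_(k < Q.+1) Z1 j k i) /\
      \sum_(k < Q.+1) \sum_(i \in [set: nat]) Z1 j k i =
      \sum_(i \in [set: nat]) \sum_(k < Q.+1) Z1 j k i.
    exact: (nsum_sum (index_enum 'I_Q.+1) (fun k : 'I_Q.+1 => eZ1 j k)).
  pose Z2 (j : 'I_P.+1) i := sg P j *: \sum_(k < Q.+1) Z1 j k i.
  have eZ2 j : evz (Z2 j) by apply: (evz_scale (fun=> sg P j)); exact: (h1 j).1.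
  rewrite -[RHS](nsum_sum (index_enum 'I_P.+1) eZ2).2.
  apply: eq_bigr => j _; rewrite /Z2 -nsum_scale; last exact: (h1 j).1.
  rewrite -(h1 j).2; congr (_ *: _); apply: eq_bigr => k _.
  by rewrite nsum_scale.
transitivity (\sum_(j < P.+1) sg P j *: (\sum_(k < Q.+1) sg Q k *: \sum_(i \in [set: nat]) G j k i)).
  by [].
rewrite key//.
transitivity (\sum_(i \in [set: nat]) \sum_(j < P.+1) sg P j *:
    \sum_(k < Q.+1) sg Q k *: H j k i).
  by apply: eq_fsbigr => i _; exact: cT.
rewrite -key//; apply: eq_bigr => j _; congr (_ *: _); apply: eq_bigr => k _.
by congr (_ *: _); rewrite nsum_lin.
Qed.

Lemma commutes_comb (c : K) (T T' : int -> int -> V -> V) :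
  commutes T -> commutes T' -> commutes (fun m n w => T m n w - c *: T' m n w).
Proof.
move=> cT cT' m n r w.
have key (Z Z' : nat -> nat -> V) :
    \sum_(j < P.+1) sg P j *: (\sum_(k < Q.+1) sg Q k *: (Z j k - c *: Z' j k)) =
    \sum_(j < P.+1) sg P j *: (\sum_(k < Q.+1) sg Q k *: Z j k) -
    c *: \sum_(j < P.+1) sg P j *: (\sum_(k < Q.+1) sg Q k *: Z' j k).
  rewrite scaler_sumr -sumrN -big_split; apply: eq_bigr => j _ /=.
  rewrite (scaleCA c) -scalerBr; congr (_ *: _).
  rewrite scaler_sumr -sumrN -big_split; apply: eq_bigr => k _ /=.
  by rewrite (scaleCA c) -scalerBr.
pose t (S : int -> int -> V -> V) (j k : nat) :=
  S (m + (P - j)%N%:Z) (n + (Q - k)%N%:Z) (Y x (r + j%:Z + k%:Z) w).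
pose t' (S : int -> int -> V -> V) (j k : nat) :=
  Y x (r + j%:Z + k%:Z) (S (m + (P - j)%N%:Z) (n + (Q - k)%N%:Z) w).
apply: etrans (key (t T) (t T')) _.
apply: etrans (congr2 (fun a b => a - c *: b) (cT m n r w) (cT' m n r w)) _.
apply: etrans (esym (key (t' T) (t' T'))) _.
apply: eq_bigr => j _; congr (_ *: _).
apply: eq_bigr => k _; congr (_ *: _).
by rewrite /t' (plinB (linr _ _)) (plinZ (linr _ _)).
Qed.

Lemma commutes_scale (c : K) (T : int -> int -> V -> V) :
  commutes T -> commutes (fun m n w => c *: T m n w).
Proof.
move=> cT; have c0 : commutes (fun _ _ _ => 0).
  move=> m n r w; apply: eq_bigr => j _; congr (_ *: _).
  by apply: eq_bigr => k _; rewrite Y0.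
have := commutes_comb (- c) c0 cT; congr commutes.
by apply/funext => m; apply/funext => n; apply/funext => w; rewrite sub0r scaleNr opprK.
Qed.

Hypotheses (u v : V).
Hypothesis locP : forall m n w, itC u x P m n w = 0.

Let locE a (N : nat) : (forall m n w, itC a x N%:Z m n w = 0) -> forall m n w,
  \sum_(i < N.+1) sg N i *: Y a (m + (N - i)%N%:Z) (Y x (n + i%:Z) w) =
  \sum_(i < N.+1) sg N i *: Y x (n + i%:Z) (Y a (m + (N - i)%N%:Z) w).
Proof. by move=> h m n w; apply/eqP; rewrite -subr_eq0 -itC_nat h. Qed.

(** Y(x, z3) is moved past Y(v, z2) by means of the factor with exponent Q, then past Y(u, z1) by
    means of the one with exponent P. The binomial sum that is idle at each move is carried
    along. *)
Lemma commutes_A (locQ : forall m n w, itC v x Q m n w = 0) l :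
  commutes (fun m n w => itA u v l m n w).
Proof.
apply: commutes_sum => [m n w|i]; first exact/evz_scale/evzA.
apply: commutes_scale => m n r w.
transitivity (\sum_(j < P.+1) sg P j *: \sum_(k < Q.+1) sg Q k *:
   Y u (m + (P - j)%N%:Z + l - i%:Z) (Y x (r + j%:Z + k%:Z) (Y v (n + (Q - k)%N%:Z + i%:Z) w))).
  apply: eq_bigr => j _; congr (_ *: _).
  have := congr1 (Y u (m + (P - j)%N%:Z + l - i%:Z)) (locE locQ (n + i%:Z) (r + j%:Z) w).
  rewrite !(plin_sum (linr _ _)) => e.
  transitivity (\sum_(k < Q.+1) Y u (m + (P - j)%N%:Z + l - i%:Z)
     (sg Q k *: Y v (n + i%:Z + (Q - k)%N%:Z) (Y x (r + j%:Z + k%:Z) w))).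
    by apply: eq_bigr => k _; rewrite (plinZ (linr _ _)); congr (_ *: Y u _ (Y v _ _)); lia.
  rewrite e; apply: eq_bigr => k _; rewrite (plinZ (linr _ _)).
  by congr (_ *: Y u _ (Y x _ (Y v _ _))); lia.
have swap (Z : nat -> nat -> V) :
    \sum_(j < P.+1) sg P j *: (\sum_(k < Q.+1) sg Q k *: Z j k) =
    \sum_(k < Q.+1) sg Q k *: (\sum_(j < P.+1) sg P j *: Z j k).
  under eq_bigr do rewrite scaler_sumr.
  rewrite exchange_big; apply: eq_bigr => k _; rewrite scaler_sumr.
  by apply: eq_bigr => j _; rewrite scaleCA.
rewrite (swap (fun j k => Y u (m + (P - j)%N%:Z + l - i%:Z) (Y x (r + j%:Z + k%:Z) (Y v (n + (Q - k)%N%:Z + i%:Z) w)))).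
rewrite (swap (fun j k => Y x (r + j%:Z + k%:Z) (Y u (m + (P - j)%N%:Z + l - i%:Z) (Y v (n + (Q - k)%N%:Z + i%:Z) w)))).
apply: eq_bigr => k _; congr (_ *: _).
have := locE locP (m + l - i%:Z) (r + k%:Z) (Y v (n + (Q - k)%N%:Z + i%:Z) w) => e.
transitivity (\sum_(j < P.+1) sg P j *: Y u (m + l - i%:Z + (P - j)%N%:Z)
    (Y x (r + k%:Z + j%:Z) (Y v (n + (Q - k)%N%:Z + i%:Z) w))).
  by apply: eq_bigr => j _; congr (_ *: Y u _ (Y x _ _)); lia.
rewrite e; apply: eq_bigr => j _.
by congr (_ *: Y x _ (Y u _ _)); lia.
Qed.

Lemma commutes_B (locQ : forall m n w, itC v x Q m n w = 0) l :
  commutes (fun m n w => itB u v l m n w).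
Proof.
apply: commutes_sum => [m n w|i]; first exact/evz_scale/evzB.
apply: commutes_scale => m n r w.
have swap (Z : nat -> nat -> V) :
    \sum_(j < P.+1) sg P j *: (\sum_(k < Q.+1) sg Q k *: Z j k) =
    \sum_(k < Q.+1) sg Q k *: (\sum_(j < P.+1) sg P j *: Z j k).
  under eq_bigr do rewrite scaler_sumr.
  rewrite exchange_big; apply: eq_bigr => k _; rewrite scaler_sumr.
  by apply: eq_bigr => j _; rewrite scaleCA.
rewrite (swap (fun j k => Y v (n + (Q - k)%N%:Z + l - i%:Z) (Y u (m + (P - j)%N%:Z + i%:Z) (Y x (r + j%:Z + k%:Z) w)))).
transitivity (\sum_(k < Q.+1) sg Q k *: \sum_(j < P.+1) sg P j *:
   Y v (n + (Q - k)%N%:Z + l - i%:Z) (Y x (r + j%:Z + k%:Z) (Y u (m + (P - j)%N%:Z + i%:Z) w))).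
  apply: eq_bigr => k _; congr (_ *: _).
  have := congr1 (Y v (n + (Q - k)%N%:Z + l - i%:Z)) (locE locP (m + i%:Z) (r + k%:Z) w).
  rewrite !(plin_sum (linr _ _)) => e.
  transitivity (\sum_(j < P.+1) Y v (n + (Q - k)%N%:Z + l - i%:Z)
     (sg P j *: Y u (m + i%:Z + (P - j)%N%:Z) (Y x (r + k%:Z + j%:Z) w))).
    by apply: eq_bigr => j _; rewrite (plinZ (linr _ _)); congr (_ *: Y v _ (Y u _ (Y x _ _))); lia.
  rewrite e; apply: eq_bigr => j _; rewrite (plinZ (linr _ _)).
  by congr (_ *: Y v _ (Y x _ (Y u _ _))); lia.
rewrite -(swap (fun j k => Y v (n + (Q - k)%N%:Z + l - i%:Z) (Y x (r + j%:Z + k%:Z) (Y u (m + (P - j)%N%:Z + i%:Z) w)))).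
apply: eq_bigr => j _; congr (_ *: _).
have := locE locQ (n + l - i%:Z) (r + j%:Z) (Y u (m + (P - j)%N%:Z + i%:Z) w) => e.
transitivity (\sum_(k < Q.+1) sg Q k *: Y v (n + l - i%:Z + (Q - k)%N%:Z)
    (Y x (r + j%:Z + k%:Z) (Y u (m + (P - j)%N%:Z + i%:Z) w))).
  by apply: eq_bigr => k _; congr (_ *: Y v _ (Y x _ _)); lia.
rewrite e; apply: eq_bigr => k _.
by congr (_ *: Y x _ (Y v _ _)); lia.
Qed.

(** Only the factor (z2 - z3)^Q does work here: the iterate is built from the fields of u_(l + i) v
    in the single variable z2. *)
Lemma commutes_L l
  (locL : forall i : nat, forall m n w, itC (Y u (l + i%:Z) v) x Q m n w = 0) :
  commutes (fun m n w => itL u v l m n w).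
Proof.
apply: commutes_sum => [m n w|i]; first exact/evz_scale/evzL.
move=> m n r w; apply: eq_bigr => j _; congr (_ *: _).
set g := _ * gbinom _ _ _.
have := congr1 (fun z => g *: z)
  (locE (locL i) (m + (P - j)%N%:Z + n - i%:Z) (r + j%:Z) w).
rewrite /= !scaler_sumr => e.
transitivity (\sum_(k < Q.+1) g *: (sg Q k *: Y (Y u (l + i%:Z) v)
    (m + (P - j)%N%:Z + n - i%:Z + (Q - k)%N%:Z) (Y x (r + j%:Z + k%:Z) w))).
  by apply: eq_bigr => k _; rewrite scaleCA; congr (_ *: (_ *: Y _ _ _)); lia.
rewrite e; apply: eq_bigr => k _; rewrite scaleCA (plinZ (linr _ _)).
by congr (_ *: (_ *: Y x _ (Y _ _ _))); lia.
Qed.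

End Commutant.

Lemma D_vac : Y vac (-2) vac = 0.
Proof. by rewrite vacuum. Qed.

Lemma Jac_vac0 u v l (s : int) : -1 <= s -> Jac u v l 0 s vac = 0.
Proof.
move=> s1.
have Lz : itL u v l 0 s vac = Y (Y u l v) s vac.
  rewrite /itL /gsum (@nsumE _ 1) => [|i i1]; last first.
    by rewrite (gbinom_nat K 0) bin0n (_ : (i == 0%N) = false) ?mulr0 ?scale0r//; lia.
  by rewrite big_ord1 gbinom0 expr0 mulr1 scale1r /= addr0 subr0 add0r.
have Bz : itB u v l 0 s vac = 0.
  by apply: nsum0 => i; rewrite (creation u).2 ?Y0 ?scaler0//; lia.
have Az : itA u v l 0 s vac = Y u l (Y v s vac).
  rewrite /itA /gsum (@nsumE _ 1) => [|i i1]; last first.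
    by rewrite (creation v).2 ?Y0 ?scaler0//; lia.
  by rewrite big_ord1 gbinom0 expr0 mulr1 scale1r /= addr0 subr0 add0r.
rewrite /Jac /itC Lz Bz Az scaler0 subr0.
have [->|s0] := eqVneq s (-1); first by rewrite !(creation _).1 subrr.
by rewrite !(creation _).2 ?Y0 ?subrr//; lia.
Qed.

(** Here a -> [Y a (-2) vac] is the translation operator. It kills the vacuum, so by [transl] it
    acts only on the modes, lowering the index. *)
Lemma Jac_vac_D u v l s :
  Y (Jac u v l 0 s vac) (-2) vac = - s%:~R *: Jac u v l 0 (s - 1) vac.
Proof.
have Lz t : itL u v l 0 t vac = Y (Y u l v) t vac.
  rewrite /itL /gsum (@nsumE _ 1) => [|i i1]; last first.
    by rewrite (gbinom_nat K 0) bin0n (_ : (i == 0%N) = false) ?mulr0 ?scale0r//; lia.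
  by rewrite big_ord1 gbinom0 expr0 mulr1 scale1r /= addr0 subr0 add0r.
have Bz t : itB u v l 0 t vac = 0.
  by apply: nsum0 => i; rewrite (creation u).2 ?Y0 ?scaler0//; lia.
have JE t : Jac u v l 0 t vac = Y (Y u l v) t vac - itA u v l 0 t vac.
  by rewrite /Jac /itC Lz Bz scaler0 subr0.
have Dlin : linear (fun a => Y a (-2) vac) := linl (-2) vac.
rewrite !JE (plinB Dlin) transl D_vac Y0 sub0r.
suff -> : Y (itA u v l 0 s vac) (-2) vac = - s%:~R *: itA u v l 0 (s - 1) vac.
  by rewrite [RHS]scalerBr [X in _ = X - _]scaleNr.
pose G (i : nat) := Y u (l - i%:Z) (Y v (s - 1 + i%:Z) vac).
have eG : evz G by have [k h] := trunc_nat v vac (s - 1); exists k => i /h e; rewrite /G e.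
have A1 : itA u v l 0 (s - 1) vac = gsum (-1) l G.
  by apply: gsum_ext => i; rewrite /G; congr (Y u _ _); lia.
have DF i : Y (Y u (0 + l - i%:Z) (Y v (s + i%:Z) vac)) (-2) vac =
    - (s + i%:Z)%:~R *: G i - (l - i%:Z)%:~R *: G i.+1.
  rewrite transl transl D_vac Y0 sub0r (plinN (linr _ _)) (plinZ (linr _ _)) -scaleNr.
  rewrite /G add0r; congr (_ *: _ - _ *: _).
    by congr (Y u _ (Y v _ _)); lia.
  by congr (Y u _ (Y v _ _)); lia.
rewrite A1 {1}/itA /gsum (nsum_lin Dlin); last exact/evz_scale/evzA.
rewrite nsum_scale; last exact: evz_scale.
pose c (i : nat) : K := (-1) ^+ i * gbinom K l i.
have e1 : evz (fun i => (c i * - (s + i%:Z)%:~R) *: G i).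
  exact: (evz_scale (fun i => c i * - (s + i%:Z)%:~R)).
have e2 : evz (fun i => (c i.+1 * (i.+1)%:~R) *: G i.+1).
  exact/(evz_scale (fun i => c i.+1 * (i.+1)%:~R))/evzS.
(* By the absorption rule (i + 1) binom(l, i + 1) = (l - i) binom(l, i), the terms in [G i.+1]
   become the shift of a sum with coefficient i, which cancels the i of s + i. *)
transitivity (\sum_(i \in [set: nat]) ((c i * - (s + i%:Z)%:~R) *: G i +
    (c i.+1 * (i.+1)%:~R) *: G i.+1)).
  apply: eq_fsbigr => i _; rewrite (plinZ Dlin) DF scalerBr !scalerA -scaleNr.
  congr (_ + _ *: _); rewrite /c exprS mulN1r !mulNr; congr (- _).
  have h : gbinom K l i * (l - i%:Z)%:~R = gbinom K l i.+1 * (i.+1)%:~R.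
    by rewrite [LHS]mulrC -gbinom_absorb [LHS]mulrC.
  rewrite -(mulrA ((-1) ^+ i) (gbinom K l i)) h.
  by rewrite (mulrA ((-1) ^+ i) (gbinom K l i.+1)).
rewrite nsumD//.
have e3 : evz (fun i => (c i * i%:~R) *: G i) by exact: (evz_scale (fun i => c i * i%:~R)).
have -> : \sum_(i \in [set: nat]) (c i.+1 * (i.+1)%:~R) *: G i.+1 =
    \sum_(i \in [set: nat]) (c i * i%:~R) *: G i.
  by rewrite [RHS]nsum_recl// mulr0 scale0r add0r.
rewrite -nsumD//; apply: eq_fsbigr => i _.
rewrite -scalerDl scalerA -mulrDr intrD opprD -addrA addNr addr0 mulrC.
by [].
Qed.

(** For s >= -1 this is the creation property. Below that, translation sends the value at s to - s
    times the value at s - 1, and s <= -1 can be divided out. *)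
Lemma Jac_vac u v l (s : int) : Jac u v l 0 s vac = 0.
Proof.
have [s1|s1] := leP (-1) s; first exact: Jac_vac0.
have : s = -1 - (absz (-1 - s)%R)%:Z by lia.
move: (absz (-1 - s)%R) => d; elim: d s {s1} => [|d IH] s ->.
  exact: Jac_vac0.
have := Jac_vac_D u v l (-1 - d%:Z).
rewrite (IH _ erefl) Y0l => /esym /eqP.
rewrite scaler_eq0 oppr_eq0 intr_eq0 (_ : (-1 - d%:Z == 0) = false) /=; last by lia.
have -> : -1 - d.+1%:Z = -1 - d%:Z - 1 by lia.
by move=> /eqP.
Qed.

Lemma Jac_step u v l : (forall m n w, Jac u v (l + 1) m n w = 0) ->
  forall m n w, Jac u v l m n w = 0.
Proof.
move=> h.
have sh m n w : Jac u v l (m + 1) n w = Jac u v l m (n + 1) w.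
  by apply/eqP; rewrite -subr_eq0 -Jac_rec h.
have shk (k : nat) m n w : Jac u v l (m + k%:Z) n w = Jac u v l m (n + k%:Z) w.
  elim: k m n => [|k IH] m n; first by rewrite !addr0.
  have -> : m + k.+1%:Z = m + 1 + k%:Z by lia.
  have -> : n + k.+1%:Z = n + k%:Z + 1 by lia.
  by rewrite IH sh.
have Jac0 m n : Jac u v l m n 0 = 0.
  rewrite /Jac /itC /itL /itA /itB /gsum !nsum0 ?scaler0 ?subrr// => i;
    by rewrite ?Y0 ?scaler0.
have J0 m n w : Jac u v l m n w = Jac u v l 0 (m + n) w.
  have [m0|m0] := leP 0 m.
    have := shk (absz m) 0 n w; rewrite add0r (_ : (absz m)%:Z = m); last by lia.
    by rewrite [n + m]addrC.
  have := shk (absz m) m (m + n) w; rewrite (_ : m + (absz m)%:Z = 0); last by lia.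
  by rewrite (_ : m + n + (absz m)%:Z = n) => [->|]//; lia.
have Jv m n : Jac u v l m n vac = 0 by rewrite J0 Jac_vac.
move=> m n x.
have [P hP] := itC_loc u x; have [Q0 hQ0] := itC_loc v x.
have [k0 hk0] := trunc_nat u v l.
(* A common exponent for the finitely many u_(l + i) v with i < k0; the others vanish. *)
have [Q1 hQ1] : exists Q1 : nat, forall i, (i < k0)%N -> forall Q, (Q1 <= Q)%N ->
    forall m n w, itC (Y u (l + i%:Z) v) x Q m n w = 0.
  elim: k0 {hk0} => [|k [Q1 IH]]; first by exists 0%N.
  have [Q2 h2] := itC_loc (Y u (l + k%:Z) v) x.
  exists (maxn Q1 Q2) => i; rewrite ltnS leq_eqVlt => /orP[/eqP->|ik] Q; rewrite geq_max => /andP[q1 q2].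
    exact: h2.
  exact: IH.
pose Q := maxn Q0 Q1.
have locP := hP P (leqnn P).
have locQ := hQ0 Q (leq_maxl _ _).
have locL (i : nat) m' n' w : itC (Y u (l + i%:Z) v) x Q m' n' w = 0.
  have [ik|ki] := ltnP i k0; first by apply: (hQ1 i ik Q (leq_maxr _ _)).
  rewrite hk0// /itC /itA /itB /gsum nsum0 => [|j]; last by rewrite Y0l scaler0.
  by rewrite nsum0 ?scaler0 ?subrr// => j; rewrite Y0l Y0 scaler0.
have cA := commutes_A locP locQ l.
have cB := commutes_B locP locQ l.
have cL := commutes_L P locL.
have cC : commutes x P Q (fun m n w => itC u v l m n w) by exact: commutes_comb cA cB.
have cJ : commutes x P Q (Jac u v l).
  have := commutes_comb 1 cL cC; congr commutes.
  by apply/funext => m'; apply/funext => n'; apply/funext => w; rewrite scale1r.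
(* The locality relation is applied to the vacuum at r = -1. The side where J acts first is zero. On
   the other side x_i 1 = 0 for i >= 0 leaves only j = k = 0, where x_(-1) 1 = x. The shifts by P
   and Q place this term at (m, n). *)
have e : \sum_(j < P.+1) ((-1) ^+ j * 'C(P, j)%:R) *:
    \sum_(k < Q.+1) ((-1) ^+ k * 'C(Q, k)%:R) *:
    Jac u v l (m - P%:Z + (P - j)%N%:Z) (n - Q%:Z + (Q - k)%N%:Z)
      (Y x (-1 + j%:Z + k%:Z) vac) = 0.
  apply: etrans (cJ (m - P%:Z) (n - Q%:Z) (-1) vac) _.
  apply: big1 => j _; rewrite big1 ?scaler0// => k _.
  by rewrite Jv Y0 scaler0.
rewrite big_ord_recl [X in _ + X]big1 in e; last first.
  move=> j _; rewrite big1 ?scaler0// => k _.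
  rewrite (creation x).2; last by rewrite !lift0; lia.
  by rewrite Jac0 scaler0.
rewrite addr0 big_ord_recl [X in _ + X]big1 in e; last first.
  move=> k _; rewrite (creation x).2; last by rewrite !lift0; lia.
  by rewrite Jac0 scaler0.
rewrite /= addr0 !expr0 !bin0 !mul1r !scale1r !subn0 !addr0 (creation x).1 in e.
by rewrite !subrK in e.
Qed.

Lemma Jac_eq0 u v l m n w : Jac u v l m n w = 0.
Proof.
have [N hN] := itC_loc u v; have [k hk] := trunc_nat u v 0.
(* For l this large, locality kills the commutator side and truncation kills every u_(l + i) v. *)
have base (N' : nat) : (maxn N k <= N')%N -> forall m n w, Jac u v N' m n w = 0.
  rewrite geq_max => /andP[NN' kN'] m' n' w'; rewrite /Jac hN// subr0.
  apply: nsum0 => i; have := hk (N' + i)%N; rewrite add0r => ->; last by lia.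
  by rewrite Y0l scaler0.
suff h (d : nat) : forall l, l + d%:Z = (maxn N k)%:Z -> forall m n w, Jac u v l m n w = 0.
  have [lN|lN] := leP (maxn N k)%:Z l.
    have {1}-> : l = (absz l)%:Z by lia.
    by apply: base; lia.
  by apply: (h (absz ((maxn N k)%:Z - l))); lia.
elim: d => [|d IH] l' e.
  have -> : l' = (maxn N k)%:Z by lia.
  exact: base.
by apply: Jac_step; apply: IH; lia.
Qed.

Lemma jacobi u v w (l m n : int) :
  \sum_(i \in [set: nat])
    (gbinom K m i *: Y (Y u (l + i%:Z) v) (m + n - i%:Z) w) =
  \sum_(i \in [set: nat]) (((-1) ^+ i * gbinom K l i) *:
    (Y u (m + l - i%:Z) (Y v (n + i%:Z) w)
     - (-1) ^ l *: Y v (n + l - i%:Z) (Y u (m + i%:Z) w))).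
Proof.
have /eqP := Jac_eq0 u v l m n w; rewrite subr_eq0 => /eqP e.
transitivity (itL u v l m n w).
  by apply: eq_fsbigr => i _; rewrite expr1n mul1r.
rewrite e /itC -scaleNr /itA /itB /gsum nsum_scale; last exact/evz_scale/evzB.
rewrite -nsumD; last 2 first.
- exact/evz_scale/evzA.
- exact/(evz_scale (fun=> - (-1) ^ l))/evz_scale/evzB.
apply: eq_fsbigr => i _; rewrite scalerBr; congr (_ + _).
by rewrite scaleNr scaleCA.
Qed.

End AbstractJacobi.

(** * Dong's lemma for Gamma-quasi locality *)

Section LinearFactors.
Variables (K : fieldType) (V : lmodType K).
Implicit Types (B : int -> int -> V) (gs : seq K).

(* multiplication by x - g y *)
Definition lfac (g : K) B : int -> int -> V := fun m n => B (m - 1) n - g *: B m (n - 1).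

Definition lfacs gs B := foldr lfac B gs.

Lemma lfac_comm g h B : lfac g (lfac h B) = lfac h (lfac g B).
Proof.
apply/funext => m; apply/funext => n; rewrite /lfac !scalerBr (scaleCA g h) !opprD !addrA.
by congr (_ + _); rewrite addrAC.
Qed.

Lemma lfac_lfacs g gs B : lfac g (lfacs gs B) = lfacs gs (lfac g B).
Proof. by elim: gs => //= h gs IH; rewrite lfac_comm IH. Qed.

Lemma lfacs_cat gs hs B : lfacs (gs ++ hs) B = lfacs gs (lfacs hs B).
Proof. exact: foldr_cat. Qed.

Lemma lfacs_catC gs hs B : lfacs (gs ++ hs) B = lfacs (hs ++ gs) B.
Proof.
rewrite !lfacs_cat; elim: gs => //= g gs IH.
by rewrite IH lfac_lfacs.
Qed.

Lemma lfacs_lin c gs B B' m n : lfacs gs (fun m n => c *: B m n + B' m n) m n =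
  c *: lfacs gs B m n + lfacs gs B' m n.
Proof.
elim: gs m n => //= g gs IH m n; rewrite /lfac !IH !scalerBr !scalerDr (scaleCA g).
by rewrite opprD !addrA; congr (_ + _); rewrite addrAC.
Qed.

Lemma lfacs0 gs B m n : (forall m n, B m n = 0) -> lfacs gs B m n = 0.
Proof.
move=> B0; elim: gs m n => [|g gs IH] m n; first exact: B0.
by rewrite /= /lfac !IH scaler0 subr0.
Qed.

Lemma lfacs_catl gs hs B : (forall m n, lfacs gs B m n = 0) ->
  forall m n, lfacs (hs ++ gs) B m n = 0.
Proof. by move=> h m n; rewrite lfacs_cat lfacs0. Qed.

Lemma lfacs_catr gs hs B : (forall m n, lfacs gs B m n = 0) ->
  forall m n, lfacs (gs ++ hs) B m n = 0.
Proof. by move=> h m n; rewrite lfacs_catC lfacs_catl. Qed.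

Lemma lfacs_map (al : V -> V) gs B m n : linear al ->
  lfacs gs (fun m n => al (B m n)) m n = al (lfacs gs B m n).
Proof.
move=> lin; elim: gs m n => //= g gs IH m n.
by rewrite /lfac !IH (plinB lin) (plinZ lin).
Qed.

Lemma lfacs_ylo gs B N : (forall m n, n < N -> B m n = 0) ->
  forall m n, n < N -> lfacs gs B m n = 0.
Proof.
move=> BN; elim: gs => //= g gs IH m n nN.
by rewrite /lfac !IH ?scaler0 ?subr0//; lia.
Qed.

Lemma lfacs_xlo gs B N : (forall m n, m < N -> B m n = 0) ->
  forall m n, m < N -> lfacs gs B m n = 0.
Proof.
move=> BN; elim: gs => //= g gs IH m n nN.
by rewrite /lfac !IH ?scaler0 ?subr0//; lia.
Qed.

(** Since x - g y = - g (y - g^-1 x), exchanging the variables inverts the roots. This is how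
    inverses in Gamma enter [gql_sym]. *)
Lemma lfacs_tr gs B : (forall g, g \in gs -> g != 0) -> exists c, c != 0 /\
  forall m n, lfacs gs B m n =
    c *: lfacs [seq g^-1 | g <- gs] (fun n m => B m n) n m.
Proof.
elim: gs => [|g gs IH] gs0; first by exists 1; split=> [|m n]; rewrite ?oner_neq0 ?scale1r.
have [|c [c0 e]] := IH; first by move=> h hg; apply: gs0; rewrite inE hg orbT.
have g0 := gs0 g (mem_head _ _).
exists (- g * c); split; first by rewrite mulf_neq0// oppr_eq0.
move=> m n; rewrite /= {1}/lfac !e /lfac scalerBr !scalerA !mulNr !scaleNr opprK.
by rewrite mulrAC mulfV// mul1r addrC.
Qed.

Definition diag (s : int) B : int -> V := fun m => B m (s - m).

(** On the line m + n = s, a polynomial in x / y acts as a polynomial in one variable. Each factor x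
    - g y, unlike x / y - g, raises the total degree by one, hence the shift by [size gs]. *)
Lemma diag_lfacs gs s B m :
  diag (s + (size gs)%:Z) (lfacs gs B) m = pact (\prod_(g <- gs) ('X - g%:P)) (diag s B) m.
Proof.
elim: gs m => [|g gs IH] m; first by rewrite big_nil pact1l addr0.
rewrite big_cons pactM.
have -> : pact ('X - g%:P) (pact (\prod_(g0 <- gs) ('X - g0%:P)) (diag s B)) m =
    pact (\prod_(g0 <- gs) ('X - g0%:P)) (diag s B) (m - 1)
    - g *: pact (\prod_(g0 <- gs) ('X - g0%:P)) (diag s B) m.
  by rewrite -polyCN -['X]mul1r pact_ind pact1l scaleNr.
rewrite -!IH /diag /= /lfac; congr (lfacs _ _ _ _ - _ *: lfacs _ _ _ _); lia.
Qed.

End LinearFactors.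

Section OperatorFactors.
Variables (K F : fieldType) (V : lmodType F) (e : K -> F) (la : F).
Implicit Types (f : int -> V) (gs : seq K).

(* multiplication by la - g t *)
Definition ofac (g : K) f : int -> V := fun k => la *: f k - e g *: f (k - 1).
Definition ofacs gs f := foldr ofac f gs.

Lemma ofac_lin c f f' g k : ofac g (fun k => c *: f k + f' k) k = c *: ofac g f k + ofac g f' k.
Proof.
rewrite /ofac scalerBr !scalerDr (scaleCA la) (scaleCA (e g)) opprD !addrA.
by congr (_ + _); rewrite addrAC.
Qed.

Lemma ofacs_lin c f f' gs k :
  ofacs gs (fun k => c *: f k + f' k) k = c *: ofacs gs f k + ofacs gs f' k.
Proof.
elim: gs k => //= g gs IH k; rewrite -ofac_lin /ofac !IH.
by [].
Qed.

Lemma ofacs0 gs f k : (forall k, f k = 0) -> ofacs gs f k = 0.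
Proof.
move=> f0; elim: gs k => [|g gs IH] k; first exact: f0.
by rewrite /= /ofac !IH !scaler0 subr0.
Qed.

Lemma ofac_comm g h f : ofac g (ofac h f) = ofac h (ofac g f).
Proof.
apply/funext => k; rewrite /ofac !scalerBr (scaleCA (e g) la) (scaleCA (e h) la) (scaleCA (e g) (e h)).
by rewrite !opprD !addrA; congr (_ + _); rewrite addrAC.
Qed.

Lemma ofacs_catC gs hs f : ofacs (gs ++ hs) f = ofacs (hs ++ gs) f.
Proof.
rewrite /ofacs !foldr_cat; elim: gs => //= g gs ->.
by elim: hs => //= h hs IH; rewrite ofac_comm IH.
Qed.

Lemma ofacs_catl gs hs f : (forall k, ofacs gs f k = 0) ->
  forall k, ofacs (hs ++ gs) f k = 0.
Proof. by move=> h k; rewrite /ofacs foldr_cat; exact: ofacs0. Qed.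

Lemma ofacs_catr gs hs f : (forall k, ofacs gs f k = 0) ->
  forall k, ofacs (gs ++ hs) f k = 0.
Proof. by move=> h k; rewrite ofacs_catC ofacs_catl. Qed.

Lemma ofacs_scale c gs f k : ofacs gs (fun k => c *: f k) k = c *: ofacs gs f k.
Proof.
elim: gs k => //= g gs IH k; rewrite /ofac !IH (scaleCA la) (scaleCA (e g)).
by rewrite scalerBr.
Qed.

End OperatorFactors.

Section IndependentFactors.
Variables (K : fieldType) (V : lmodType K).
Implicit Types (B : int -> int -> V) (rs gs : seq K).

Lemma lfacs_shift rs B m k :
  lfacs rs (fun m k => B m (k - 1)) m k = lfacs rs B m (k - 1).
Proof. by elim: rs m k => //= y ys IH m k; rewrite /lfac !IH. Qed.

(** The two families of factors share only the variable of [k]. Applying the second one combines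
    shifts of families that the first already kills, and the first commutes with these shifts. *)
Lemma lfacs_indep rs gs (g : int -> int -> int -> V) :
  (forall j m k, lfacs rs (fun m k => g m j k) m k = 0) ->
  forall j m k, lfacs rs (fun m k => lfacs gs (fun j k => g m j k) j k) m k = 0.
Proof.
move=> hg; elim: gs => [|x gs IH] j m k; first exact: hg.
have -> : (fun m k => lfacs (x :: gs) (fun j k => g m j k) j k) =
    (fun m k => (- x) *: lfacs gs (fun j k => g m j k) j (k - 1) +
        lfacs gs (fun j k => g m j k) (j - 1) k).
  by apply/funext => m'; apply/funext => k'; rewrite /= /lfac scaleNr addrC.
rewrite (lfacs_lin (- x) rs (fun m k => lfacs gs (fun j k => g m j k) j (k - 1))).
rewrite IH addr0.
by rewrite (lfacs_shift rs (fun m k => lfacs gs (fun j k => g m j k) j k)) IH scaler0.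
Qed.

End IndependentFactors.

Section Dong.
Variables (K : numFieldType) (W : lmodType K) (p : laurent K).
Hypothesis p_neq0 : p != 0.
Variable Gam : set K.
Hypothesis Gam_neq0 : forall g, Gam g -> g != 0.
Hypothesis GamV : forall g, Gam g -> Gam g^-1.
Notation L := (laurent K).
Implicit Types (a b c : distr W) (gs : seq K).

Definition inGam gs := forall g, g \in gs -> Gam g.

Lemma inGam_cat gs hs : inGam gs -> inGam hs -> inGam (gs ++ hs).
Proof. by move=> h h' g; rewrite mem_cat => /orP[/h|/h']. Qed.

Definition lkills gs a b := forall w m n,
  lfacs gs (fun m n => distr_comm a b m n w) m n = 0.

Definition gql a b := exists gs, inGam gs /\ lkills gs a b.

Lemma gql_sym a b : gql a b -> gql b a.
Proof.
move=> [gs [gsG h]]; have gs0 g : g \in gs -> g != 0 by move=> /gsG/Gam_neq0.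
exists [seq g^-1 | g <- gs]; split=> [g /mapP[g' /gsG/GamV g'G ->]//|w m n].
have [c [c0 e]] := lfacs_tr (fun m n => distr_comm a b m n w) gs0.
have := h w n m; rewrite e => /eqP; rewrite scaler_eq0 (negbTE c0) /= => /eqP e0.
have -> : (fun m n => distr_comm b a m n w) =
    (fun m n => -1 *: distr_comm a b n m w + 0).
  by apply/funext => i; apply/funext => j; rewrite /distr_comm scaleN1r opprB addr0.
rewrite (lfacs_lin (-1) _ (fun m n => distr_comm a b n m w) (fun _ _ => 0)).
by rewrite e0 scaler0 add0r lfacs0.
Qed.

Definition lpoly2 gs : {poly {poly K}} := \prod_(g <- gs) ('X - (g *: 'X)%:P).

Lemma lpoly2_neq0 gs : lpoly2 gs != 0.
Proof.
rewrite /lpoly2; elim: gs => [|g gs IH]; first by rewrite big_nil oner_neq0.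
by rewrite big_cons mulf_neq0// polyXsubC_eq0.
Qed.

Lemma pact_lpoly2 gs (G : int -> lser W) m n :
  pact (lq (lpoly2 gs)) G m n = lfacs gs (fun m n => G m n) m n.
Proof.
elim: gs m n => [|g gs IH] m n.
  by rewrite /lpoly2 big_nil lq1 pact1l.
rewrite /lpoly2 big_cons lqM pactM -/(lpoly2 gs).
have -> : lq ('X - (g *: 'X)%:P) = 'X - (lpoly (g *: 'X))%:P.
  by rewrite /lq rmorphB /= map_polyX map_polyC.
have -> : lpoly (g *: 'X) = lmonom 1 1 * lconst g.
  by rewrite -mul_polyC lpolyMX lpolyC.
have -> : pact ('X - (lmonom 1 1 * lconst g)%:P) (pact (lq (lpoly2 gs)) G) m =
    pact (lq (lpoly2 gs)) G (m - 1) - lmonom 1 1 *: (lconst g *: pact (lq (lpoly2 gs)) G m).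
  by rewrite -polyCN -['X]mul1r pact_ind pact1l scaleNr scalerA.
by rewrite lserB lscale_monom lscale_const !IH.
Qed.

Lemma lkills_kills gs a b : in_EW a -> in_EW b -> lkills gs a b -> kills (lpoly2 gs) a b.
Proof.
move=> aE bE h w m; apply: eq_lser => n; rewrite pact_lpoly2.
have -> : (fun m n => scoef (commv a b w m) n) = (fun m n => distr_comm a b m n w).
  by apply/funext => i; apply/funext => j; rewrite zrowE//; exact: rowb_comm.
exact: h.
Qed.

Lemma gql_ql a b : in_EW a -> in_EW b -> gql a b -> ql a b.
Proof.
move=> aE bE [gs [_ /(lkills_kills aE bE) h]]; exists (lpoly2 gs).
by apply/qlocalP => //; split=> //; exact: lpoly2_neq0.
Qed.

Lemma gql_idr a : in_EW a -> gql a (id_distr W).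
Proof.
move=> aE; exists [::]; split=> // w m n /=; rewrite /distr_comm /id_distr.
by case: ifP => _; rewrite ?(distr0 _ aE) subrr.
Qed.

Lemma gql_lin (c : K) a b e : in_EW a -> in_EW b -> in_EW e -> gql a e -> gql b e ->
  gql (c *: a + b) e.
Proof.
move=> aE bE eE [gs [gsG h]] [hs [hsG h']]; exists (gs ++ hs); split.
  exact: inGam_cat.
move=> w m n.
have -> : (fun m n => distr_comm (c *: a + b) e m n w) =
    (fun m n => c *: distr_comm a e m n w + distr_comm b e m n w).
  apply/funext => i; apply/funext => j; rewrite /distr_comm.
  rewrite -[(c *: a + b) i _]/(c *: a i (e j w) + b i (e j w)).
  rewrite -[(c *: a + b) i w]/(c *: a i w + b i w).
  by rewrite (plinD (eE.1 j)) (plinZ (eE.1 j)) scalerBr opprD addrACA.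
by rewrite lfacs_lin (lfacs_catr _ (h w)) (lfacs_catl _ (h' w)) scaler0 addr0.
Qed.

Section Peel.
Variable I : Type.
Implicit Types (G : I -> int -> lser W) (H : I -> int -> lser (lser W)).

(* products of factors z - g t and phi(z, z0) - g t; zzf is zf on series in z0 *)
Definition zf := ofacs (V := lser W) (@lconst K) (zL K).
Definition phif := ofacs (V := lser (lser W)) (fun g => lconst (lconst g)) (phi p).
Definition zzf := ofacs (V := lser (lser W)) (fun g => lconst (lconst g)) (lconst (zL K)).

(** One list has to serve all indices i: in the application i is the vector w, on which the factors
    in a relation of Gamma-quasi locality may not depend. *)
Definition killed G := exists gs, inGam gs /\ forall i k, zf gs (G i) k = 0.

Lemma killed_lin (c : L) G G' : killed G -> killed G' ->
  killed (fun i k => c *: G i k + G' i k).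
Proof.
move=> [gs [gsG h]] [hs [hsG h']]; exists (gs ++ hs); split; first exact: inGam_cat.
move=> i k; rewrite /zf ofacs_lin.
by rewrite (ofacs_catr _ (h i)) (ofacs_catl _ (h' i)) scaler0 addr0.
Qed.

Lemma killed_ext G G' : (forall i k, G i k = G' i k) -> killed G -> killed G'.
Proof.
by move=> e; congr killed; apply/funext => i; apply/funext => k.
Qed.

Lemma killed0 : killed (fun _ _ => 0).
Proof. by exists [::]. Qed.

Lemma killed_sum (r : seq int) (c : int -> L) (F : int -> I -> int -> lser W) :
  (forall h, h \in r -> killed (F h)) ->
  killed (fun i k => \sum_(h <- r) c h *: F h i k).
Proof.
elim: r => [|h r IH] hF.
  by apply: killed_ext killed0 => i k; rewrite big_nil.
apply: (@killed_ext (fun i k => c h *: F h i k + \sum_(h <- r) c h *: F h i k)).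
  by move=> i k; rewrite big_cons.
apply: killed_lin; first exact: hF (mem_head _ _).
by apply: IH => h' h'r; apply: hF; rewrite inE h'r orbT.
Qed.

(* phi(z, z0) - g t = (z - g t) + O(z0), so that the coefficients in z0 can be handled
   one after the other, starting from the lowest one. *)
Lemma peel g N H : Gam g -> (forall i k n, n < N -> H i k n = 0) ->
  (forall n, killed (fun i k => phif [:: g] (H i) k n)) ->
  forall n, killed (fun i k => H i k n).
Proof.
move=> gG HN hk n.
suff h (d : nat) : forall n, n < N + d%:Z -> killed (fun i k => H i k n).
  by apply: (h (absz (n - N + 1)%R)); lia.
elim: d => [|d IH] {}n nd.
  by apply: killed_ext killed0 => i k; rewrite HN//; lia.
have E i k : zf [:: g] (fun k => H i k n) k = phif [:: g] (H i) k n -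
    \sum_(h <- zrange 1 (absz (n - N))) phi p h *: H i k (n - h).
  rewrite -[LHS]/(zL K *: H i k n - lconst g *: H i (k - 1) n).
  rewrite -[phif _ _ _]/(phi p *: H i k - lconst (lconst g) *: H i (k - 1)).
  rewrite lserB lscale_const lscaleE.
  rewrite (@fsum_seq _ (0 :: zrange 1 (absz (n - N)))).
  - by rewrite big_cons subr0 phi0 [X in _ = X - _]addrAC addrK.
  - by rewrite /= zrange_uniq mem_zrange.
  - move=> h; rewrite inE mem_zrange negb_or => /andP[h0 hN].
    have [hneg|hpos] := ltP h 0; first by rewrite phi_pos// scale0r.
    by rewrite HN ?scaler0//; lia.
have kS : killed (fun i k => \sum_(h <- zrange 1 (absz (n - N))) phi p h *: H i k (n - h)).
  apply: (@killed_sum _ (phi p) (fun h i k => H i k (n - h))) => h.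
  by rewrite mem_zrange => hr; apply: IH; lia.
have [gs [gsG hgs]] : killed (fun i k => zf [:: g] (fun k => H i k n) k).
  apply: (killed_ext _ (killed_lin (-1) kS (hk n))) => i k.
  by rewrite E scaleN1r [LHS]addrC.
exists (gs ++ [:: g]); split.
  by apply: inGam_cat => // h; rewrite inE => /eqP->.
by move=> i k; rewrite /zf /ofacs foldr_cat; exact: hgs.
Qed.

Lemma phif_lo gs N H : (forall i k n, n < N -> H i k n = 0) ->
  forall i k n, n < N -> phif gs (H i) k n = 0.
Proof.
move=> HN; elim: gs => [|g gs IH] i k n nN; first exact: HN.
have IH1 := IH i k; have IH2 := IH i (k - 1) n nN.
have -> : phif (g :: gs) (H i) k =
    phi p *: phif gs (H i) k - lconst (lconst g) *: phif gs (H i) (k - 1) by [].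
move: {IH HN} (phif gs (H i) k) (phif gs (H i) (k - 1)) IH1 IH2 => X X' IH1 IH2.
have e1 : (lconst (lconst g) *: X') n = 0.
  by rewrite (lscale_const (lconst g) X' n) IH2 scaler0.
have e2 : (phi p *: X) n = 0.
  by apply: (@lscale_lo _ _ (phi p) X 0 N (@phi_pos _ p) IH1); lia.
by rewrite (lserB (phi p *: X)) e1 e2 subr0.
Qed.

Lemma peels gs N H : inGam gs -> (forall i k n, n < N -> H i k n = 0) ->
  (forall n, killed (fun i k => phif gs (H i) k n)) ->
  forall n, killed (fun i k => H i k n).
Proof.
move=> + HN; elim: gs => //= g gs IH gG h.
apply: IH; first by move=> g' g'gs; apply: gG; rewrite inE g'gs orbT.
apply: (@peel g N (fun i => phif gs (H i))) => //.
  by apply: gG; rewrite mem_head.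
exact: phif_lo.
Qed.

Lemma zzf_coef gs (f : int -> lser (lser W)) k n :
  zzf gs f k n = zf gs (fun k => f k n) k.
Proof.
elim: gs k => // g gs IH k.
rewrite -[LHS]/((lconst (zL K) *: zzf gs f k - lconst (lconst g) *: zzf gs f (k - 1)) n).
rewrite -[RHS]/(zL K *: zf gs (fun k => f k n) k - lconst g *: zf gs (fun k => f k n) (k - 1)).
by rewrite lserB (lscale_const (zL K)) (lscale_const (lconst g)) (IH k) (IH (k - 1)).
Qed.

Lemma killed_factors rs ss N H : inGam rs -> inGam ss ->
  (forall i k n, n < N -> H i k n = 0) ->
  (forall i k, phif rs (zzf ss (H i)) k = 0) ->
  forall n, killed (fun i k => H i k n).
Proof.
move=> rsG ssG HN h n.
have lo i k m : m < N -> zzf ss (H i) k m = 0.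
  by move=> mN; rewrite zzf_coef; apply: ofacs0 => k'; exact: HN.
have [gs [gsG hgs]] : killed (fun i k => zzf ss (H i) k n).
  apply: (peels rsG lo) => m.
  by apply: killed_ext killed0 => i k; rewrite h.
exists (gs ++ ss); split; first exact: inGam_cat.
move=> i k; rewrite /zf /ofacs foldr_cat -/(zf ss _) -/(zf gs _) -(hgs i k).
by congr (zf gs _ k); apply/funext => k'; rewrite zzf_coef.
Qed.

End Peel.

Section DongProof.
(** Multiplication by x - g t, and in [zfac] by z - g t, where [G k m] in W((z)) is the coefficient
    of t^k x^m. After x = phi(z, z0) these become the factors of [phif] and [zzf]. *)
Definition xfac (g : K) (G : int -> int -> lser W) k m := G k (m - 1) - lconst g *: G (k - 1) m.
Definition zfac (g : K) (G : int -> int -> lser W) k m := zL K *: G k m - lconst g *: G (k - 1) m.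

Lemma xfacE g G k m j : xfac g G k m j = G k (m - 1) j - g *: G (k - 1) m j.
Proof. by rewrite lserB lscale_const. Qed.

Lemma zfacE g G k m j : zfac g G k m j = G k m (j - 1) - g *: G (k - 1) m j.
Proof. by rewrite lserB lscale_monom lscale_const. Qed.

Variable q : {poly {poly K}}.

Definition Tq (G : int -> int -> lser W) k : lser (lser W) :=
  T p (fun m => pact (lq q) (G k) m).

Definition bdq (G : int -> int -> lser W) := forall k, bounded2 (fun m => pact (lq q) (G k) m).

Lemma pact_xfac g G k m : pact (lq q) (xfac g G k) m =
  pact (lq q) (G k) (m - 1) - lconst g *: pact (lq q) (G (k - 1)) m.
Proof. by rewrite pactBr pactZr pact_shift. Qed.

Lemma pact_zfac g G k m : pact (lq q) (zfac g G k) m =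
  zL K *: pact (lq q) (G k) m - lconst g *: pact (lq q) (G (k - 1)) m.
Proof. by rewrite pactBr !pactZr. Qed.

Lemma bounded2_scale (f : L) (B : int -> lser W) : bounded2 (fun m => B m) ->
  bounded2 (fun m => f *: B m).
Proof.
move=> bB; have := bounded2_pact f%:P bB.
by congr bounded2; apply/funext => m; rewrite pactC.
Qed.

Lemma bounded2_sub (B B' : int -> lser W) : bounded2 (fun m => B m) ->
  bounded2 (fun m => B' m) -> bounded2 (fun m => B m - B' m).
Proof.
move=> [N h] [N' h']; exists (Num.min N N') => m n mn.
by rewrite lserB h ?h' ?subr0//; lia.
Qed.

Lemma Tq_xfac g G k : bdq G -> bdq (xfac g G) /\
  Tq (xfac g G) k = phi p *: Tq G k - lconst (lconst g) *: Tq G (k - 1).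
Proof.
move=> bG.
have b1 k' := bounded2_shift 1 (bG k').
have b2 k' := bounded2_scale (lconst g) (bG (k' - 1)).
split=> [k'|].
  have [N h] := bounded2_sub (b1 k') (b2 k').
  by exists N => m n mn; rewrite pact_xfac; exact: h.
rewrite /Tq -(T_shift p (bG k)) -(T_scale p (lconst g) (bG (k - 1))).
rewrite -(T_sub p (b1 k) (b2 k)).
by apply: T_ext => m n; rewrite pact_xfac.
Qed.

Lemma Tq_zfac g G k : bdq G -> bdq (zfac g G) /\
  Tq (zfac g G) k = lconst (zL K) *: Tq G k - lconst (lconst g) *: Tq G (k - 1).
Proof.
move=> bG.
have b1 k' := bounded2_scale (zL K) (bG k').
have b2 k' := bounded2_scale (lconst g) (bG (k' - 1)).
split=> [k'|].
  have [N h] := bounded2_sub (b1 k') (b2 k').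
  by exists N => m n mn; rewrite pact_zfac; exact: h.
rewrite /Tq -(T_scale p (zL K) (bG k)) -(T_scale p (lconst g) (bG (k - 1))).
rewrite -(T_sub p (b1 k) (b2 k)).
by apply: T_ext => m n; rewrite pact_zfac.
Qed.

Lemma Tq_xfacs rs G : bdq G -> bdq (foldr xfac G rs) /\
  forall k, Tq (foldr xfac G rs) k = phif rs (Tq G) k.
Proof.
move=> bG; elim: rs => //= g rs [b1 e1]; split=> [|k].
  exact: (Tq_xfac g 0 b1).1.
by rewrite (Tq_xfac g k b1).2 !e1.
Qed.

Lemma Tq_zfacs rs G : bdq G -> bdq (foldr zfac G rs) /\
  forall k, Tq (foldr zfac G rs) k = zzf rs (Tq G) k.
Proof.
move=> bG; elim: rs => //= g rs [b1 e1]; split=> [|k].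
  exact: (Tq_zfac g 0 b1).1.
by rewrite (Tq_zfac g k b1).2 !e1.
Qed.

End DongProof.

Lemma dong a b c n : in_EW a -> in_EW b -> in_EW c -> ql a b -> gql a c -> gql b c ->
  gql (nprod p a n b) c.
Proof.
move=> aE bE cE qab [rs [rsG hr]] [ss [ssG hs]].
have [q /(qlocalP _ aE bE)[qn0 qk]] := qab.
(* [H] is [Y(a, z0) b, c(t)] and [G] below is [a(x) b(z), c(t)], both applied to w, with k the power
   of t. By [QH], substitution in q G gives H multiplied by q(phi(z, z0), z). *)
pose H w k : lser (lser W) := Yv p a b (c k w) - lsmap (lsmap (c k)) (Yv p a b w).
have c1 k : lsmap (c k) 0 = 0 := plin0 (lsmap_linear (cE.1 k)).
pose G w k m : lser W := prodv a b (c k w) m - lsmap (c k) (prodv a b w m).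
have GE w k m j : G w k m j = a m (b j (c k w)) - c k (a m (b j w)).
  by rewrite lserB prodvE// lsmapE ?distr0// prodvE.
have pB v := prod_bounded v aE bE qk.
have pG w k m : pact (lq q) (G w k) m = pact (lq q) (prodv a b (c k w)) m -
    lsmap (c k) (pact (lq q) (prodv a b w) m).
  by rewrite pactBr (pact_lin _ _ _ (lsmap_linear (cE.1 k))).
have bc w k : bounded2 (fun m => lsmap (c k) (pact (lq q) (prodv a b w) m)).
  by have [N h] := pB w; exists N => m j mj; rewrite lsmapE ?distr0// h// distr0.
have bG w : bdq q (G w).
  move=> k; have := bounded2_sub (pB (c k w)) (bc w k).
  by congr bounded2; apply/funext => m; rewrite pG.
have QH w k : poly_phi p q *: H w k = Tq q (G w) k.
  have Y1 := Yv_spec p_neq0 (c k w) aE bE qab qn0 qk.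
  have Y2 := Yv_spec p_neq0 w aE bE qab qn0 qk.
  have lin2 := lsmap_linear (lsmap_linear (cE.1 k)).
  rewrite /H scalerBr Y1 -(plinZ lin2) Y2 -(T_map p_neq0 (cE.1 k) (pB w)).
  have e2 : T p (fun m n => c k (pact (lq q) (prodv a b w) m n)) =
      T p (fun m => lsmap (c k) (pact (lq q) (prodv a b w) m)).
    by apply: T_ext => m j; rewrite lsmapE// distr0.
  rewrite e2 -(T_sub p (pB (c k w)) (bc w k)); apply: T_ext => m j.
  by rewrite pG.
have G0 w k m : foldr xfac (foldr zfac (G w) ss) rs k m = 0.
  pose g3 (k m j : int) := a m (b j (c k w)) - c k (a m (b j w)).
  have zE k' m' j : foldr zfac (G w) ss k' m' j =
      lfacs ss (fun j k => g3 k m' j) j k'.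
    elim: ss {hs ssG} k' m' j => [|g ss IH] k' m' j; first exact: GE.
    by rewrite [LHS]zfacE !IH.
  have xE k' m' j : foldr xfac (foldr zfac (G w) ss) rs k' m' j =
      lfacs rs (fun m k => lfacs ss (fun j k => g3 k m j) j k) m' k'.
    elim: rs {hr rsG} k' m' j => [|g rs IH] k' m' j; first exact: zE.
    by rewrite [LHS]xfacE !IH.
  apply: eq_lser => j; rewrite xE.
  (* This is [a b, c] = a [b, c] + [a, c] b. The factors of [ss] kill the first term and those of
     [rs] the second. *)
  have g3E k' m' j' : g3 k' m' j' =
      1 *: a m' (distr_comm b c j' k' w) + distr_comm a c m' k' (b j' w).
    by rewrite scale1r /distr_comm /g3 (plinB (aE.1 m')) addrA subrK.
  have -> : (fun m k => lfacs ss (fun j k => g3 k m j) j k) =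
      (fun m k => lfacs ss (fun j k => distr_comm a c m k (b j w)) j k).
    apply/funext => m'; apply/funext => k'.
    have -> : (fun j k => g3 k m' j) = (fun j k => 1 *: a m' (distr_comm b c j k w) +
        distr_comm a c m' k (b j w)).
      by apply/funext => j'; apply/funext => k''; exact: g3E.
    rewrite (lfacs_lin 1 ss (fun j k => a m' (distr_comm b c j k w))).
    by rewrite (lfacs_map _ _ _ _ (aE.1 m')) hs distr0// scaler0 add0r.
  by apply: (@lfacs_indep _ _ rs ss (fun m j k => distr_comm a c m k (b j w))) => j' m' k'; exact: hr.
(* The value of q at phi is a nonzero scalar that commutes with all the factors, so it can be
   cancelled. *)
have H0 w k : phif rs (zzf ss (H w)) k = 0.
  apply: (scalerI (poly_phi_neq0 p_neq0 qn0)); rewrite scaler0.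
  have [bz ez] := Tq_zfacs ss (bG w); have [bx ex] := Tq_xfacs rs bz.
  have e1 : (fun k => poly_phi p q *: zzf ss (H w) k) = Tq q (foldr zfac (G w) ss).
    apply/funext => k'; rewrite ez; apply: etrans (esym (ofacs_scale _ _ _ _ _ _)) _.
    by rewrite -(funext (QH w)).
  apply: etrans (esym (ofacs_scale _ _ _ _ _ _)) _.
  apply: etrans (congr1 (fun f => phif rs f k) e1) _.
  apply: etrans (esym (ex k)) _; apply: T_eq0 => m j.
  by rewrite pact0r// => i; exact: G0.
have [N hN] := Yv_lo p a b.
have HN w k j : j < N -> H w k j = 0.
  by move=> jN; rewrite lserB hN// lsmapE// hN// c1 subr0.
have [gs [gsG hgs]] := killed_factors rsG ssG HN H0 (- n - 1).
exists gs; split=> // w m k.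
have nE := nprod_EW p_neq0 n aE bE qab.
have := congr1 (fun f : lser W => f m) (hgs w k); rewrite lser0 => <-.
have zE (f : int -> lser W) : forall m k, zf gs f k m = lfacs gs (fun m k => f k m) m k.
  elim: gs {gsG hgs} => // g gs IH m' k'.
  rewrite -[zf _ _ _]/(zL K *: zf gs f k' - lconst g *: zf gs f (k' - 1)).
  by rewrite lserB lscale_monom lscale_const (IH (m' - 1)) (IH m').
rewrite zE; congr (lfacs gs _ m k); apply/funext => m'; apply/funext => k'.
have -> : H w k' (- n - 1) m' = Yv p a b (c k' w) (- n - 1) m' -
    lsmap (lsmap (c k')) (Yv p a b w) (- n - 1) m' by [].
rewrite (lsmapE (Yv p a b w) _ (c1 k')) (lsmapE _ _ (distr0 k' cE)).
by rewrite /distr_comm !nprodE.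
Qed.

End Dong.

(** * The generated space *)

Section Levels.
Variables (K : numFieldType) (W : lmodType K) (p : laurent K).
Hypothesis p_neq0 : p != 0.
Variable Gam : set K.
Hypothesis Gam_neq0 : forall g, Gam g -> g != 0.
Hypothesis GamV : forall g, Gam g -> Gam g^-1.
Implicit Types (a b : distr W) (U : set (distr W)).

Definition step U : set (distr W) := fun x => exists a b, [/\ U a, U b &
  (exists c, x = c *: a + b) \/ (exists n : int, x = nprod p a n b)].

Definition good U := U `<=` @in_EW _ W /\
  forall a b, U a -> U b -> gql Gam a b.

(** [dong] handles products in the first argument only; [gql_sym] lets [half] be applied once for
    each argument. *)
Lemma step_good U : good U -> good (step U).
Proof.
move=> [UE Uq].
have sE : step U `<=` @in_EW _ W.
  move=> x [a [b [Ua Ub [[c ->]|[n ->]]]]]; first exact: EW_lin (UE _ Ua) (UE _ Ub).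
  have abq := gql_ql (UE _ Ua) (UE _ Ub) (Uq _ _ Ua Ub).
  exact: (nprod_EW p_neq0 n (UE _ Ua) (UE _ Ub) abq).
have half y : in_EW y -> (forall a, U a -> gql Gam a y) -> forall x, step U x -> gql Gam x y.
  move=> yE yq x [a [b [Ua Ub [[c ->]|[n ->]]]]].
    exact: gql_lin (UE _ Ua) (UE _ Ub) yE (yq _ Ua) (yq _ Ub).
  have abq := gql_ql (UE _ Ua) (UE _ Ub) (Uq _ _ Ua Ub).
  exact: (dong p_neq0 n (UE _ Ua) (UE _ Ub) yE abq (yq _ Ua) (yq _ Ub)).
split=> // x y Ux Uy; apply: (half y (sE _ Uy) _ x Ux) => a Ua.
apply: gql_sym => //; apply: (half a (UE _ Ua) _ y Uy) => b Ub.
exact: Uq.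
Qed.

Variable S : set (distr W).
Hypothesis S_good : good S.

Fixpoint level n : set (distr W) :=
  if n is m.+1 then step (level m) else fun a => S a \/ a = id_distr W.

Lemma level_good n : good (level n).
Proof.
elim: n => [|n IH]; last exact: step_good.
have [SE Sq] := S_good; have idE : in_EW (id_distr W) := EW_id W.
split=> [a [/SE|->]//|a b [Sa|->] [Sb|->]].
- exact: Sq.
- exact: gql_idr (SE _ Sa).
- by apply: gql_sym => //; exact: gql_idr (SE _ Sb).
- exact: gql_idr.
Qed.

Lemma level_mono m n : (m <= n)%N -> level m `<=` level n.
Proof.
move=> /subnK <-; elim: (n - m)%N => // d IH a /IH la.
by exists a, a; split=> //; left; exists 0; rewrite scale0r add0r.
Qed.

Lemma level_pair a b : (exists n, level n a) -> (exists n, level n b) ->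
  exists n, level n a /\ level n b.
Proof.
move=> [m la] [n lb]; exists (maxn m n).
by split; [apply: level_mono la|apply: level_mono lb]; rewrite ?leq_maxl ?leq_maxr.
Qed.

Lemma levels_closed : closed_quasi_local_subspace p [set a | exists n, level n a].
Proof.
have lin c a b : (exists n, level n a) -> (exists n, level n b) ->
    exists n, level n (c *: a + b).
  move=> la lb; have [n [na nb]] := level_pair la lb; exists n.+1, a, b.
  by split=> //; left; exists c.
have lid : exists n, level n (id_distr W) by exists 0%N; right.
split.
- by move=> a [n na]; have [h _] := level_good n; exact: h.
- split=> [|c a b]; rewrite -!topredE /= !in_setE /=; last exact: lin.
  by have := lin (-1) _ _ lid lid; rewrite scaleN1r addNr.
- move=> a b /= la lb; have [n [na nb]] := level_pair la lb.
  have [h hq] := level_good n.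
  exact: gql_ql (h _ na) (h _ nb) (hq _ _ na nb).
- move=> a b m /= la lb; have [n [na nb]] := level_pair la lb; exists n.+1, a, b.
  by split=> //; right; exists m.
Qed.

(** The union of the levels is itself one of the subspaces that are intersected, and each of these
    contains every level. *)
Lemma generated_level a : generated p S a <-> exists n, level n a.
Proof.
split=> [h|[n]].
  apply: (h [set a | exists n, level n a]); split; first exact: levels_closed.
  - by move=> b Sb; exists 0%N; left.
  - by exists 0%N; right.
move=> na U [[UE [_ Ulin] _ Un] SU Uid]; elim: n a na => [|n IH] a.
  by move=> [/SU|->].
move=> [b [c [/IH Ub /IH Uc [[d ->]|[m ->]]]]]; last exact: Un.
by have := Ulin d b c; rewrite -!topredE /= !in_setE; exact.
Qed.

Lemma generated_closed : closed_quasi_local_subspace p (generated p S).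
Proof.
have -> : generated p S = [set a | exists n, level n a].
  by apply/seteqP; split=> a /generated_level.
exact: levels_closed.
Qed.

Lemma generated_gql a b : generated p S a -> generated p S b -> gql Gam a b.
Proof.
move=> /generated_level la /generated_level lb.
have [n [na nb]] := level_pair la lb; have [_ hq] := level_good n.
exact: hq.
Qed.

Lemma generated_ind (P : set (distr W)) : S `<=` P -> P (id_distr W) ->
  (forall c a b, generated p S a -> generated p S b -> P a -> P b -> P (c *: a + b)) ->
  (forall n a b, generated p S a -> generated p S b -> P a -> P b -> P (nprod p a n b)) ->
  generated p S `<=` P.
Proof.
move=> SP Pid Plin Pn a /generated_level[n]; elim: n a => [|n IH] a.
  by move=> [/SP|->].
move=> [b [c [Ub Uc h]]].
have gb : generated p S b by apply/generated_level; exists n.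
have gc : generated p S c by apply/generated_level; exists n.
by case: h => [[d ->]|[m ->]]; [apply: Plin|apply: Pn] => //; exact: IH.
Qed.

End Levels.

(** * Polynomials in z1 / z2 and linear factors *)

Section RatioFactors.
Variables (K : numClosedFieldType) (W : lmodType K).
Implicit Types (A : distr2 W) (gs : seq K).

(** Dividing each factor z1 - g z2 by z2 lowers the power of z2 by [size gs] in all. *)
Lemma ratio_mul_lfacs gs A m n w : ratio_mul (\prod_(g <- gs) ('X - g%:P)) A m n w =
  lfacs gs (fun m n => A m n w) m (n + (size gs)%:Z).
Proof.
have := diag_lfacs gs (m + n) (fun m n => A m n w) m.
rewrite /diag (_ : m + n + (size gs)%:Z - m = n + (size gs)%:Z); last lia.
move=> ->; rewrite /pact /ratio_mul; apply: eq_bigr => i _.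
by rewrite (_ : m + n - (m - i%:Z) = n + i%:Z) //; lia.
Qed.

(** Over an algebraically closed field a monic polynomial is the product of its linear factors,
    which turns [gamma_quasi_local] into vanishing under [lfacs]. *)
Lemma poly_roots_in_prod (Gam : set K) q : poly_roots_in Gam q ->
  exists2 gs, inGam Gam gs & q = \prod_(g <- gs) ('X - g%:P).
Proof.
move=> [mq rq]; have [gs e] := closed_field_poly_normal q.
move: e; rewrite (monicP mq) scale1r => e; exists gs => // g gs_g.
by apply: rq; rewrite e root_prod_XsubC.
Qed.

Lemma poly_roots_in_factors (Gam : set K) gs : inGam Gam gs ->
  poly_roots_in Gam (\prod_(g <- gs) ('X - g%:P)).
Proof.
by move=> gsG; split=> [|g]; [exact: monic_prod_XsubC|rewrite root_prod_XsubC => /gsG].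
Qed.

End RatioFactors.

(** * Covariance under dilations *)

Section Dilation.
Variables (K : numFieldType) (W : lmodType K).
Notation L := (laurent K).
Implicit Types (a b : distr W) (f : lser W).

(** Rescaling coefficients by a multiplicative [u], together with a map semilinear over [s], is
    semilinear for the scalars rescaled in the same way. It is used for z -> lam z and, one level
    up, for [sigma]. *)
Lemma lscale_twist (F : fieldType) (V : lmodType F) (s : F -> F) (al : V -> V)
    (u : int -> F) (c c' : laurent F) (x x' y' : lser V) :
  {morph al : v w / v + w} -> (forall d v, al (d *: v) = s d *: al v) ->
  (forall i j, u (i + j) = u i * u j) ->
  (forall i, c' i = u i * s (c i)) -> (forall i, x' i = u i *: al (x i)) ->
  (forall i, y' i = u i *: al ((c *: x) i)) -> y' = c' *: x'.
Proof.
move=> alD alZ uD c'E x'E y'E.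
have al0 : al 0 = 0 by apply: (addrI (al 0)); rewrite -alD !addr0.
have s0 v : s 0 *: al v = 0 by rewrite -alZ scale0r.
have [N cN] := laurentP c; have [M xM] := lserP x.
apply: eq_lser => n; rewrite y'E !lscaleE.
have lo i : i < N -> c i *: x (n - i) = 0 by move=> /cN->; rewrite scale0r.
have hi i : n - M + 1 <= i -> c i *: x (n - i) = 0.
  by move=> h; rewrite xM ?scaler0//; lia.
have e i : u n *: al (c i *: x (n - i)) = c' i *: x' (n - i).
  rewrite alZ c'E x'E !scalerA; congr (_ *: _).
  by rewrite [RHS]mulrAC -uD [i + _]addrC subrK.
rewrite (fsum_box lo hi) (big_morph al alD al0) scaler_sumr.
rewrite (@fsum_box _ N (n - M + 1)) => [|i iN|i iM].
- by apply: eq_bigr => i _; exact: e.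
- by rewrite -e lo// al0 scaler0.
- by rewrite -e hi// al0 scaler0.
Qed.

Lemma scale_twistX (F : pzRingType) (M : lmodType F) (s : M -> M) (f c : F) :
  (forall x, s (f *: x) = c *: (f *: s x)) -> GRing.comm f c ->
  forall i x, s (f ^+ i *: x) = c ^+ i *: (f ^+ i *: s x).
Proof.
move=> h fc; elim=> [|i IH] x; first by rewrite !expr0 !scale1r.
rewrite exprSr -scalerA IH h !scalerA; congr (_ *: _).
rewrite exprSr -!mulrA; congr (_ * _); rewrite !mulrA; congr (_ * _).
exact: commr_sym (commrX i (commr_sym fc)).
Qed.

Variable lam : K.
Hypothesis lam0 : lam != 0.

Fact sdil_bdd f : bounded_below (fun n => lam ^ n *: f n).
Proof. by have [N h] := lserP f; exists N => n /h->; rewrite scaler0. Qed.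

Definition sdil f : lser W := mk_lser (sdil_bdd f).

Lemma sdilD : {morph sdil : f g / f + g}.
Proof. by move=> f g; apply: eq_lser => n; exact: scalerDr. Qed.

Lemma sdil0 : sdil 0 = 0.
Proof. by apply: eq_lser => n; exact: scaler0. Qed.

Lemma sdilZ (c : L) f : sdil (c *: f) = ldil lam c *: sdil f.
Proof.
apply: (@lscale_twist _ _ id id (fun n => lam ^ n) c (ldil lam c) f) => //.
by move=> i j; rewrite expfzDr.
Qed.

Lemma ldil_const c : ldil lam (lconst c) = lconst c.
Proof.
apply: eq_laurent => n; rewrite /= /lconst /=.
by have [->|_] := eqVneq n 0; rewrite ?mul1r// mulr0n mulr0.
Qed.

Lemma sdil_const c f : sdil (lconst c *: f) = lconst c *: sdil f.
Proof. by rewrite sdilZ ldil_const. Qed.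

Lemma EW_dil a : in_EW a -> in_EW (dil lam a).
Proof.
move=> aE; split=> [n c u v|w].
  by rewrite /dil (aE.1 n) scalerDr (scaleCA (lam ^ n)).
by have [N h] := aE.2 w; exists N => n /h; rewrite /dil => ->; rewrite scaler0.
Qed.

Lemma prodv_dil a b w m : in_EW a -> in_EW b ->
  prodv (dil lam a) (dil lam b) w m = lconst (lam ^ m) *: sdil (prodv a b w m).
Proof.
move=> aE bE; apply: eq_lser => n; have aE' := EW_dil aE; have bE' := EW_dil bE.
rewrite prodvE// (lscale_const (lam ^ m)).
have -> : sdil (prodv a b w m) n = lam ^ n *: prodv a b w m n by [].
by rewrite prodvE// /dil (plinZ (aE.1 m)).
Qed.

Lemma commv_dil a b w m : in_EW a -> in_EW b ->
  commv (dil lam a) (dil lam b) w m = lconst (lam ^ m) *: sdil (commv a b w m).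
Proof.
move=> aE bE; apply: eq_lser => n; have aE' := EW_dil aE; have bE' := EW_dil bE.
rewrite commvE// (lscale_const (lam ^ m)).
have -> : sdil (commv a b w m) n = lam ^ n *: commv a b w m n by [].
rewrite commvE// /dil (plinZ (aE.1 m)) (plinZ (bE.1 n)).
by rewrite (scaleCA (lam ^ n) (lam ^ m)) -!scalerBr.
Qed.

(* q(lam x, lam z) *)
Definition twist (q : {poly L}) : {poly L} :=
  \poly_(i < size q) (lconst (lam ^ i%:Z) * ldil lam q`_i).

Definition dilp (r : {poly K}) : {poly K} := \poly_(j < size r) (lam ^ j%:Z * r`_j).
Definition dilpp (q : {poly {poly K}}) : {poly {poly K}} :=
  \poly_(i < size q) ((lam ^ i%:Z) *: dilp q`_i).

Lemma dilp_coef r j : (dilp r)`_j = lam ^ j%:Z * r`_j.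
Proof. by rewrite coef_poly; case: ltnP => // h; rewrite nth_default ?mulr0. Qed.

Lemma dilp0 : dilp 0 = 0.
Proof. by apply/polyP => j; rewrite dilp_coef !coef0 mulr0. Qed.

Lemma dilpp_coef q i : (dilpp q)`_i = (lam ^ i%:Z) *: dilp q`_i.
Proof. by rewrite coef_poly; case: ltnP => // h; rewrite nth_default// dilp0 scaler0. Qed.

Lemma lpoly_dilp r : lpoly (dilp r) = ldil lam (lpoly r).
Proof.
by apply: eq_laurent => -[n|n] /=; rewrite ?dilp_coef// mulr0.
Qed.

Lemma dilpp_neq0 q : q != 0 -> dilpp q != 0.
Proof.
apply: contra_neq => e; apply/polyP => i; apply/polyP => j; rewrite !coef0.
have := congr1 (fun q : {poly {poly K}} => q`_i`_j) e.
rewrite dilpp_coef coefZ dilp_coef !coef0 => /eqP.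
by rewrite !mulf_eq0 !expfz_eq0 (negbTE lam0) !andbF /= => /eqP.
Qed.

Lemma ldil0 : ldil lam (0 : L) = 0.
Proof. by apply: eq_laurent => n; exact: mulr0. Qed.

Lemma lq_dilpp q : lq (dilpp q) = twist (lq q).
Proof.
apply/polyP => i; rewrite [LHS]lq_coef dilpp_coef [RHS]coef_poly (lq_coef q i).
rewrite -mul_polyC rmorphM /= lpolyC lpoly_dilp.
case: ltnP => // h; have := lq_coef q i; rewrite nth_default// => <-.
by rewrite ldil0 mulr0.
Qed.

Lemma pact_twist (q : {poly L}) (G G' : int -> lser W) :
  (forall m, G' m = lconst (lam ^ m) *: sdil (G m)) ->
  forall m, pact (twist q) G' m = lconst (lam ^ m) *: sdil (pact q G m).
Proof.
move=> h m; rewrite (@pactE _ _ (size q)); last exact: size_poly.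
rewrite /pact (big_morph sdil sdilD sdil0) scaler_sumr; apply: eq_bigr => i _.
rewrite coef_poly ltn_ord h sdilZ !scalerA; congr (_ *: _).
rewrite mulrAC -rmorphM /= -expfzDr// [i%:Z + _]addrC subrK.
by [].
Qed.

Lemma kills_dil q a b : in_EW a -> in_EW b -> kills q a b ->
  kills (dilpp q) (dil lam a) (dil lam b).
Proof.
move=> aE bE qk w m; rewrite lq_dilpp.
rewrite (@pact_twist _ (commv a b w)) => [|i]; last exact: commv_dil.
by rewrite qk sdil0 scaler0.
Qed.

Lemma ql_dil a b : in_EW a -> in_EW b -> ql a b -> ql (dil lam a) (dil lam b).
Proof.
move=> aE bE [q /(qlocalP _ aE bE)[qn0 qk]]; exists (dilpp q).
apply/qlocalP; [exact: EW_dil|exact: EW_dil|split; first exact: dilpp_neq0].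
exact: kills_dil.
Qed.

End Dilation.

Section Covariance.
Variables (K : numFieldType) (W : lmodType K) (p : laurent K) (chi d : K).
Hypotheses (p_neq0 : p != 0) (chi0 : chi != 0) (d0 : d != 0).
Hypothesis cov : phi_covariant p chi d.
Notation L := (laurent K).
Let lam := d^-1.
Implicit Types (a b : distr W) (f : lser W) (B : int -> int -> W) (X : lser (lser W)).

Lemma lam_neq0 : lam != 0. Proof. by rewrite invr_eq0. Qed.

Lemma ldil_phi n : ldil lam (phi p n) = lconst (lam * chi ^ n) * phi p n.
Proof.
have h := cov n; rewrite rmorphM /= -mulrA h mulrA -rmorphM /=.
by rewrite /lam mulVf// rmorph1 mul1r.
Qed.

(** The coefficient of z0 in the covariance of phi. It makes p d/dz commute with z -> lam z up to
    the factor chi^-1. *)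
Lemma ldil_p : ldil lam p = lconst (lam * chi) * p.
Proof. by have := ldil_phi 1; rewrite phi1. Qed.

Lemma sderiv_sdil f : sderiv (sdil lam f) = lconst lam *: sdil lam (sderiv f).
Proof.
apply: eq_lser => n; rewrite (lscale_const lam).
have -> : sdil lam (sderiv f) n = lam ^ n *: ((n + 1)%:~R *: f (n + 1)) by [].
have -> : sderiv (sdil lam f) n = (n + 1)%:~R *: (lam ^ (n + 1) *: f (n + 1)) by [].
rewrite !scalerA; congr (_ *: _).
by rewrite expfzDr ?lam_neq0// expr1z; ring.
Qed.

Lemma Ds_sdil f : Ds p (sdil lam f) = lconst chi^-1 *: sdil lam (Ds p f).
Proof.
rewrite /Ds sderiv_sdil (sdilZ lam_neq0) ldil_p !scalerA; congr (_ *: _).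
rewrite mulrA -rmorphM /= mulrCA mulVf// mulr1 mulrC.
by [].
Qed.

Definition dil2 B : int -> int -> W := fun m n => lam ^ (m + n) *: B m n.

Lemma dil2_bdd N B : bdd2 N B -> bdd2 N (dil2 B).
Proof. by move=> h m n /h e; rewrite /dil2 e scaler0. Qed.

Lemma Dx_dil c B : bounded2 B ->
  Dx p (fun m n => c *: dil2 B m n) = fun m n => (c / chi) *: dil2 (Dx p B) m n.
Proof.
move=> bB; apply/funext => m; apply/funext => n; rewrite /Dx.
have bB' : bounded2 (dil2 B) by have [N h] := bB; exists N; exact: dil2_bdd.
have -> : colx (fun m n => c *: dil2 B m n) n = lconst (c * lam ^ n) *: sdil lam (colx B n).
  apply: eq_lser => i; rewrite colxE; last exact: bounded2Z.
  rewrite (lscale_const (c * lam ^ n)).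
  have -> : sdil lam (colx B n) i = lam ^ i *: colx B n i by [].
  rewrite colxE// /dil2 !scalerA expfzDr ?lam_neq0//; congr (_ *: _); ring.
rewrite Ds_const Ds_sdil (lscale_const (c * lam ^ n)) (lscale_const chi^-1).
have -> : sdil lam (Ds p (colx B n)) m = lam ^ m *: Ds p (colx B n) m by [].
by rewrite /dil2 !scalerA expfzDr ?lam_neq0//; congr (_ *: _); ring.
Qed.

Lemma iter_Dx_dil j B : bounded2 B ->
  iter j (Dx p) (dil2 B) = fun m n => (chi ^- j) *: dil2 (iter j (Dx p) B) m n.
Proof.
move=> bB; elim: j => [|j IH].
  by apply/funext => m; apply/funext => n; rewrite expr0 invr1 scale1r.
rewrite !iterS IH Dx_dil; last exact: bounded2_iter.
by rewrite exprSr invfM mulrC.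
Qed.

Lemma Delta_dil c B k : bounded2 B ->
  Delta (fun m n => c *: dil2 B m n) k = (c * lam ^ k) *: Delta B k.
Proof.
move=> [N BN]; rewrite /Delta (@fsum_scale _ _ _ N (k - N + 1)) => [|i iN|i iM].
- by apply: eq_fsbigr => i _; rewrite /dil2 scalerA [i + _]addrC subrK.
- by apply: BN; rewrite iN.
- by apply: BN; lia.
Qed.

(** This is X(lam z, chi^-1 z0). Covariance reads phi(lam z, chi^-1 z0) = lam phi(z, z0), so it is
    what B(x, z) -> B(lam x, lam z) becomes after substitution. *)
Definition sigma X : lser (lser W) :=
  to_lser (fun n => lconst (chi^-1 ^ n) *: sdil lam (X n)).

Lemma sigmaE X n : sigma X n = lconst (chi^-1 ^ n) *: sdil lam (X n).
Proof.
rewrite to_lserE//; have [N h] := lserP X; exists N => i /h->.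
by rewrite sdil0 scaler0.
Qed.

Lemma sigmaD : {morph sigma : X Y / X + Y}.
Proof. by move=> X Y; apply: eq_lser => n; rewrite lserD !sigmaE lserD sdilD scalerDr. Qed.

Lemma sigma0 : sigma 0 = 0.
Proof. by apply: eq_lser => n; rewrite sigmaE !lser0 sdil0 scaler0. Qed.

Lemma sigmaZ (c c' : laurent L) X :
  (forall n, c' n = lconst (chi^-1 ^ n) * ldil lam (c n)) ->
  sigma (c *: X) = c' *: sigma X.
Proof.
move=> c'E; apply: (@lscale_twist L (lser W) (ldil lam) (sdil lam)
  (fun n => lconst (chi^-1 ^ n)) c c' X).
- exact: sdilD.
- exact: (sdilZ lam_neq0).
- by move=> i j; rewrite expfzDr ?invr_eq0// rmorphM.
- exact: c'E.
- exact: sigmaE.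
- exact: sigmaE.
Qed.

Lemma sigma_const (c : L) X : sigma (lconst c *: X) = lconst (ldil lam c) *: sigma X.
Proof.
apply: sigmaZ => n; have e (x : L) : lconst x n = x *+ (n == 0) by [].
rewrite !e; have [->|_] := eqVneq n 0; first by rewrite !mulr1n expr0z rmorph1 mul1r.
by rewrite !mulr0n ldil0 mulr0.
Qed.

Lemma sigma_phi X : sigma (phi p *: X) = lconst (lconst lam) *: (phi p *: sigma X).
Proof.
rewrite scalerA; apply: sigmaZ => n.
rewrite ldil_phi mulrA -rmorphM /= mulrCA -expfzMl mulVf// exp1rz mulr1.
by rewrite -(lconst_mulE _ (phi p)).
Qed.

Lemma sigma_phiX i X :
  sigma (phi p ^+ i *: X) = (lconst (lconst lam) ^+ i) *: (phi p ^+ i *: sigma X).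
Proof. by apply: scale_twistX; [exact: sigma_phi|exact: mulrC]. Qed.

Lemma evphi_wide n (q : {poly L}) : (size q <= n)%N ->
  evphi p q = \sum_(i < n) lconst q`_i * phi p ^+ i.
Proof.
move=> qn; rewrite /evphi (@horner_coef_wide _ n); last first.
  by rewrite (leq_trans (size_poly _ _)).
by apply: eq_bigr => i _; rewrite coef_map.
Qed.

Lemma sigma_evphi (q : {poly L}) X :
  sigma (evphi p q *: X) = evphi p (twist lam q) *: sigma X.
Proof.
rewrite (evphi_wide (leqnn _)) scaler_suml (big_morph sigma sigmaD sigma0).
rewrite (@evphi_wide (size q)); last exact: size_poly.
rewrite scaler_suml; apply: eq_bigr => i _.
have -> : (twist lam q)`_i = lconst (lam ^+ i) * ldil lam q`_i.
  by rewrite coef_poly ltn_ord.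
have -> : lconst (lconst (lam ^+ i) * ldil lam q`_i) =
    lconst (ldil lam q`_i) * lconst (lconst lam) ^+ i.
  by rewrite rmorphM /= (rmorphXn (@lconst K)) (rmorphXn (@lconst L)) /= mulrC.
rewrite -(scalerA (lconst q`_i)) sigma_const sigma_phiX.
move: (lconst (ldil lam q`_i)) (lconst (lconst lam) ^+ i) (phi p ^+ i) (sigma X).
by move=> c1 c2 c3 Z; rewrite !scalerA.
Qed.

Lemma T_dil2 B : bounded2 B -> T p (dil2 B) = sigma (T p B).
Proof.
move=> bB; apply: eq_lser => n; rewrite sigmaE; case: n => j; last first.
  by rewrite !T_pos// sdil0 scaler0.
have bB' : bounded2 (dil2 B) by have [N h] := bB; exists N; exact: dil2_bdd.
rewrite -[T p _ _]/(Tc p j (dil2 B)) -[T p B _]/(Tc p j B) /Tc.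
rewrite (sdil_const lam_neq0) [RHS](scaleCA (lconst (chi^-1 ^ j))); congr (_ *: _).
apply: eq_lser => k; rewrite (lscale_const (chi^-1 ^ j)).
have -> : sdil lam (DeltaL (iter j (Dx p) B)) k =
  lam ^ k *: DeltaL (iter j (Dx p) B) k by [].
rewrite !DeltaLE; try exact: bounded2_iter.
by rewrite iter_Dx_dil// Delta_dil ?scalerA -?exprVn//; exact: bounded2_iter.
Qed.

Lemma Yv_dil a b w : in_EW a -> in_EW b -> ql a b ->
  Yv p (dil lam a) (dil lam b) w = sigma (Yv p a b w).
Proof.
move=> aE bE abq; have [q /(qlocalP _ aE bE)[qn0 qk]] := abq.
have aE' := EW_dil lam aE; have bE' := EW_dil lam bE.
have abq' := ql_dil lam_neq0 aE bE abq.
have qk' := kills_dil lam_neq0 aE bE qk.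
apply/esym/(Yv_unique p_neq0 aE' bE' abq' (dilpp_neq0 lam_neq0 qn0) qk').
rewrite poly_phiE (lq_dilpp lam) -sigma_evphi -poly_phiE Yv_spec//.
rewrite -T_dil2; last exact: prod_bounded.
apply: T_ext => m n.
have h i : prodv (dil lam a) (dil lam b) w i = lconst (lam ^ i) *: sdil lam (prodv a b w i).
  exact: prodv_dil.
rewrite (pact_twist lam_neq0 (lq q) h) (lscale_const (lam ^ m)).
have -> : sdil lam (pact (lq q) (prodv a b w) m) n =
  lam ^ n *: pact (lq q) (prodv a b w) m n by [].
by rewrite scalerA -expfzDr// lam_neq0.
Qed.

Lemma nprod_dil a b n : in_EW a -> in_EW b -> ql a b ->
  dil lam (nprod p a n b) = (chi ^ (- n - 1)) *: nprod p (dil lam a) n (dil lam b).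
Proof.
move=> aE bE abq; apply/funext => m; apply/funext => w.
rewrite -[RHS]/(chi ^ (- n - 1) *: nprod p (dil lam a) n (dil lam b) m w).
rewrite -[LHS]/(lam ^ m *: nprod p a n b m w) (nprodE p n m w aE bE abq).
rewrite (nprodE p n m w (EW_dil lam aE) (EW_dil lam bE) (ql_dil lam_neq0 aE bE abq)).
rewrite Yv_dil// sigmaE.
rewrite (lscale_const (chi^-1 ^ (- n - 1))) scalerA -expfzMl mulfV//.
by rewrite exp1rz scale1r.
Qed.

End Covariance.

(** * The vertex algebra and its module *)

Section GeneratedVertexAlgebra.
Variables (K : numFieldType) (W : lmodType K) (p : laurent K) (S : set (distr W)).
Hypotheses (p_neq0 : p != 0) (S_closed : closed_quasi_local_subspace p (generated p S)).
Notation V := (generated_space p S).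
Implicit Types u v w : V.

Lemma generated_predE a : (a \in generated_pred p S) = (a \in generated p S).
Proof. by []. Qed.

Lemma gval_generated v : generated p S (gval v).
Proof. by have := valP v; rewrite generated_predE in_setE. Qed.

Fact mem_generated a : generated p S a -> a \in generated_pred p S.
Proof. by rewrite generated_predE in_setE. Qed.

Definition mk_gen a (h : generated p S a) : V := GeneratedSpace (mem_generated h).

Lemma gval_EW v : in_EW (gval v).
Proof. by have [h _ _ _] := S_closed; apply: h; exact: gval_generated. Qed.

Lemma gval_ql u v : ql (gval u) (gval v).
Proof. by have [_ _ h _] := S_closed; apply: h; exact: gval_generated. Qed.

Lemma generated_nprod u n v : generated p S (nprod p (gval u) n (gval v)).
Proof. by have [_ _ _ h] := S_closed; apply: h; exact: gval_generated. Qed.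

Lemma generated_id : generated p S (id_distr W).
Proof. by move=> U []. Qed.

Definition Yg u n v : V := mk_gen (generated_nprod u n v).
Definition vacg : V := mk_gen generated_id.

Lemma gval_linear : linear (@gval K W p S).
Proof. by []. Qed.

Lemma Yg_linl n v : linear (fun u => Yg u n v).
Proof.
move=> c u u'; apply: val_inj; rewrite /= (nprod_linl p_neq0) //;
  do ?exact: gval_EW; do ?exact: gval_ql.
exact: (gval_ql (c *: u + u') v).
Qed.

Lemma Yg_linr u n : linear (Yg u n).
Proof.
move=> c v v'; apply: val_inj; rewrite /= (nprod_linr p_neq0) //;
  do ?exact: gval_EW; do ?exact: gval_ql.
exact: (gval_ql u (c *: v + v')).
Qed.

Lemma Yg_trunc u v : exists N : int, forall n, N <= n -> Yg u n v = 0.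
Proof.
have [N h] := nprod_trunc p (gval_EW u) (gval_EW v) (gval_ql u v).
by exists N => n /h e; apply: val_inj.
Qed.

Lemma Yg_vacuum n v : Yg vacg n v = if n == -1 then v else 0.
Proof.
apply: val_inj; rewrite /= nprod_idl//; last exact: gval_EW.
by case: ifP.
Qed.

Lemma Yg_creation v : Yg v (-1) vacg = v /\ forall n : int, 0 <= n -> Yg v n vacg = 0.
Proof.
have [h1 _ h3] := nprod_idr p_neq0 (gval_EW v).
by split=> [|n /h3 e]; apply: val_inj.
Qed.

Lemma Yg_transl u v n :
  Yg (Yg u n v) (-2) vacg = Yg u n (Yg v (-2) vacg) - n%:~R *: Yg u (n - 1) v.
Proof.
apply: val_inj; rewrite /=.
have [_ e2 _] := nprod_idr p_neq0 (gval_EW (Yg u n v)).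
have [_ e2' _] := nprod_idr p_neq0 (gval_EW v).
by rewrite e2 e2' Dd_nprod//; [exact: gval_EW|exact: gval_EW|exact: gval_ql].
Qed.

Lemma Yg_locality u v : exists N : nat, forall m n w,
  \sum_(i < N.+1) ((-1) ^+ i * 'C(N, i)%:R) *: Yg u (m + (N - i)%N%:Z) (Yg v (n + i%:Z) w) =
  \sum_(i < N.+1) ((-1) ^+ i * 'C(N, i)%:R) *: Yg v (n + i%:Z) (Yg u (m + (N - i)%N%:Z) w).
Proof.
have [q /(qlocalP _ (gval_EW u) (gval_EW v))[qn0 qk]] := gval_ql u v.
have [N h] := nprod_comm p_neq0 (gval_EW u) (gval_EW v) qn0 qk.
exists N => m n w; apply: val_inj; apply/funext => k; apply/funext => x.
(* [nprod_comm] is indexed by powers of z2 and z1, so the modes n and m enter as the powers - n - 1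
   and - m - 1. *)
have := h (gval w) x (gval_EW w) (gval_ql u w) (gval_ql v w)
  (fun n => gval_ql u (Yg v n w)) (fun n => gval_ql v (Yg u n w)) (- n - 1) (- m - 1).
move=> /(congr1 (fun f : lser W => f k)).
have sE (c : 'I_N.+1 -> laurent K) (c' : 'I_N.+1 -> K) (X : 'I_N.+1 -> lser W) (Z : 'I_N.+1 -> V) :
    (forall i, c i = lconst (c' i)) -> (forall i, X i k = gval (Z i) k x) ->
    (\sum_i c i *: X i) k = gval (\sum_i c' i *: Z i) k x.
  move=> cE XE; rewrite lser_sum.
  have -> : gval (\sum_i c' i *: Z i) = \sum_i c' i *: gval (Z i).
    exact: (plin_sum gval_linear).
  rewrite !fct_sumE; apply: eq_bigr => i _.
  by rewrite cE lscale_const XE.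
have cE (i : 'I_N.+1) : ((-1) ^+ i * 'C(N, i)%:R : laurent K) = lconst ((-1) ^+ i * 'C(N, i)%:R).
  by rewrite rmorphM /= rmorphXn /= rmorphN1 rmorph_nat.
pose Z1 (i : 'I_N.+1) := Yg u (m + (N - i)%N%:Z) (Yg v (n + i%:Z) w).
pose Z2 (i : 'I_N.+1) := Yg v (n + i%:Z) (Yg u (m + (N - i)%N%:Z) w).
pose X1 (i : 'I_N.+1) := Yv p (gval u) (nprod p (gval v) (- (- n - 1 - i%:Z) - 1) (gval w)) x
  (- m - 1 - (N - i)%N%:Z).
pose X2 (i : 'I_N.+1) := Yv p (gval v) (nprod p (gval u) (- (- m - 1 - (N - i)%N%:Z) - 1)
  (gval w)) x (- n - 1 - i%:Z).
have XE1 i : X1 i k = gval (Z1 i) k x.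
  apply: etrans _ (esym (nprodE p _ _ _ (gval_EW u) (gval_EW (Yg v (n + i%:Z) w)) (gval_ql u _))); rewrite /X1.
  rewrite (_ : - (- n - 1 - i%:Z) - 1 = n + i%:Z); last by lia.
  by rewrite (_ : - m - 1 - (N - i)%N%:Z = - (m + (N - i)%N%:Z) - 1); last by lia.
have XE2 i : X2 i k = gval (Z2 i) k x.
  apply: etrans _ (esym (nprodE p _ _ _ (gval_EW v) (gval_EW (Yg u (m + (N - i)%N%:Z) w)) (gval_ql v _))); rewrite /X2.
  rewrite (_ : - n - 1 - i%:Z = - (n + i%:Z) - 1); last by lia.
  by rewrite (_ : - (- m - 1 - (N - i)%N%:Z) - 1 = m + (N - i)%N%:Z); last by lia.
move=> e; apply: etrans (esym (sE _ _ X1 Z1 cE XE1)) _.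
exact: etrans e (sE _ _ X2 Z2 cE XE2).
Qed.

Lemma generated_va : vertex_algebra Yg vacg.
Proof.
split; [exact: Yg_linl|exact: Yg_linr|exact: Yg_trunc|exact: Yg_vacuum|exact: Yg_creation|].
exact: jacobi Yg_linl Yg_linr Yg_trunc Yg_vacuum Yg_creation Yg_transl Yg_locality.
Qed.

Lemma generated_cqm : coordinated_quasi_module p Yg vacg (@gval K W p S).
Proof.
split; [exact: gval_linear|exact: gval_EW|by []|move=> u v].
exact: (nprod_assoc p_neq0 (gval_EW u) (gval_EW v) (gval_ql u v)).
Qed.

End GeneratedVertexAlgebra.

Section RatioProducts.
Variables (K : numClosedFieldType) (W : lmodType K).
Implicit Types (a b : distr W) (gs : seq K).

(* The bound in z1 comes from b(z2) a(z1), the bound in z2 from a(z1) b(z2). *)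
Lemma prod_in_EW2 gs a b : in_EW a -> in_EW b -> lkills gs a b ->
  in_EW2 (ratio_mul (\prod_(g <- gs) ('X - g%:P)) (distr_prod a b)).
Proof.
move=> aE bE h; split=> [m n c u v|w].
  rewrite /ratio_mul scaler_sumr -big_split; apply: eq_bigr => i _ /=.
  by rewrite /distr_prod (bE.1 _) (aE.1 _) scalerDr !scalerA [_ * c]mulrC.
have [N aN] := aE.2 w; have [M bM] := bE.2 w.
exists (Num.min N (M - (size gs)%:Z)) => m n mn; rewrite ratio_mul_lfacs.
have [nM|nM] := ltP (n + (size gs)%:Z) M.
  by apply: lfacs_ylo nM => i j /bM; rewrite /distr_prod => ->; rewrite distr0.
have mN : m < N by lia.
have -> : (fun m n => distr_prod a b m n w) =
    (fun m n => 1 *: distr_comm a b m n w + b n (a m w)).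
  by apply/funext => i; apply/funext => j; rewrite scale1r /distr_comm subrK.
rewrite (lfacs_lin 1 gs (fun m n => distr_comm a b m n w)) h scaler0 add0r.
by apply: lfacs_xlo mN => i j /aN ->; rewrite distr0.
Qed.

Lemma gamma_gql (Gam : set K) (S : set (distr W)) a b :
  gamma_quasi_local Gam S -> S a -> S b -> gql Gam a b.
Proof.
move=> h Sa Sb; have [q /poly_roots_in_prod[gs gsG ->] e] := h a b Sa Sb.
exists gs; split=> // w m n.
have := congr1 (fun A : distr2 W => A m (n - (size gs)%:Z) w) e.
by rewrite ratio_mul_lfacs subrK.
Qed.

End RatioProducts.

(** * The group action on the generated space *)

Section GroupAction.
Variables (K : numFieldType) (W : lmodType K) (p : laurent K) (S : set (distr W)).
Variables (G : groupType) (chi chip : G -> K).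
Hypotheses (p_neq0 : p != 0) (S_closed : closed_quasi_local_subspace p (generated p S)).
Hypotheses (chiC : linear_character chi) (chipC : linear_character chip).
Hypothesis cov : forall g, phi_covariant p (chi g) (chip g).
Hypothesis S_good : good (range chip) S.
Hypothesis S_stable : gamma_stable (range chip) S.
Notation V := (generated_space p S).

Lemma character1 (c : G -> K) : linear_character c -> c 1%g = 1.
Proof.
move=> [cM c0]; apply: (mulfI (c0 1%g)).
by rewrite -cM mulr1 mulg1.
Qed.

Lemma characterV (c : G -> K) g : linear_character c -> c (g^-1)%g = (c g)^-1.
Proof.
move=> cC; have [cM c0] := cC; apply: (mulfI (c0 g)).
by rewrite -cM mulgV mulfV// character1.
Qed.

Lemma dil_dil (c e : K) (a : distr W) : dil c (dil e a) = dil (c * e) a.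
Proof. by apply/funext => n; apply/funext => w; rewrite /dil scalerA expfzMl. Qed.

Lemma dil1 (a : distr W) : dil 1 a = a.
Proof. by apply/funext => n; apply/funext => w; rewrite /dil exp1rz scale1r. Qed.

Lemma dil_id (c : K) : dil c (id_distr W) = id_distr W.
Proof.
apply/funext => n; apply/funext => w; rewrite /dil /id_distr.
by case: eqP => [->|_]; rewrite ?expr0z ?scale1r ?scaler0.
Qed.

Lemma dil_linear (c : K) : linear (@dil K W c).
Proof.
move=> e a b; apply/funext => n; apply/funext => w.
rewrite -[RHS]/(e *: (c ^ n *: a n w) + c ^ n *: b n w).
by rewrite (scaleCA e) -scalerDr.
Qed.

Lemma generated_lin (c : K) (a b : distr W) :
  generated p S a -> generated p S b -> generated p S (c *: a + b).
Proof.
have [_ [_ h] _ _] := S_closed; move=> Ga Gb; have := h c a b.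
by rewrite -!topredE /= !in_setE; exact.
Qed.

Let lam g := (chip g)^-1.
Let chip0 g : chip g != 0 := chipC.2 g.

(** Induction on generation. It starts from the stability of S, the inverse of [chip g] being again
    a value of [chip]; by [nprod_dil] a dilated product is a scalar multiple of the product of the
    dilated fields. *)
Lemma generated_dil g a : generated p S a -> generated p S (dil (lam g) a).
Proof.
have [SE Sq] := S_good.
have Gam0 c : range chip c -> c != 0 by move=> [h _ <-].
have GamV c : range chip c -> range chip c^-1.
  by move=> [h _ <-]; exists (h^-1)%g; rewrite ?characterV.
move: a; apply: (generated_ind p_neq0 Gam0 GamV S_good).
- move=> a Sa U [_ SU _]; apply/SU/S_stable => //.
  by exists (g^-1)%g; rewrite ?characterV.
- by rewrite dil_id; exact: generated_id.
- by move=> c a b _ _ ha hb; rewrite dil_linear; exact: generated_lin.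
- move=> n a b Ga Gb ha hb.
  have [GE _ Gq Gn] := S_closed.
  rewrite (nprod_dil p_neq0 (chiC.2 g) (chip0 g) (cov g) n (GE _ Ga) (GE _ Gb) (Gq _ _ Ga Gb)).
  (* Closure is available in the form c a + b, used here with b = 0, which is obtained as - a +
     a. *)
  rewrite -[_ *: _]addr0; apply: generated_lin; first exact: Gn.
  have := generated_lin (-1) ha ha; rewrite scaleN1r addNr.
  exact.
Qed.

Definition Rhog g (v : V) : V := mk_gen (generated_dil g (gval_generated v)).

Lemma Rhog_mul g h v : Rhog (g * h)%g v = Rhog g (Rhog h v).
Proof.
apply: val_inj; rewrite /= dil_dil /lam chipC.1.
by rewrite invfM.
Qed.

Lemma Rhog1 v : Rhog 1%g v = v.
Proof. by apply: val_inj; rewrite /= /lam character1// invr1 dil1. Qed.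

Lemma Rhog_eva : equivariant_vertex_algebra chi (Yg S_closed) (vacg p S) Rhog.
Proof.
split.
- exact: generated_va.
- by move=> g c u v; apply: val_inj; exact: dil_linear.
- move=> g; exists (Rhog (g^-1)%g) => v; rewrite -Rhog_mul ?mulVg ?mulgV; exact: Rhog1.
- exact: Rhog_mul.
- by move=> g; apply: val_inj; exact: dil_id.
- move=> g u v n; apply: val_inj.
  apply: etrans (nprod_dil p_neq0 (chiC.2 g) (chip0 g) (cov g) n
    (gval_EW S_closed u) (gval_EW S_closed (Rhog (g^-1)%g v)) (gval_ql S_closed u _)) _.
  have -> : dil (lam g) (gval (Rhog (g^-1)%g v)) = gval v.
    by rewrite -[RHS](congr1 _ (Rhog1 v)) -(mulgV g) Rhog_mul.
  by [].
Qed.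

End GroupAction.

Theorem theorem5p5 (R : realType) (p : laurent R[i]) (p_neq0 : p != 0)
    (G : groupType) (chi chi_phi : G -> R[i])
    (chi_char : linear_character chi) (chi_phi_char : linear_character chi_phi)
    (phi_cov : forall g, phi_covariant p (chi g) (chi_phi g))
    (chi_phi_inj : injective chi_phi)
    (W : lmodType R[i]) (S : set (distr W)) (S_sub : S `<=` @in_EW _ W)
    (S_stable : gamma_stable (range chi_phi) S)
    (S_local : gamma_quasi_local (range chi_phi) S) :
  closed_quasi_local_subspace p (generated p S) /\
  exists (Y : generated_space p S -> int -> generated_space p S ->
              generated_space p S)
         (vac : generated_space p S)
         (Rho : G -> generated_space p S -> generated_space p S),
    [/\ forall a n b, gval (Y a n b) = nprod p (gval a) n (gval b),
        gval vac = id_distr W,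
        forall g a, gval (Rho g a) = dil (chi_phi g)^-1 (gval a),
        equivariant_vertex_algebra chi Y vac Rho &
        [/\ coordinated_quasi_module p Y vac (@gval _ W p S),
            injective (@gval _ W p S) &
            equivariant_module chi_phi Rho (@gval _ W p S)]].
Proof.
pose Gam := range chi_phi.
have Gam0 c : Gam c -> c != 0 by move=> [h _ <-]; exact: chi_phi_char.2.
have GamV c : Gam c -> Gam c^-1.
  by move=> [h _ <-]; exists (h^-1)%g; rewrite ?(characterV _ chi_phi_char).
have S_good : good Gam S by split=> // a b; exact: gamma_gql.
have S_closed := generated_closed p_neq0 Gam0 GamV S_good.
split=> //; exists (Yg S_closed), (vacg p S).
exists (Rhog p_neq0 S_closed chi_char chi_phi_char phi_cov S_good S_stable).
split=> //; first exact: Rhog_eva.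
split; [exact: generated_cqm|exact: val_inj|split=> // u v].
have [gs [gsG h]] := generated_gql p_neq0 Gam0 GamV S_good
  (gval_generated u) (gval_generated v).
exists (\prod_(g <- gs) ('X - g%:P)); first exact: poly_roots_in_factors.
by apply: prod_in_EW2 h; exact: gval_EW.
Qed.
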